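(* Let $(H,R)$ be a finite dimensional quasi-triangular quasi-Hopf algebra, $\underline H$ the associated enveloping algebra braided group of $H$, $(\underline H)^*$ the dual Hopf algebra structure of $\underline H$ in ${}_H\mathcal M$ (on the categorical left dual of $\underline H$), and $\underline{H^*}$ the function algebra braided group associated to $H^*$. Then the map $\lambda:(\underline H)^*\to\underline{H^*}$ given for all $\chi\in H^*$ by $$\lambda(\chi)=S^{-1}(g^1)\rightharpoonup\chi\circ S\leftharpoonup g^2,$$ i.e. $\lambda(\chi)(h)=\chi\big(g^1S(g^2h)\big)$ for $h\in H$, is a braided Hopf algebra isomorphism (an isomorphism of Hopf algebras in ${}_H\mathcal M$), where $g^1\otimes g^2$ is the inverse of the Drinfeld twist $f$.
   Context: All vector spaces and tensor products are over a fixed field $k$. **Quasi-Hopf algebras.** A quasi-bialgebra $(H,\Delta,\varepsilon,\Phi)$ is a unital associative algebra $H$ with an invertible $\Phi\in H^{\otimes 3}$ and algebra maps $\Delta:H\to H\otimes H$, $\varepsilon:H\to k$ such that $(id\otimes\Delta)(\Delta(h))=\Phi(\Delta\otimes id)(\Delta(h))\Phi^{-1}$, $(id\otimes\varepsilon)\Delta(h)=h=(\varepsilon\otimes id)\Delta(h)$, $(1\otimes\Phi)(id\otimes\Delta\otimes id)(\Phi)(\Phi\otimes 1)=(id\otimes id\otimes\Delta)(\Phi)(\Delta\otimes id\otimes id)(\Phi)$, $(id\otimes\varepsilon\otimes id)(\Phi)=1\otimes 1$. Write (summation understood) $\Delta(h)=h_1\otimes h_2$; $\Phi=X^1\otimes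 X^2\otimes X^3=Y^1\otimes Y^2\otimes Y^3=\cdots$ and $\Phi^{-1}=x^1\otimes x^2\otimes x^3=y^1\otimes y^2\otimes y^3=\cdots$ (different letters denote independent copies; e.g. $X^2_1\otimes X^2_2=\Delta(X^2)$). It is a quasi-Hopf algebra if there are an algebra anti-endomorphism $S$ of $H$ and $\alpha,\beta\in H$ with $S(h_1)\alpha h_2=\varepsilon(h)\alpha$, $h_1\beta S(h_2)=\varepsilon(h)\beta$, $X^1\beta S(X^2)\alpha X^3=1$, $S(x^1)\alpha x^2\beta S(x^3)=1$; normalized so that $\varepsilon(\alpha)=\varepsilon(\beta)=1$. $S$ is automatically bijective if $H$ is finite dimensional or quasi-triangular. **Special elements.** Put $A^1\otimes\cdots\otimes A^4=(\Phi\otimes1)(\Delta\otimes id\otimes id)(\Phi^{-1})$, $B^1\otimes\cdots\otimes B^4=(\Delta\otimes id\otimes id)(\Phi)(\Phi^{-1}\otimes 1)$, $\gamma=S(A^2)\alpha A^3\otimes S(A^1)\alpha A^4$, $\delta=B^1\beta S(B^4)\otimes B^2\beta S(B^3)$. With $\Delta^{op}(h)=h_2\otimes h_1$, the Drinfeld twist is $f=f^1\otimes f^2=(S\otimes S)(\Delta^{op}(x^1))\,\gamma\,\Delta(x^2\beta S(x^3))$, with inverse $f^{-1}=g^1\otimes g^2=\Delta(S(x^1)\alpha x^2)\,\delta\,(S\otimes S)(\Delta^{op}(x^3))$. Further $p_R=p^1\otimes p^2=x^1\otimes x^2\beta S(x^3)$, $q_R=q^1\otimes q^2=X^1\otimes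 S^{-1}(\alpha X^3)X^2$, $p_L=\tilde p^1\otimes\tilde p^2=X^2S^{-1}(X^1\beta)\otimes X^3$. **Quasi-triangular (QT).** $(H,R)$ is QT if $R=R^1\otimes R^2\in H\otimes H$ satisfies $(\Delta\otimes id)(R)=\Phi_{312}R_{13}\Phi^{-1}_{132}R_{23}\Phi$, $(id\otimes\Delta)(R)=\Phi^{-1}_{231}R_{13}\Phi_{213}R_{12}\Phi^{-1}$, $\Delta^{op}(h)R=R\Delta(h)$, $(\varepsilon\otimes id)(R)=(id\otimes\varepsilon)(R)=1$, where $\Phi_{\sigma(1)\sigma(2)\sigma(3)}=X^{\sigma^{-1}(1)}\otimes X^{\sigma^{-1}(2)}\otimes X^{\sigma^{-1}(3)}$ and $R_{ij}$ is $R$ in the $i$-th and $j$-th positions. $R$ is invertible; $R^{-1}=\overline R^1\otimes\overline R^2$; $r^1\otimes r^2$ denotes another copy of $R$. **Braided category ${}_H\mathcal M$.** Left $H$-modules, tensor product via $\Delta$, unit $k$ (via $\varepsilon$), associativity $(u\otimes v)\otimes w\mapsto\Phi\cdot(u\otimes(v\otimes w))$, braiding $c_{U,V}(u\otimes v)=R^2\cdot v\otimes R^1\cdot u$. **$\underline H$**: the vector space $H$ with $H$-action $h\triangleright h'=h_1h'S(h_2)$, product $h\bullet h'=X^1hS(x^1X^2)\alpha x^2X^3_1h'S(x^3X^3_2)$, unit $\beta$, coproduct $\underline\Delta(h)=h_{\underline1}\otimes h_{\underline2}=x^1X^1h_1g^1S(x^2R^2y^3X^3_2)\otimes x^3R^1\triangleright\big(y^1X^2h_2g^2S(y^2X^3_1)\big)$,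 counit $\varepsilon$, antipode $\underline S(h)=X^1R^2p^2S\big(q^1(X^2R^1p^1\triangleright h)S(q^2)X^3\big)$. **$(\underline H)^*$**: the vector space $H^*$ with $H$-action $(h\succ\chi)(h')=\chi(S(h)\triangleright h')$; product $(\chi*\psi)(h)=\langle\chi,f^2\triangleright h_{\underline2}\rangle\langle\psi,f^1\triangleright h_{\underline1}\rangle$; unit $\varepsilon$; coproduct $\chi\mapsto\sum_{i,j}\langle\chi,(g^1\triangleright e_i)\bullet(g^2\triangleright e_j)\rangle\,e^j\otimes e^i$ for dual bases $\{e_i\},\{e^i\}$ of $H,H^*$; counit $\chi\mapsto\chi(\beta)$; antipode $\chi\mapsto\chi\circ\underline S$. **$\underline{H^*}$**: the vector space $H^*$, where $\langle h'\rightharpoonup\chi\leftharpoonup h'',h\rangle=\chi(h''hh')$, $\chi_1(h)\chi_2(h')=\chi(hh')$, and juxtaposition of functionals is convolution $(\chi\psi)(h)=\chi(h_1)\psi(h_2)$. $H$-action $h\blacktriangleright\chi=h_2\rightharpoonup\chi\leftharpoonup S(h_1)$; product $\chi\,\underline\cdot\,\psi=[x^3_1Y^2r^1y^1X^2\rightharpoonup\chi\leftharpoonup S(x^1X^1)f^2R^1]\,[x^3_2Y^3y^3X^3_2\rightharpoonup\psi\leftharpoonup S(x^2Y^1r^2y^2X^3_1)f^1R^2]$; unit $\varepsilon$; coproduct $\underline\Delta(\chi)=\chi_1\leftharpoonup S(x^1)\otimes x^3_2X^3\rightharpoonup\chi_2\leftharpoonup x^2X^1\beta S(x^3_1X^2)$;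 counit $\chi\mapsto\chi(\alpha)$; antipode $\underline S(\chi)=q^1_2\overline R^1_2\tilde p^2\rightharpoonup(\chi\circ S)\leftharpoonup q^2\overline R^2S(q^1_1\overline R^1_1\tilde p^1)$. *)

(* Defs.v *)
From HB Require Import structures.
From mathcomp Require Import all_boot all_order all_algebra all_field.

Set Implicit Arguments.
Unset Strict Implicit.
Unset Printing Implicit Defensive.

Import GRing.Theory.
Local Open Scope ring_scope.

(* V ⊗ W is realised by coordinate matrices in the library bases of V and W.  *)
(* tsum t E is the value at t of the linear map induced by a bilinear E, i.e. *)
(* the sum that Sweedler notation leaves implicit: for bilinear E,            *)
(*   tsum (u ⊗ v) E = E u v             (tsum_pure),                          *)
(* and every tensor is a sum of pure ones (tensor_ind).                       *)
Definition tensor (K : fieldType) (V W : vectType K) : Type :=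
  'M[K]_(\dim {:V}, \dim {:W}).

Notation "V ⊗ W" := (tensor V W) (at level 40, left associativity) : type_scope.

HB.instance Definition _ (K : fieldType) (V W : vectType K) :=
  Vector.copy (V ⊗ W)%type 'M[K]_(\dim {:V}, \dim {:W}).

Definition pure_tensor (K : fieldType) (V W : vectType K) (u : V) (v : W) :
    (V ⊗ W)%type :=
  \matrix_(i, j) (coord (vbasis {:V}) i u * coord (vbasis {:W}) j v).

Notation "u ⊗ v" := (pure_tensor u v) (at level 40, left associativity) : ring_scope.

Definition tsum (K : fieldType) (V W : vectType K) (U : lmodType K)
    (t : (V ⊗ W)%type) (E : V -> W -> U) : U :=
  \sum_i \sum_j (t : 'M_(_, _)) i j *: E (vbasis {:V})`_i (vbasis {:W})`_j.

(* V1 ⊗ V2 ⊗ V3 associates to the left, and so do the n-fold sums. *)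
Notation "\tsum_ ( a ⊗ b <- t ) E" := (tsum t (fun a b => E))
  (at level 41, a name, b name, t at level 200, E at level 41, right associativity,
   format "'[' \tsum_ ( a  ⊗  b  <-  t ) '/  '  E ']'") : ring_scope.
Notation "\tsum_ ( a ⊗ b ⊗ c <- t ) E" :=
  (tsum t (fun ab c => tsum ab (fun a b => E)))
  (at level 41, a name, b name, c name, t at level 200, E at level 41, right associativity,
   format "'[' \tsum_ ( a  ⊗  b  ⊗  c  <-  t ) '/  '  E ']'") : ring_scope.
Notation "\tsum_ ( a ⊗ b ⊗ c ⊗ d <- t ) E" :=
  (tsum t (fun abc d => tsum abc (fun ab c => tsum ab (fun a b => E))))
  (at level 41, a name, b name, c name, d name, t at level 200, E at level 41,
   right associativity,
   format "'[' \tsum_ ( a  ⊗  b  ⊗  c  ⊗  d  <-  t ) '/  '  E ']'") : ring_scope.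

Section TensorTheory.
Variables (K : fieldType) (V W : vectType K).

Definition bilinear_fun (U : lmodType K) (E : V -> W -> U) : Prop :=
  (forall w, linear (E^~ w)) /\ (forall v, linear (E v)).

Lemma pure_tensor_bilinear : bilinear_fun (@pure_tensor K V W).
Proof.
split=> x a u v; apply/matrixP=> i j; rewrite !mxE linearP.
  by rewrite mulrDl mulrA.
by rewrite mulrDr mulrCA.
Qed.

Lemma tsum_linear (U : lmodType K) (E : V -> W -> U) : linear (fun t => tsum t E).
Proof.
move=> a s t; rewrite /tsum scaler_sumr -big_split; apply: eq_bigr => i _ /=.
rewrite scaler_sumr -big_split; apply: eq_bigr => j _ /=.
by rewrite !mxE scalerDl scalerA.
Qed.

Lemma tsum_pure (U : lmodType K) (E : V -> W -> U) u v :
  bilinear_fun E -> tsum (u ⊗ v) E = E u v.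
Proof.
case=> El Er.
have E0l w : E 0 w = 0 by have := El w (-1) 0 0; rewrite scaler0 addr0 scaleN1r addNr.
have E0r w : E w 0 = 0 by have := Er w (-1) 0 0; rewrite scaler0 addr0 scaleN1r addNr.
have Esl (n : nat) (F : 'I_n -> K) (G : 'I_n -> V) w :
    E (\sum_i F i *: G i) w = \sum_i F i *: E (G i) w.
  apply: (big_ind2 (fun x y => E x w = y)) => [|x1 x2 y1 y2 <- <-|i _] //.
    by rewrite -[x1]scale1r El !scale1r.
  by rewrite -[_ *: _]addr0 El E0l addr0.
have Esr (n : nat) (F : 'I_n -> K) (G : 'I_n -> W) w :
    E w (\sum_i F i *: G i) = \sum_i F i *: E w (G i).
  apply: (big_ind2 (fun x y => E w x = y)) => [|x1 x2 y1 y2 <- <-|i _] //.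
    by rewrite -[x1]scale1r Er !scale1r.
  by rewrite -[_ *: _]addr0 Er E0r addr0.
rewrite [u in RHS](coord_vbasis (memvf u)) [v in RHS](coord_vbasis (memvf v)).
rewrite Esl; apply: eq_bigr => i _; rewrite Esr scaler_sumr.
by apply: eq_bigr => j _; rewrite !mxE scalerA.
Qed.

Lemma tensorE (t : (V ⊗ W)%type) : t = \tsum_(u ⊗ v <- t) u ⊗ v.
Proof.
rewrite [LHS](matrix_sum_delta (t : 'M_(_, _))); apply: eq_bigr => i _.
apply: eq_bigr => j _; congr (_ *: _); apply/matrixP => i' j'.
rewrite !mxE !coord_free ?(basis_free (vbasisP _)) //.
by rewrite -natrM mulnb ![_ == i]eq_sym ![_ == j]eq_sym.
Qed.

Lemma tensor_ind (P : (V ⊗ W)%type -> Prop) :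
  (forall u v, P (u ⊗ v)) -> (forall s t, P s -> P t -> P (s + t)) ->
  forall t, P t.
Proof.
have [Bl Br] := pure_tensor_bilinear.
move=> Pp PD t; rewrite [t]tensorE /tsum.
have P0 : P 0.
  have -> : 0 = 0 ⊗ 0 :> (V ⊗ W)%type; last exact: Pp.
  by apply/matrixP=> i j; rewrite !mxE linear0 mul0r.
elim/big_ind: _ => // i _; elim/big_ind: _ => // j _.
set a := (t : 'M_(_, _)) i j; set u := _`_i; set v := _`_j.
have -> : a *: (u ⊗ v) = (a *: u) ⊗ v; last exact: Pp.
by apply/matrixP=> i' j'; rewrite !mxE linearZ mulrA.
Qed.
End TensorTheory.

Section TensorAlgebra.
Variables (K : fieldType) (A B : falgType K).
Implicit Types s t u : (A ⊗ B)%type.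

Definition tensor_one : (A ⊗ B)%type := 1 ⊗ 1.

Definition tensor_mul s t : (A ⊗ B)%type :=
  \tsum_(a ⊗ b <- s) \tsum_(c ⊗ d <- t) (a * c) ⊗ (b * d).

Lemma tensor_mul_linearl t : linear (tensor_mul^~ t).
Proof. exact: tsum_linear. Qed.

Lemma tensor_mul_linearr s : linear (tensor_mul s).
Proof.
move=> a t u; rewrite /tensor_mul {1 3 5}/tsum scaler_sumr -big_split.
apply: eq_bigr => i _ /=; rewrite scaler_sumr -big_split; apply: eq_bigr => j _ /=.
by rewrite tsum_linear scalerDr !scalerA mulrC.
Qed.

Lemma tensor_mul_pure (a c : A) (b d : B) :
  tensor_mul (a ⊗ b) (c ⊗ d) = (a * c) ⊗ (b * d).
Proof.
have [Pl Pr] := @pure_tensor_bilinear K A B.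
have bil (x : A) (y : B) : bilinear_fun (fun c d => (x * c) ⊗ (y * d)).
  by split=> [w|v] k p q; rewrite mulrDr -scalerAr ?Pl ?Pr.
rewrite /tensor_mul tsum_pure ?tsum_pure //; split=> [w|v] k p q.
  by rewrite !tsum_pure // mulrDl -scalerAl Pl.
by rewrite !tsum_pure // mulrDl -scalerAl Pr.
Qed.

Lemma tensor_mulDl : left_distributive tensor_mul +%R.
Proof. by move=> s t u; rewrite -[s]scale1r tensor_mul_linearl !scale1r. Qed.

Lemma tensor_mulDr : right_distributive tensor_mul +%R.
Proof. by move=> s t u; rewrite -[t]scale1r tensor_mul_linearr !scale1r. Qed.

Lemma tensor_mulA : associative tensor_mul.
Proof.
move=> s t u; elim/tensor_ind: s => [a b|s s' IH IH']; last first.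
  by rewrite !tensor_mulDl IH IH'.
elim/tensor_ind: t => [c d|t t' IH IH']; last first.
  by rewrite tensor_mulDl !tensor_mulDr tensor_mulDl IH IH'.
elim/tensor_ind: u => [e f|u u' IH IH']; last by rewrite !tensor_mulDr IH IH'.
by rewrite !tensor_mul_pure !mulrA.
Qed.

Lemma tensor_mul1l : left_id tensor_one tensor_mul.
Proof.
move=> t; elim/tensor_ind: t => [a b|t t' IH IH']; last by rewrite tensor_mulDr IH IH'.
by rewrite tensor_mul_pure !mul1r.
Qed.

Lemma tensor_mul1r : right_id tensor_one tensor_mul.
Proof.
move=> t; elim/tensor_ind: t => [a b|t t' IH IH']; last by rewrite tensor_mulDl IH IH'.
by rewrite tensor_mul_pure !mulr1.
Qed.

Lemma tensor_one_neq0 : tensor_one != 0.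
Proof.
apply/eqP => /matrixP tens0.
have basis0 (C : falgType K) : exists i, coord (vbasis {:C}) i 1 != 0.
  apply/existsP; apply: contra_neqT (oner_neq0 C); rewrite negb_exists => /forallP H.
  rewrite [LHS](coord_vbasis (memvf _)) big1 // => i _.
  by move: (H i); rewrite negbK => /eqP ->; rewrite scale0r.
have [[i ni] [j nj]] := (basis0 A, basis0 B).
have := tens0 i j; rewrite !mxE => /eqP; rewrite mulf_eq0.
by rewrite (negPf ni) (negPf nj).
Qed.

Lemma tensor_scaleAl (k : K) s t : k *: tensor_mul s t = tensor_mul (k *: s) t.
Proof.
have m0 : tensor_mul 0 t = 0.
  by have := tensor_mul_linearl t (-1) 0 0; rewrite scaler0 addr0 scaleN1r addNr.
by rewrite -[k *: s]addr0 tensor_mul_linearl m0 addr0.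
Qed.

Lemma tensor_scaleAr (k : K) s t : k *: tensor_mul s t = tensor_mul s (k *: t).
Proof.
have m0 : tensor_mul s 0 = 0.
  by have := tensor_mul_linearr s (-1) 0 0; rewrite scaler0 addr0 scaleN1r addNr.
by rewrite -[k *: t]addr0 tensor_mul_linearr m0 addr0.
Qed.
End TensorAlgebra.

HB.instance Definition _ (K : fieldType) (A B : falgType K) :=
  GRing.Zmodule_isNzRing.Build (A ⊗ B)%type (@tensor_mulA K A B) (@tensor_mul1l K A B)
    (@tensor_mul1r K A B) (@tensor_mulDl K A B) (@tensor_mulDr K A B)
    (@tensor_one_neq0 K A B).
HB.instance Definition _ (K : fieldType) (A B : falgType K) :=
  GRing.Lmodule_isLalgebra.Build K (A ⊗ B)%type (@tensor_scaleAl K A B).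
HB.instance Definition _ (K : fieldType) (A B : falgType K) :=
  GRing.Lalgebra_isAlgebra.Build K (A ⊗ B)%type (@tensor_scaleAr K A B).
HB.instance Definition _ (K : fieldType) (A B : falgType K) :=
  Algebra_isFalgebra.Build K (A ⊗ B)%type.

Lemma tensor1E (K : fieldType) (A B : falgType K) : 1 = 1 ⊗ 1 :> (A ⊗ B)%type.
Proof. by []. Qed.

Lemma pure_tensorM (K : fieldType) (A B : falgType K) (a c : A) (b d : B) :
  (a ⊗ b) * (c ⊗ d) = (a * c) ⊗ (b * d).
Proof. exact: tensor_mul_pure. Qed.

Section TensorMaps.
Variable K : fieldType.

Definition tmap (V W V' W' : vectType K) (f : V -> V') (g : W -> W')
    (t : (V ⊗ W)%type) : (V' ⊗ W')%type :=
  \tsum_(a ⊗ b <- t) f a ⊗ g b.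

Definition tflip (V W : vectType K) (t : (V ⊗ W)%type) : (W ⊗ V)%type :=
  \tsum_(a ⊗ b <- t) b ⊗ a.

Variable H : falgType K.

(* legσ t is t_{σ(1)σ(2)σ(3)} = t^{σ^-1(1)} ⊗ t^{σ^-1(2)} ⊗ t^{σ^-1(3)}. *)
Definition leg312 (t : (H ⊗ H ⊗ H)%type) : (H ⊗ H ⊗ H)%type :=
  \tsum_(a ⊗ b ⊗ c <- t) b ⊗ c ⊗ a.
Definition leg132 (t : (H ⊗ H ⊗ H)%type) : (H ⊗ H ⊗ H)%type :=
  \tsum_(a ⊗ b ⊗ c <- t) a ⊗ c ⊗ b.
Definition leg231 (t : (H ⊗ H ⊗ H)%type) : (H ⊗ H ⊗ H)%type :=
  \tsum_(a ⊗ b ⊗ c <- t) c ⊗ a ⊗ b.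
Definition leg213 (t : (H ⊗ H ⊗ H)%type) : (H ⊗ H ⊗ H)%type :=
  \tsum_(a ⊗ b ⊗ c <- t) b ⊗ a ⊗ c.

Definition leg12 (t : (H ⊗ H)%type) : (H ⊗ H ⊗ H)%type :=
  \tsum_(a ⊗ b <- t) a ⊗ b ⊗ 1.
Definition leg13 (t : (H ⊗ H)%type) : (H ⊗ H ⊗ H)%type :=
  \tsum_(a ⊗ b <- t) a ⊗ 1 ⊗ b.
Definition leg23 (t : (H ⊗ H)%type) : (H ⊗ H ⊗ H)%type :=
  \tsum_(a ⊗ b <- t) 1 ⊗ a ⊗ b.
End TensorMaps.

Record quasiBialgebra (K : fieldType) (H : falgType K) := QuasiBialgebra {
  Delta : {lrmorphism H -> (H ⊗ H)%type};
  eps : {lrmorphism H -> K^o};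
  Phi : (H ⊗ H ⊗ H)%type;
  Phi_unit : Phi \is a GRing.unit;
  quasi_coassoc : forall h : H,
    \tsum_(h1 ⊗ h2 <- Delta h) \tsum_(h21 ⊗ h22 <- Delta h2) h1 ⊗ h21 ⊗ h22 =
    Phi * (\tsum_(h1 ⊗ h2 <- Delta h) Delta h1 ⊗ h2) * Phi^-1;
  counitr : forall h : H, \tsum_(h1 ⊗ h2 <- Delta h) eps h2 *: h1 = h;
  counitl : forall h : H, \tsum_(h1 ⊗ h2 <- Delta h) eps h1 *: h2 = h;
  Phi_cocycle :
    (\tsum_(X1 ⊗ X2 ⊗ X3 <- Phi) 1 ⊗ X1 ⊗ X2 ⊗ X3)
      * (\tsum_(X1 ⊗ X2 ⊗ X3 <- Phi)
           \tsum_(X21 ⊗ X22 <- Delta X2) X1 ⊗ X21 ⊗ X22 ⊗ X3)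
      * (Phi ⊗ 1) =
    (\tsum_(X1 ⊗ X2 ⊗ X3 <- Phi)
       \tsum_(X31 ⊗ X32 <- Delta X3) X1 ⊗ X2 ⊗ X31 ⊗ X32)
      * (\tsum_(X1 ⊗ X2 ⊗ X3 <- Phi) Delta X1 ⊗ X2 ⊗ X3);
  Phi_counit : \tsum_(X1 ⊗ X2 ⊗ X3 <- Phi) eps X2 *: (X1 ⊗ X3) = 1 ⊗ 1
}.

Record quasiHopf (K : fieldType) (H : falgType K) := QuasiHopf {
  quasi_bialgebra :> quasiBialgebra H;
  antipode : 'End(H);
  antipode1 : antipode 1 = 1;
  antipodeM : forall h h' : H, antipode (h * h') = antipode h' * antipode h;
  alpha : H;
  beta : H;
  antipode_alpha : forall h : H,
    \tsum_(h1 ⊗ h2 <- Delta quasi_bialgebra h) antipode h1 * alpha * h2 =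
    eps quasi_bialgebra h *: alpha;
  antipode_beta : forall h : H,
    \tsum_(h1 ⊗ h2 <- Delta quasi_bialgebra h) h1 * beta * antipode h2 =
    eps quasi_bialgebra h *: beta;
  Phi_antipode : \tsum_(X1 ⊗ X2 ⊗ X3 <- Phi quasi_bialgebra)
    X1 * beta * antipode X2 * alpha * X3 = 1;
  Phi_inv_antipode : \tsum_(x1 ⊗ x2 ⊗ x3 <- (Phi quasi_bialgebra)^-1)
    antipode x1 * alpha * x2 * beta * antipode x3 = 1;
  eps_alpha : eps quasi_bialgebra alpha = 1;
  eps_beta : eps quasi_bialgebra beta = 1
}.

Record quasiTriangular (K : fieldType) (H : falgType K) (Q : quasiBialgebra H)
    (R : (H ⊗ H)%type) : Prop := QuasiTriangular {
  Delta_id_R : \tsum_(R1 ⊗ R2 <- R) Delta Q R1 ⊗ R2 =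
    leg312 (Phi Q) * leg13 R * leg132 (Phi Q)^-1 * leg23 R * Phi Q;
  id_Delta_R :
    \tsum_(R1 ⊗ R2 <- R) \tsum_(R21 ⊗ R22 <- Delta Q R2) R1 ⊗ R21 ⊗ R22 =
    leg231 (Phi Q)^-1 * leg13 R * leg213 (Phi Q) * leg12 R * (Phi Q)^-1;
  Delta_op_R : forall h : H, tflip (Delta Q h) * R = R * Delta Q h;
  eps_id_R : \tsum_(R1 ⊗ R2 <- R) eps Q R1 *: R2 = 1;
  id_eps_R : \tsum_(R1 ⊗ R2 <- R) eps Q R2 *: R1 = 1
}.

(* The structure maps, without the axioms, of a Hopf algebra in the category  *)
(* of left H-modules; a morphism of Hopf algebras only involves these maps.   *)
Record hopfData (K : fieldType) (H : falgType K) (V : vectType K) := HopfData {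
  h_act : H -> V -> V;
  h_mul : V -> V -> V;
  h_one : V;
  h_comul : V -> (V ⊗ V)%type;
  h_counit : V -> K;
  h_antipode : V -> V
}.

Record hopfIso (K : fieldType) (H : falgType K) (V W : vectType K)
    (A : hopfData H V) (B : hopfData H W) (f : V -> W) : Prop := HopfIso {
  iso_linear : linear f;
  iso_bij : bijective f;
  iso_act : forall h v, f (h_act A h v) = h_act B h (f v);
  iso_mul : forall u v, f (h_mul A u v) = h_mul B (f u) (f v);
  iso_one : f (h_one A) = h_one B;
  iso_comul : forall v, tmap f f (h_comul A v) = h_comul B (f v);
  iso_counit : forall v, h_counit B (f v) = h_counit A v;
  iso_antipode : forall v, f (h_antipode A v) = h_antipode B (f v)
}.

Section BraidedGroups.
Variables (K : fieldType) (H : falgType K) (Q : quasiHopf H) (R : (H ⊗ H)%type).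
Local Notation Delta := (Delta Q).
Local Notation eps := (eps Q).
Local Notation Phi := (Phi Q).
Local Notation S := (antipode Q).
Local Notation alpha := (alpha Q).
Local Notation beta := (beta Q).
Local Notation dualH := 'Hom(H, K^o).

(* S is bijective and R is invertible because H is finite dimensional and     *)
(* (H, R) quasi-triangular, and the Drinfeld twist is always invertible, so   *)
(* the total inverses of the library are genuine ones here and below.         *)
Definition Sinv : 'End(H) := (S^-1)%VF.

Definition drinfeld_gamma : (H ⊗ H)%type :=
  \tsum_(A1 ⊗ A2 ⊗ A3 ⊗ A4 <-
      (Phi ⊗ 1) * \tsum_(x1 ⊗ x2 ⊗ x3 <- Phi^-1) (Delta x1 ⊗ x2 ⊗ x3))
    (S A2 * alpha * A3) ⊗ (S A1 * alpha * A4).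

Definition drinfeld_twist : (H ⊗ H)%type :=
  \tsum_(x1 ⊗ x2 ⊗ x3 <- Phi^-1)
    (tmap S S (tflip (Delta x1)) * drinfeld_gamma * Delta (x2 * beta * S x3)).

Definition pR : (H ⊗ H)%type :=
  \tsum_(x1 ⊗ x2 ⊗ x3 <- Phi^-1) x1 ⊗ (x2 * beta * S x3).
Definition qR : (H ⊗ H)%type :=
  \tsum_(X1 ⊗ X2 ⊗ X3 <- Phi) X1 ⊗ (Sinv (alpha * X3) * X2).
Definition pL : (H ⊗ H)%type :=
  \tsum_(X1 ⊗ X2 ⊗ X3 <- Phi) (X2 * Sinv (X1 * beta)) ⊗ X3.

Local Notation f := drinfeld_twist.

(* env_group is the enveloping algebra braided group \underline{H},           *)
(* env_group_dual its categorical left dual (\underline{H})^*, and fun_group  *)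
(* the function algebra braided group \underline{H^*}; ad h h' is h ▷ h'.     *)
Definition ad (h h' : H) : H :=
  \tsum_(h1 ⊗ h2 <- Delta h) h1 * h' * S h2.

Definition env_mul (h h' : H) : H :=
  \tsum_(X1 ⊗ X2 ⊗ X3 <- Phi) \tsum_(x1 ⊗ x2 ⊗ x3 <- Phi^-1)
  \tsum_(X31 ⊗ X32 <- Delta X3)
    X1 * h * S (x1 * X2) * alpha * x2 * X31 * h' * S (x3 * X32).

Definition env_comul (h : H) : (H ⊗ H)%type :=
  \tsum_(x1 ⊗ x2 ⊗ x3 <- Phi^-1) \tsum_(X1 ⊗ X2 ⊗ X3 <- Phi)
  \tsum_(h1 ⊗ h2 <- Delta h) \tsum_(g1 ⊗ g2 <- f^-1)
  \tsum_(R1 ⊗ R2 <- R) \tsum_(y1 ⊗ y2 ⊗ y3 <- Phi^-1)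
  \tsum_(X31 ⊗ X32 <- Delta X3)
    (x1 * X1 * h1 * g1 * S (x2 * R2 * y3 * X32))
    ⊗ ad (x3 * R1) (y1 * X2 * h2 * g2 * S (y2 * X31)).

Definition env_antipode (h : H) : H :=
  \tsum_(X1 ⊗ X2 ⊗ X3 <- Phi) \tsum_(R1 ⊗ R2 <- R)
  \tsum_(p1 ⊗ p2 <- pR) \tsum_(q1 ⊗ q2 <- qR)
    X1 * R2 * p2 * S (q1 * ad (X2 * R1 * p1) h * S q2 * X3).

Definition env_group : hopfData H H :=
  HopfData ad env_mul beta env_comul eps env_antipode.

(* Every function passed to linfun below is linear, so linfun f is f.         *)
Definition dual_basis (i : 'I_(\dim {:H})) : dualH :=
  linfun (fun h => coord (vbasis {:H}) i h : K^o).

Definition dual_act (h : H) (chi : dualH) : dualH :=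
  linfun (fun h' => chi (h_act env_group (S h) h')).

Definition dual_mul (chi psi : dualH) : dualH :=
  linfun (fun h =>
    \tsum_(f1 ⊗ f2 <- f) \tsum_(h1 ⊗ h2 <- h_comul env_group h)
      chi (h_act env_group f2 h2) * psi (h_act env_group f1 h1)).

Definition dual_comul (chi : dualH) : (dualH ⊗ dualH)%type :=
  \sum_(i < \dim {:H}) \sum_(j < \dim {:H})
    (\tsum_(g1 ⊗ g2 <- f^-1)
       chi (h_mul env_group (h_act env_group g1 (vbasis {:H})`_i)
                            (h_act env_group g2 (vbasis {:H})`_j)) : K)
    *: (dual_basis j ⊗ dual_basis i).

Definition dual_antipode (chi : dualH) : dualH :=
  linfun (fun h => chi (h_antipode env_group h)).

Definition env_group_dual : hopfData H dualH :=
  HopfData dual_act dual_mul (linfun eps) dual_comul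
    (fun chi => chi (h_one env_group)) dual_antipode.

(* hits a chi b is a ⇀ chi ↼ b. *)
Definition hits (a : H) (chi : dualH) (b : H) : dualH :=
  linfun (fun h => chi (b * h * a)).

Definition convolution (chi psi : dualH) : dualH :=
  linfun (fun h => \tsum_(h1 ⊗ h2 <- Delta h) chi h1 * psi h2).

(* chi_1 ⊗ chi_2 with chi_1(h) chi_2(h') = chi(h h'). *)
Definition mul_transpose (chi : dualH) : (dualH ⊗ dualH)%type :=
  \sum_(i < \dim {:H}) \sum_(j < \dim {:H}) (chi ((vbasis {:H})`_i * (vbasis {:H})`_j) : K)
    *: (dual_basis i ⊗ dual_basis j).

Definition fun_act (h : H) (chi : dualH) : dualH :=
  \tsum_(h1 ⊗ h2 <- Delta h) hits h2 chi (S h1).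

Definition fun_mul (chi psi : dualH) : dualH :=
  \tsum_(x1 ⊗ x2 ⊗ x3 <- Phi^-1) \tsum_(x31 ⊗ x32 <- Delta x3)
  \tsum_(Y1 ⊗ Y2 ⊗ Y3 <- Phi) \tsum_(r1 ⊗ r2 <- R)
  \tsum_(y1 ⊗ y2 ⊗ y3 <- Phi^-1)
  \tsum_(X1 ⊗ X2 ⊗ X3 <- Phi) \tsum_(X31 ⊗ X32 <- Delta X3)
  \tsum_(f1 ⊗ f2 <- f) \tsum_(R1 ⊗ R2 <- R)
    convolution
      (hits (x31 * Y2 * r1 * y1 * X2) chi (S (x1 * X1) * f2 * R1))
      (hits (x32 * Y3 * y3 * X32) psi (S (x2 * Y1 * r2 * y2 * X31) * f1 * R2)).

Definition fun_comul (chi : dualH) : (dualH ⊗ dualH)%type :=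
  \tsum_(chi1 ⊗ chi2 <- mul_transpose chi)
  \tsum_(x1 ⊗ x2 ⊗ x3 <- Phi^-1) \tsum_(x31 ⊗ x32 <- Delta x3)
  \tsum_(X1 ⊗ X2 ⊗ X3 <- Phi)
    hits 1 chi1 (S x1) ⊗ hits (x32 * X3) chi2 (x2 * X1 * beta * S (x31 * X2)).

Definition fun_antipode (chi : dualH) : dualH :=
  \tsum_(q1 ⊗ q2 <- qR) \tsum_(q11 ⊗ q12 <- Delta q1)
  \tsum_(Ri1 ⊗ Ri2 <- R^-1) \tsum_(Ri11 ⊗ Ri12 <- Delta Ri1)
  \tsum_(p1 ⊗ p2 <- pL)
    hits (q12 * Ri12 * p2) (chi \o S)%VF (q2 * Ri2 * S (q11 * Ri11 * p1)).

Definition fun_group : hopfData H dualH :=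
  HopfData fun_act fun_mul (linfun eps) fun_comul (fun chi => chi alpha)
    fun_antipode.

Definition lambda (chi : dualH) : dualH :=
  \tsum_(g1 ⊗ g2 <- f^-1) hits (Sinv g1) (chi \o S)%VF g2.
End BraidedGroups.

(* Main.v *)
(* lambda chi is chi \o T for T x = g^1 S(g^2 x), so every clause is an identity about T.       *)
(* Such an identity says that two words in an algebra H^{⊗n} have the same image under a        *)
(* linear form k. The letters are the images of Φ, R and the twist f under the leg inclusions   *)
(* and their coproduct-products a ⋆ b, and the quasi-Hopf axioms become                         *)
(*  - identities of words: pentagon, hexagons, naturality of Φ, R and f;                        *)
(*  - deletions: if k contains S(l_i) α l_j (resp. l_i β S(l_j)), then i ⋆ j may be replaced by *)
(*    ε at the left (resp. right) end of a word.                                                *)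
(* The twist enters through (1⊗f)(id⊗Δ)(f)Φ = S^{⊗3}(Φ_{321})(f⊗1)(Δ⊗id)(f) and                 *)
(* (S⊗S)(R) f = f_{21} R, which hold because both sides intertwine the same two maps and agree  *)
(* on Δ(α). These two laws give the product and coproduct clauses. For the antipodes, both      *)
(* sides equal R^2 g^2 v S^2(x) S(R^1 g^1), where v is the inverse of the Drinfeld element u    *)
(* with S^2(h) u = u h; that u is invertible also makes S bijective.                            *)

From HB Require Import structures.
Require Import Defs.
From mathcomp Require Import all_boot all_order all_algebra all_field.
From Stdlib Require Import FunctionalExtensionality.

Set Implicit Arguments.
Unset Strict Implicit.
Unset Printing Implicit Defensive.

Import GRing.Theory.
Local Open Scope ring_scope.

(* Write f for the Drinfeld twist, g^1 ⊗ g^2 for its inverse, and T(x) = g^1 S(g^2 x). Since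
   [lambda chi] is χ∘T ([lambdaE]), every clause of the theorem is the transpose of an identity for
   T.

   Action: f^{-1} intertwines (S ⊗ S)Δ^op and Δ∘S, which gives T(S(h_1) x h_2) = S(h) ▷ T(x)
   ([lambda_map_ad]). Bijectivity: f^1 T(x) S(f^2) = S(x), so T is injective as soon as S is. The
   injectivity of S follows from S^2(h) u = u h for the Drinfeld element u, whose inverse v is
   written down explicitly ([drinfeld_elt_conj], [drinfeld_elt_invK]). Unit and counit: ε∘T = ε; and
   T(α) is invariant under ▷, hence equal to β ▷ T(α), which Δ(β) f^{-1} = δ evaluates to β.

   The other clauses rest on two laws of the twist, its compatibility with Φ ([twist_associator])
   and with R ([twist_braiding]). Each follows from a uniqueness principle ([intertwiner_ext]): both
   sides intertwine the same pair of maps, and such an element is determined by its product with the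
   image of α. Because f Δ(α) = γ, that product is an explicit expression in Φ, α and S, or in Φ, R,
   α and S, and can be compared directly. With the two laws, the coproduct clause regroups three
   copies of f^{-1} ([lambda_map_comul]), and the product clause pushes f through a word in Φ and R
   ([twist_braid_word]). The two antipodes are brought to one expression [antipode_value], through
   two formulas for v, one in R and one in R^{-1} ([env_antipode_lambda],
   [fun_antipode_form_value]).

   The computations are string diagram arguments in a non-strict category. A word in commuting
   copies of H records the reassociations and crossings, and a linear form records how the strands
   are closed by caps S(-) α (-) and cups (-) β S(-). A cap deletes a coproduct at the left end of a
   word, a cup deletes one at the right end, and pentagon, hexagons and naturality move letters to
   those ends. *)
Reserved Notation "X[ a , b , c ]" (at level 0, a, b, c at level 200).
Reserved Notation "x[ a , b , c ]" (at level 0, a, b, c at level 200).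
Reserved Notation "a ⋆ b" (at level 40, left associativity).
Reserved Notation "R[ a , b ]" (at level 0, a, b at level 200).
Reserved Notation "F[ a , b ]" (at level 0, a, b at level 200).
Reserved Notation "G[ a , b ]" (at level 0, a, b at level 200).
Reserved Notation "'SX[' a , b , c ]" (at level 0, a, b, c at level 200).
Reserved Notation "'Sx[' a , b , c ]" (at level 0, a, b, c at level 200).
Reserved Notation "'SR[' a , b ]" (at level 0, a, b at level 200).
Reserved Notation "r[ a , b ]" (at level 0, a, b at level 200).

(** * Linearity of Sweedler sums *)

Section LinearClosure.
Variable K : fieldType.

Lemma lin_id (V : lmodType K) : linear (fun x : V => x).
Proof. by []. Qed.

Lemma lin_comp (V W U : lmodType K) (f : W -> U) (g : V -> W) :
  linear f -> linear g -> linear (fun x => f (g x)).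
Proof. by move=> lf lg k x y; rewrite lg lf. Qed.

Lemma lin_mull (V : lmodType K) (A : algType K) (c : A) (g : V -> A) :
  linear g -> linear (fun x => c * g x).
Proof. by move=> lg k x y; rewrite lg mulrDr scalerAr. Qed.

Lemma lin_mulr (V : lmodType K) (A : algType K) (c : A) (g : V -> A) :
  linear g -> linear (fun x => g x * c).
Proof. by move=> lg k x y; rewrite lg mulrDl scalerAl. Qed.

Lemma lin_tensl (V : lmodType K) (W U : vectType K) (c : U) (g : V -> W) :
  linear g -> linear (fun x => g x ⊗ c).
Proof. by move=> lg k x y; rewrite lg (pure_tensor_bilinear W U).1. Qed.

Lemma lin_tensr (V : lmodType K) (W U : vectType K) (c : W) (g : V -> U) :
  linear g -> linear (fun x => c ⊗ g x).
Proof. by move=> lg k x y; rewrite lg (pure_tensor_bilinear W U).2. Qed.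

Lemma lin_scaler (V U : lmodType K) (c : K) (g : V -> U) :
  linear g -> linear (fun x => c *: g x).
Proof. by move=> lg k x y; rewrite lg scalerDr !scalerA mulrC. Qed.

Lemma lin_scalel (V U : lmodType K) (c : U) (g : V -> K^o) :
  linear g -> linear (fun x => g x *: c).
Proof. by move=> lg k x y; rewrite lg scalerDl scalerA. Qed.

Lemma lin_lfun (V : lmodType K) (W U : vectType K) (f : 'Hom(W, U)) (g : V -> W) :
  linear g -> linear (fun x => f (g x)).
Proof. by move=> lg k x y; rewrite lg linearP. Qed.

Lemma lin_lrmorph (V : lmodType K) (A B : algType K) (f : {lrmorphism A -> B}) (g : V -> A) :
  linear g -> linear (fun x => f (g x)).
Proof. by move=> lg k x y; rewrite lg linearP. Qed.

Lemma lin_sum (V U : lmodType K) (I : finType) (E : I -> V -> U) :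
  (forall i, linear (E i)) -> linear (fun x => \sum_i E i x).
Proof.
move=> lE k x y; rewrite scaler_sumr -big_split /=.
by apply: eq_bigr => i _; rewrite lE.
Qed.

Lemma linear_scale (V U : lmodType K) (f : V -> U) l x : linear f -> f (l *: x) = l *: f x.
Proof.
move=> lf; have f0 : f 0 = 0 by have := lf (-1) 0 0; rewrite scaler0 addr0 scaleN1r addNr.
by rewrite -[_ *: x in LHS]addr0 lf f0 addr0.
Qed.

Lemma linear_bigsum (V U : lmodType K) (f : V -> U) (I : finType) (E : I -> V) :
  linear f -> f (\sum_i E i) = \sum_i f (E i).
Proof.
move=> lf; have f0 : f 0 = 0 by rewrite -[X in f X](scale0r 0) (linear_scale _ _ lf) scale0r.
by apply: (big_morph f _ f0) => x y; rewrite -[x in LHS]scale1r lf scale1r.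
Qed.

Variables (V W : vectType K).
Implicit Types (t : (V ⊗ W)%type).

Lemma eq_tsum (U : lmodType K) t (E E' : V -> W -> U) :
  (forall a b, E a b = E' a b) -> tsum t E = tsum t E'.
Proof. by move=> eE; rewrite /tsum; under eq_bigr do under eq_bigr do rewrite eE. Qed.

Lemma eq_tsumK t (E E' : V -> W -> K^o) :
  (forall a b, E a b = E' a b) -> tsum t E = tsum t E'.
Proof. exact: eq_tsum. Qed.

Lemma lin_tsuml (X U : lmodType K) (g : X -> (V ⊗ W)%type) (E : V -> W -> U) :
  linear g -> linear (fun x => tsum (g x) E).
Proof. by move=> lg k x y; rewrite lg tsum_linear. Qed.

Lemma lin_tsumr (X U : lmodType K) t (E : X -> V -> W -> U) :
  (forall a b, linear (fun x => E x a b)) -> linear (fun x => tsum t (E x)).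
Proof.
move=> lE; rewrite /tsum; do 2![apply: lin_sum => ?].
exact: lin_scaler.
Qed.

Lemma linear_tsum (U U' : lmodType K) (g : U -> U') t (E : V -> W -> U) :
  linear g -> g (tsum t E) = tsum t (fun a b => g (E a b)).
Proof.
move=> lg; rewrite /tsum (linear_bigsum _ lg); apply: eq_bigr => i _.
by rewrite (linear_bigsum _ lg); apply: eq_bigr => j _; apply: linear_scale.
Qed.
End LinearClosure.

Section TensorSums.
Variable K : fieldType.

Lemma exchange_tsum (V W V' W' : vectType K) (U : lmodType K)
    (s : (V ⊗ W)%type) (t : (V' ⊗ W')%type) (E : V -> W -> V' -> W' -> U) :
  tsum s (fun a b => tsum t (fun c d => E a b c d)) =
  tsum t (fun c d => tsum s (fun a b => E a b c d)).
Proof.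
rewrite /tsum.
under eq_bigr do under eq_bigr do rewrite scaler_sumr.
under eq_bigr do rewrite exchange_big.
rewrite exchange_big; apply: eq_bigr => k _.
under eq_bigr do under eq_bigr do rewrite scaler_sumr.
under eq_bigr do rewrite exchange_big.
rewrite exchange_big; apply: eq_bigr => l _.
rewrite scaler_sumr; apply: eq_bigr => i _.
rewrite scaler_sumr; apply: eq_bigr => j _.
by rewrite !scalerA mulrC.
Qed.

Lemma tsum_mul (A B : falgType K) (U : lmodType K) (s t : (A ⊗ B)%type)
    (E : A -> B -> U) : bilinear_fun E ->
  tsum (s * t) E = tsum s (fun a b => tsum t (fun c d => E (a * c) (b * d))).
Proof.
move=> bE; have [El Er] := bE.
have lE1 x : linear (fun u => tsum (x * u) E).
  by move=> k u v; rewrite mulrDr -scalerAr tsum_linear.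
have lE2 x : linear (fun u => tsum (u * x) E).
  by move=> k u v; rewrite mulrDl -scalerAl tsum_linear.
rewrite [s in LHS]tensorE (linear_tsum _ _ (lE2 t)); apply: eq_tsum => a b.
rewrite [t in LHS]tensorE (linear_tsum _ _ (lE1 _)); apply: eq_tsum => c d.
by rewrite pure_tensorM tsum_pure.
Qed.

Lemma tsum_one (A B : falgType K) (U : lmodType K) (E : A -> B -> U) :
  bilinear_fun E -> tsum (1 : (A ⊗ B)%type) E = E 1 1.
Proof. by move=> bE; rewrite tensor1E tsum_pure. Qed.
End TensorSums.

(** Proves linearity by recursion on the head symbol; the patterns without a lambda serve
    eta-contracted goals. *)
Ltac lin1 :=
  lazymatch goal with
  | |- GRing.linear_for _ (fun x => x) => exact: lin_id
  | |- GRing.linear_for _ (fun _ => GRing.mul ?c _) => apply: lin_mull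
  | |- GRing.linear_for _ (fun _ => GRing.mul _ ?c) => apply: lin_mulr
  | |- GRing.linear_for _ (fun _ => pure_tensor _ ?c) => apply: lin_tensl
  | |- GRing.linear_for _ (fun _ => pure_tensor ?c _) => apply: lin_tensr
  | |- GRing.linear_for _ (fun _ => GRing.scale ?c _) => apply: lin_scaler
  | |- GRing.linear_for _ (fun _ => GRing.scale _ ?c) => apply: lin_scalel
  | |- GRing.linear_for _ (fun _ => tsum ?t _) => apply: lin_tsumr => ? ?
  | |- GRing.linear_for _ (fun _ => tsum _ ?E) => apply: lin_tsuml
  | |- GRing.linear_for _ (GRing.mul _) => apply: lin_mull
  | |- GRing.linear_for _ (pure_tensor _) => apply: lin_tensr
  | |- GRing.linear_for _ (GRing.scale _) => apply: lin_scaler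
  | |- _ => first [ exact: lin_id | assumption | apply: tsum_linear | apply: lin_lfun
                 | apply: lin_lrmorph ]
  end.
Ltac lin := do ?lin1.

(** * Words in commuting homomorphisms *)

Section Homs.
Variables (K : fieldType) (H B : falgType K).
Implicit Types (a b c d : H -> B) (u v : B).

Definition alghom a := [/\ linear a, a 1 = 1 & forall x y, a (x * y) = a x * a y].
(** Naturality in word form: a letter on leg [a] becomes a letter on leg [a'] when it passes [u].
    Coassociativity, the braiding and the twist are all used in this form. *)
Definition intertwines u a a' := forall x, u * a x = a' x * u.
Definition commuting a b := forall x, intertwines (a x) b b.

Existing Class alghom.
Existing Class commuting.

(* ev2 t a b is t written on the legs a and b, so X[a, b, c] below is Φ in positions a, b, c. *)
Definition ev2 (t : (H ⊗ H)%type) a b := \tsum_(x ⊗ y <- t) a x * b y.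
Definition ev3 (t : (H ⊗ H ⊗ H)%type) a b c :=
  \tsum_(x ⊗ y ⊗ z <- t) a x * b y * c z.

Lemma commuting_sym a b : commuting a b -> commuting b a.
Proof. by move=> ab x y; rewrite ab. Qed.

Lemma intertwinesM u v a a' a'' :
  intertwines v a a' -> intertwines u a' a'' -> intertwines (u * v) a a''.
Proof. by move=> va ua x; rewrite -mulrA va !mulrA ua. Qed.

Lemma intertwines_ev2 t a b d : commuting a d -> commuting b d -> intertwines (ev2 t a b) d d.
Proof.
move=> ad bd x; rewrite /ev2 (linear_tsum (g := fun y => y * d x)); last by lin.
rewrite (linear_tsum (g := fun y => d x * y)); last by lin.
by apply: eq_tsum => p q; rewrite -mulrA bd !mulrA ad.
Qed.

Lemma intertwines_ev3 t a b c d :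
  commuting a d -> commuting b d -> commuting c d -> intertwines (ev3 t a b c) d d.
Proof.
move=> ad bd cd x; rewrite /ev3 (linear_tsum (g := fun y => y * d x)); last by lin.
rewrite (linear_tsum (g := fun y => d x * y)); last by lin.
apply: eq_tsum => pq r; rewrite (linear_tsum (g := fun y => y * d x)); last by lin.
rewrite (linear_tsum (g := fun y => d x * y)); last by lin.
by apply: eq_tsum => p q; rewrite -(mulrA _ (c r)) cd mulrA -(mulrA _ (b q)) bd !mulrA ad.
Qed.

Lemma ev2_nat u t a b a' b' : intertwines u a a' -> intertwines u b b' ->
  u * ev2 t a b = ev2 t a' b' * u.
Proof.
move=> ia ib; rewrite /ev2 (linear_tsum (g := fun y => u * y)); last by lin.
rewrite (linear_tsum (g := fun y => y * u)); last by lin.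
by apply: eq_tsum => p q; rewrite mulrA ia -mulrA ib mulrA.
Qed.

Lemma ev3_nat u t a b c a' b' c' :
  intertwines u a a' -> intertwines u b b' -> intertwines u c c' ->
  u * ev3 t a b c = ev3 t a' b' c' * u.
Proof.
move=> ia ib ic; rewrite /ev3 (linear_tsum (g := fun y => u * y)); last by lin.
rewrite (linear_tsum (g := fun y => y * u)); last by lin.
apply: eq_tsum => pq r; rewrite (linear_tsum (g := fun y => u * y)); last by lin.
rewrite (linear_tsum (g := fun y => y * u)); last by lin.
by apply: eq_tsum => p q; rewrite !mulrA ia -(mulrA _ u) ib -!mulrA ic.
Qed.

Lemma ev2M s t a b : alghom a -> alghom b -> commuting a b ->
  ev2 (s * t) a b = ev2 s a b * ev2 t a b.
Proof.
move=> [la _ aM] [lb _ bM] ab; rewrite /ev2 tsum_mul; last first.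
  by split=> ?; [apply: lin_mulr | apply: lin_mull].
rewrite (linear_tsum (g := fun y => y * _)); last by lin.
apply: eq_tsum => p q; rewrite (linear_tsum (g := fun y => _ * y)); last by lin.
by apply: eq_tsum => p' q'; rewrite aM bM -!mulrA (mulrA (b q)) -(ab p') !mulrA.
Qed.

Lemma ev3M s t a b c : alghom a -> alghom b -> alghom c ->
  commuting a b -> commuting a c -> commuting b c ->
  ev3 (s * t) a b c = ev3 s a b c * ev3 t a b c.
Proof.
move=> ha hb [lc _ cM] ab ac bc; have [[la _ _] [lb _ _]] := (ha, hb).
have E (r : (H ⊗ H ⊗ H)%type) : ev3 r a b c = tsum r (fun pq r => ev2 pq a b * c r).
  apply: eq_tsum => pq z.
  by rewrite /ev2 (linear_tsum (g := fun y => y * c z)) //; lin.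
rewrite !E.
rewrite tsum_mul; last by split=> ?; [apply: lin_mulr; exact: tsum_linear | apply: lin_mull].
rewrite (linear_tsum (g := fun y => y * _)); last by lin.
apply: eq_tsum => p q; rewrite (linear_tsum (g := fun y => _ * y)); last by lin.
apply: eq_tsum => p' q'; rewrite ev2M // cM -!mulrA (mulrA (c q)).
by rewrite -(intertwines_ev2 _ ac bc) -!mulrA.
Qed.

Lemma ev2_1 a b : alghom a -> alghom b -> ev2 1 a b = 1.
Proof.
move=> [la a1 _] [lb b1 _]; rewrite /ev2 tsum_one ?a1 ?b1 ?mulr1 //.
by split=> ?; [apply: lin_mulr | apply: lin_mull].
Qed.

Lemma ev3_1 a b c : alghom a -> alghom b -> alghom c -> ev3 1 a b c = 1.
Proof.
move=> ha hb [lc c1 _]; have [[la _ _] [lb _ _]] := (ha, hb).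
rewrite /ev3 tsum_one.
  rewrite -(ev2_1 ha hb) /ev2 c1; apply: eq_tsum => p q; exact: mulr1.
split=> w /=; first exact: tsum_linear.
by apply: lin_tsumr => p q; apply: lin_mull.
Qed.
End Homs.

(* Symmetry is applied only to hypotheses, so that instance search does not loop on it. *)
#[global] Hint Extern 3 (commuting ?a ?b) =>
  match goal with ba : commuting b a |- _ => exact (commuting_sym ba) end : typeclass_instances.

#[global] Typeclasses Opaque alghom commuting intertwines.

(** * Coproduct, counit and associator on words *)

Section Calculus.
Variables (K : fieldType) (H : falgType K) (Q : quasiBialgebra H).
Local Notation Delta := (Delta Q).
Local Notation Phi := (Phi Q).

Definition counit (h : H) : K := eps Q h.

Lemma counit_linear : linear (counit : H -> K^o).
Proof. by move=> k x y; rewrite /counit linearP. Qed.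

Lemma counit1 : counit 1 = 1.
Proof. exact: rmorph1. Qed.

Lemma counitM x y : counit (x * y) = counit x * counit y.
Proof. exact: rmorphM. Qed.

Section Words.
Variable B : falgType K.
Implicit Types (a b c d : H -> B) (u v : B).

(* The leg (a ⊗ b) \o Δ: position 12, say, is i1 ⋆ i2. *)
Definition star a b : H -> B := fun h => ev2 (Delta h) a b.
(** The leg that carries nothing: it is neutral for ⋆ by the counit axioms, and deleting a leg means
    replacing it by this one. *)
Definition triv : H -> B := fun h => counit h *: 1.

#[global] Instance triv_alghom : alghom triv.
Proof.
split=> [||x y]; rewrite /triv ?counit1 ?scale1r //.
  by apply: lin_scalel; exact: counit_linear.
by rewrite counitM -scalerAl mul1r scalerA.
Qed.

#[global] Instance commuting_trivl a : commuting triv a.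
Proof. by move=> x y; rewrite /triv -scalerAl -scalerAr mul1r mulr1. Qed.

#[global] Instance commuting_trivr a : commuting a triv.
Proof. exact: commuting_sym. Qed.

Lemma intertwines_triv u : intertwines u triv triv.
Proof. by move=> x; rewrite /triv -scalerAl -scalerAr mul1r mulr1. Qed.

Lemma ev2_linear a b : linear (fun t => ev2 t a b).
Proof. exact: tsum_linear. Qed.

Lemma ev3_linear a b c : linear (fun t => ev3 t a b c).
Proof. exact: tsum_linear. Qed.

#[global] Instance star_alghom a b {ha : alghom a} {hb : alghom b} {ab : commuting a b} :
  alghom (star a b).
Proof.
split=> [||x y]; rewrite /star.
- by apply: lin_tsuml; apply: lin_lrmorph; exact: lin_id.
- by rewrite rmorph1 ev2_1.
- by rewrite rmorphM ev2M.
Qed.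

#[global] Instance commuting_starl a b c {ac : commuting a c} {bc : commuting b c} :
  commuting (star a b) c.
Proof. by move=> x; apply: intertwines_ev2. Qed.

#[global] Instance commuting_starr a b c {ac : commuting c a} {bc : commuting c b} :
  commuting c (star a b).
Proof. exact: commuting_sym. Qed.

Lemma intertwines_star u a b a' b' : intertwines u a a' -> intertwines u b b' ->
  intertwines u (star a b) (star a' b').
Proof. by move=> ia ib x; apply: ev2_nat. Qed.

Lemma ev2_pure a b x y : linear a -> linear b -> ev2 (x ⊗ y) a b = a x * b y.
Proof. by move=> la lb; rewrite /ev2 tsum_pure //; split=> ?; lin. Qed.

Lemma ev3_pure a b c t z : linear a -> linear b -> linear c ->
  ev3 (t ⊗ z) a b c = ev2 t a b * c z.
Proof.
move=> la lb lc; rewrite /ev3 tsum_pure; last by split=> ?; lin.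
by rewrite /ev2 (linear_tsum (g := fun y => y * c z)) //; lin.
Qed.

Lemma star_trivl b {hb : alghom b} : star triv b = b.
Proof.
have [lb _ _] := hb; apply: functional_extensionality => h.
rewrite -[in RHS](counitl Q h) (linear_tsum (g := b)) //.
apply: eq_tsum => x y; by rewrite /triv -scalerAl mul1r (linear_scale _ _ lb).
Qed.

Lemma star_trivr b {hb : alghom b} : star b triv = b.
Proof.
have [lb _ _] := hb; apply: functional_extensionality => h.
rewrite -[in RHS](counitr Q h) (linear_tsum (g := b)) //.
apply: eq_tsum => x y; by rewrite /triv -scalerAr mulr1 (linear_scale _ _ lb).
Qed.

Local Notation "X[ a , b , c ]" := (ev3 Phi a b c).
Local Notation "x[ a , b , c ]" := (ev3 Phi^-1 a b c).

Definition ev4 (t : (H ⊗ H ⊗ H ⊗ H)%type) a b c d :=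
  tsum t (fun xyz w => ev3 xyz a b c * d w).

Lemma ev4_linear a b c d : linear (fun t => ev4 t a b c d).
Proof. exact: tsum_linear. Qed.

Lemma ev4_pure a b c d t z : linear a -> linear b -> linear c -> linear d ->
  ev4 (t ⊗ z) a b c d = ev3 t a b c * d z.
Proof. by move=> la lb lc ld; rewrite /ev4 tsum_pure //; split=> w /=; lin. Qed.

Lemma ev4M s t a b c d : alghom a -> alghom b -> alghom c -> alghom d ->
  commuting a b -> commuting a c -> commuting a d -> commuting b c -> commuting b d ->
  commuting c d ->
  ev4 (s * t) a b c d = ev4 s a b c d * ev4 t a b c d.
Proof.
move=> ha hb hc [ld _ dM] ab ac ad bc bd cd; rewrite /ev4.
rewrite tsum_mul; last by split=> w /=; lin.
rewrite (linear_tsum (g := fun y => y * _)); last by lin.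
apply: eq_tsum => p q; rewrite (linear_tsum (g := fun y => _ * y)); last by lin.
apply: eq_tsum => p' q'; rewrite ev3M // dM -!mulrA (mulrA (d q)).
by rewrite -(intertwines_ev3 _ ad bd cd) -!mulrA.
Qed.

Section Associator.
Context (a b c d : H -> B) {ha : alghom a} {hb : alghom b} {hc : alghom c} {hd : alghom d}.
Context {ab : commuting a b} {ac : commuting a c} {ad : commuting a d}.
Context {bc : commuting b c} {bd : commuting b d} {cd : commuting c d}.

Lemma assocK : X[a, b, c] * x[a, b, c] = 1.
Proof. by rewrite -ev3M // divrr ?ev3_1 //; exact: Phi_unit. Qed.

Lemma assocVK : x[a, b, c] * X[a, b, c] = 1.
Proof. by rewrite -ev3M // mulVr ?ev3_1 //; exact: Phi_unit. Qed.

Lemma star_assoc : intertwines X[a, b, c] (star (star a b) c) (star a (star b c)).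
Proof.
have [[la _ _] [lb _ _] [lc _ _]] := And3 ha hb hc; move=> h.
have Er : star a (star b c) h = ev3 (\tsum_(h1 ⊗ h2 <- Delta h)
    \tsum_(h21 ⊗ h22 <- Delta h2) h1 ⊗ h21 ⊗ h22) a b c.
  rewrite (linear_tsum (g := fun t => ev3 t a b c)) //; last exact: ev3_linear.
  apply: eq_tsum => p q; rewrite (linear_tsum (g := fun t => ev3 t a b c)) //; last exact: ev3_linear.
  rewrite /star /ev2 (linear_tsum (g := fun y => _ * y)); last by lin.
  by apply: eq_tsum => r s; rewrite ev3_pure // ev2_pure // mulrA.
have El : star (star a b) c h = ev3 (\tsum_(h1 ⊗ h2 <- Delta h) Delta h1 ⊗ h2) a b c.
  rewrite (linear_tsum (g := fun t => ev3 t a b c)) //; last exact: ev3_linear.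
  by apply: eq_tsum => p q; rewrite ev3_pure.
by rewrite Er quasi_coassoc !ev3M // -El -!mulrA assocVK mulr1.
Qed.

Lemma star_assocV : intertwines x[a, b, c] (star a (star b c)) (star (star a b) c).
Proof.
move=> h; rewrite -[LHS]mulr1 -assocK mulrA -[_ * _ * X[a, b, c]]mulrA.
by rewrite -mulrA -star_assoc !mulrA assocVK mul1r.
Qed.

Lemma pentagon :
  X[b, c, d] * X[a, star b c, d] * X[a, b, c] =
  X[a, b, star c d] * X[star a b, c, d].
Proof.
have [[la a1 _] [lb b1 _] [lc c1 _] [ld d1 _]] := And4 ha hb hc hd.
have := congr1 (fun t => ev4 t a b c d) (Phi_cocycle Q).
rewrite !ev4M //; have l4 := ev4_linear a b c d.
rewrite ev4_pure // d1 mulr1.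
congr (_ * _ * _ = _ * _).
- rewrite (linear_tsum _ _ l4); apply: eq_tsum => xy z; rewrite (linear_tsum _ _ l4).
  by apply: eq_tsum => x y; rewrite ev4_pure // ev3_pure // ev2_pure // a1 mul1r.
- rewrite (linear_tsum _ _ l4); apply: eq_tsum => xy z; rewrite (linear_tsum _ _ l4).
  apply: eq_tsum => x y; rewrite (linear_tsum _ _ l4) /star /ev2.
  rewrite (linear_tsum (g := fun y => _ * y)); last by lin.
  rewrite (linear_tsum (g := fun y => y * d z)); last by lin.
  by apply: eq_tsum => y1 y2; rewrite ev4_pure // ev3_pure // ev2_pure // !mulrA.
- rewrite (linear_tsum _ _ l4); apply: eq_tsum => xy z; rewrite (linear_tsum _ _ l4).
  apply: eq_tsum => x y; rewrite (linear_tsum _ _ l4) /star /ev2.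
  rewrite (linear_tsum (g := fun y => _ * y)); last by lin.
  by apply: eq_tsum => y1 y2; rewrite ev4_pure // ev3_pure // ev2_pure // !mulrA.
- rewrite (linear_tsum _ _ l4); apply: eq_tsum => xy z; rewrite (linear_tsum _ _ l4).
  by apply: eq_tsum => x y; rewrite ev4_pure // ev3_pure.
Qed.
End Associator.
#[global] Arguments assocK a b c {_ _ _ _ _ _}.
#[global] Arguments assocVK a b c {_ _ _ _ _ _}.
#[global] Arguments star_assoc a b c {_ _ _ _ _ _}.
#[global] Arguments star_assocV a b c {_ _ _ _ _ _}.
#[global] Arguments pentagon a b c d {_ _ _ _ _ _ _ _ _ _}.

Section AssociatorUnit.
Context (a b : H -> B) {ha : alghom a} {hb : alghom b} {ab : commuting a b}.

Lemma assoc_triv2 : X[a, triv, b] = 1.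
Proof.
have [[la a1 _] [lb b1 _]] := conj ha hb.
have := congr1 (fun t => ev2 t a b) (Phi_counit Q).
rewrite ev2_pure // a1 b1 mulr1 => <-.
rewrite (linear_tsum _ _ (ev2_linear a b)); apply: eq_tsum => xy z.
rewrite (linear_tsum _ _ (ev2_linear a b)); apply: eq_tsum => x y.
by rewrite /triv -scalerAr mulr1 -scalerAl -ev2_pure // -(linear_scale _ _ (ev2_linear a b)).
Qed.
End AssociatorUnit.
#[global] Arguments assoc_triv2 a b {_ _}.

Section AssociatorUnits.
Context (a b : H -> B) {ha : alghom a} {hb : alghom b} {ab : commuting a b}.

(** The counit axiom only speaks of the middle leg. The pentagon with two trivial legs makes this
    value idempotent, and it is invertible. *)
Lemma assoc_triv1 : X[triv, a, b] = 1.
Proof.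
have e : X[triv, a, b] * X[triv, a, b] = X[triv, a, b].
  pose proof (pentagon triv triv a b) as e.
  by rewrite !star_trivl !assoc_triv2 mulr1 mul1r in e.
by rewrite -[LHS]mulr1 -(assocK triv a b) mulrA e.
Qed.

Lemma assoc_triv3 : X[a, b, triv] = 1.
Proof.
have e : X[a, b, triv] * X[a, b, triv] = X[a, b, triv].
  pose proof (pentagon a b triv triv) as e.
  by rewrite !star_trivr !assoc_triv2 mul1r mulr1 in e.
by rewrite -[LHS]mulr1 -(assocK a b triv) mulrA e.
Qed.

Lemma assocV_triv1 : x[triv, a, b] = 1.
Proof. by rewrite -[LHS]mul1r -{1}assoc_triv1 assocK. Qed.

Lemma assocV_triv2 : x[a, triv, b] = 1.
Proof. by rewrite -[LHS]mul1r -{1}(assoc_triv2 a b) assocK. Qed.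

Lemma assocV_triv3 : x[a, b, triv] = 1.
Proof. by rewrite -[LHS]mul1r -{1}assoc_triv3 assocK. Qed.
End AssociatorUnits.
End Words.
End Calculus.

(* Laws of the braiding on words *)
Existing Class quasiTriangular.

Section Braiding.
Variables (K : fieldType) (H : falgType K) (Q : quasiBialgebra H) (R : (H ⊗ H)%type).
Context {hR : quasiTriangular Q R}.
Local Notation Phi := (Phi Q).
Variable B : falgType K.
Implicit Types (a b c d : H -> B) (u v : B).
Local Notation "a ⋆ b" := (star Q a b).
Local Notation "X[ a , b , c ]" := (ev3 Phi a b c).
Local Notation "x[ a , b , c ]" := (ev3 Phi^-1 a b c).
Local Notation "R[ a , b ]" := (ev2 R a b).

Section ThreeHoms.
Context (a b c : H -> B) {ha : alghom a} {hb : alghom b} {hc : alghom c}.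
Context {ab : commuting a b} {ac : commuting a c} {bc : commuting b c}.

Lemma ev2_flip (t : (H ⊗ H)%type) : ev2 (tflip t) a b = ev2 t b a.
Proof.
have [[la _ _] [lb _ _]] := conj ha hb.
rewrite (linear_tsum _ _ (ev2_linear a b)); apply: eq_tsum => x y.
by rewrite ev2_pure // ab.
Qed.

Lemma ev3_leg (t : (H ⊗ H)%type) :
  [/\ ev3 (leg12 t) a b c = ev2 t a b, ev3 (leg13 t) a b c = ev2 t a c &
      ev3 (leg23 t) a b c = ev2 t b c].
Proof.
have [[la a1 _] [lb b1 _] [lc c1 _]] := And3 ha hb hc.
split; rewrite (linear_tsum _ _ (ev3_linear a b c)); apply: eq_tsum => x y;
  by rewrite ev3_pure // ev2_pure // ?a1 ?b1 ?c1 ?mulr1 ?mul1r.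
Qed.

Lemma ev3_perm (t : (H ⊗ H ⊗ H)%type) :
  [/\ ev3 (leg312 t) a b c = ev3 t c a b, ev3 (leg132 t) a b c = ev3 t a c b,
      ev3 (leg231 t) a b c = ev3 t b c a & ev3 (leg213 t) a b c = ev3 t b a c].
Proof.
have [[la a1 _] [lb b1 _] [lc c1 _]] := And3 ha hb hc.
split; rewrite (linear_tsum _ _ (ev3_linear a b c)); apply: eq_tsum => xy z;
  rewrite (linear_tsum _ _ (ev3_linear a b c)); apply: eq_tsum => x y;
  rewrite ev3_pure // ev2_pure // -?mulrA.
- by rewrite (bc z x) !mulrA (ac y x).
- by rewrite (bc z y).
- by rewrite mulrA (ab z x) -!mulrA (ac z y).
- by rewrite !mulrA (ab y x).
Qed.
End ThreeHoms.

Section BraidingAxioms.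
Context (a b c : H -> B) {ha : alghom a} {hb : alghom b} {hc : alghom c}.
Context {ab : commuting a b} {ac : commuting a c} {bc : commuting b c}.

Lemma braid_star : intertwines R[a, b] (a ⋆ b) (b ⋆ a).
Proof.
move=> h; rewrite /star -ev2M // -(Delta_op_R hR) ev2M //; congr (_ * _).
exact: ev2_flip.
Qed.

Lemma hexagon1 :
  R[a ⋆ b, c] = X[c, a, b] * R[a, c] * x[a, c, b] * R[b, c] * X[a, b, c].
Proof.
have [[la a1 _] [lb b1 _] [lc c1 _]] := And3 ha hb hc.
pose proof (congr1 (fun t => ev3 t a b c) (Delta_id_R hR)) as e.
rewrite /= !ev3M // in e.
have [e312 _ _ _] := ev3_perm (a := a) (b := b) (c := c) Phi.
have [_ e132 _ _] := ev3_perm (a := a) (b := b) (c := c) Phi^-1.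
have [_ e13 e23] := ev3_leg (a := a) (b := b) (c := c) R.
rewrite e312 e132 e13 e23 in e; rewrite -e.
rewrite (linear_tsum _ _ (ev3_linear a b c)); apply: eq_tsum => x y.
by rewrite ev3_pure.
Qed.

Lemma hexagon2 :
  R[a, b ⋆ c] = x[b, c, a] * R[a, c] * X[b, a, c] * R[a, b] * x[a, b, c].
Proof.
have [[la a1 _] [lb b1 _] [lc c1 _]] := And3 ha hb hc.
pose proof (congr1 (fun t => ev3 t a b c) (id_Delta_R hR)) as e.
rewrite /= !ev3M // in e.
have [_ _ _ e213] := ev3_perm (a := a) (b := b) (c := c) Phi.
have [_ _ e231 _] := ev3_perm (a := a) (b := b) (c := c) Phi^-1.
have [e12 e13 _] := ev3_leg (a := a) (b := b) (c := c) R.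
rewrite e213 e231 e13 e12 in e; rewrite -e.
rewrite (linear_tsum _ _ (ev3_linear a b c)); apply: eq_tsum => x y.
rewrite (linear_tsum _ _ (ev3_linear a b c)) /star {1}/ev2.
rewrite (linear_tsum (g := fun y => _ * y)); last by lin.
by apply: eq_tsum => y1 y2; rewrite ev3_pure // ev2_pure // mulrA.
Qed.

Lemma braid_triv1 : R[@triv _ _ Q _, b] = 1.
Proof.
have [lb b1 _] := hb.
rewrite -b1 -(eps_id_R hR) (linear_tsum _ _ lb); apply: eq_tsum => x y.
by rewrite /triv -scalerAl mul1r (linear_scale _ _ lb).
Qed.

Lemma braid_triv2 : R[b, @triv _ _ Q _] = 1.
Proof.
have [lb b1 _] := hb.
rewrite -b1 -(id_eps_R hR) (linear_tsum _ _ lb); apply: eq_tsum => x y.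
by rewrite /triv -scalerAr mulr1 (linear_scale _ _ lb).
Qed.
End BraidingAxioms.
End Braiding.
#[global] Arguments braid_star {K H Q R hR B} a b {_ _ _}.
#[global] Arguments hexagon1 {K H Q R hR B} a b c {_ _ _ _ _ _}.
#[global] Arguments hexagon2 {K H Q R hR B} a b c {_ _ _ _ _ _}.

(** * Deleting legs under a linear form *)

Section LinearForms.
Variables (K : fieldType) (H : falgType K) (Q : quasiBialgebra H).
Variables (B : falgType K) (U : lmodType K).
Implicit Types (k : B -> U) (a b c : H -> B) (u v z s : B).

(** The form [k] cannot tell [a] from [a'] at the left end of a word; for [a'] trivial this is a
    deletion. *)
Definition lsub k a a' := forall h z, k (a h * z) = k (a' h * z).
Definition rsub k a a' := forall h z, k (z * a h) = k (z * a' h).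

Lemma lsub_mul k u a a' : intertwines u a a -> intertwines u a' a' ->
  lsub k a a' -> lsub (fun z => k (u * z)) a a'.
Proof. by move=> ia ia' e h z; rewrite !mulrA ia ia' -!mulrA e. Qed.

Lemma rsub_mul k u a a' : intertwines u a a -> intertwines u a' a' ->
  rsub k a a' -> rsub (fun z => k (z * u)) a a'.
Proof. by move=> ia ia' e h z; rewrite -!mulrA -ia -ia' !mulrA e. Qed.

Section Two.
Context (k : B -> U) (lk : linear k) (a b a' b' : H -> B).
Context {ab : commuting a b} {a'b : commuting a' b} {a'b' : commuting a' b'}.

Lemma lsub_ev2 (t : (H ⊗ H)%type) z : lsub k a a' -> lsub k b b' ->
  k (ev2 t a b * z) = k (ev2 t a' b' * z).
Proof.
move=> ea eb; rewrite /ev2 (linear_tsum (g := fun y => k (y * z))); last first.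
  by apply: (lin_comp lk); lin.
rewrite (linear_tsum (g := fun y => k (y * z))); last first.
  by apply: (lin_comp lk); lin.
by apply: eq_tsum => x y; rewrite -mulrA ea mulrA a'b -mulrA eb mulrA a'b'.
Qed.

Lemma rsub_ev2 (t : (H ⊗ H)%type) z : rsub k a a' -> rsub k b b' ->
  k (z * ev2 t a b) = k (z * ev2 t a' b').
Proof.
move=> ea eb; rewrite /ev2 (linear_tsum (g := fun y => k (z * y))); last first.
  by apply: (lin_comp lk); lin.
rewrite (linear_tsum (g := fun y => k (z * y))); last first.
  by apply: (lin_comp lk); lin.
by apply: eq_tsum => x y; rewrite ab mulrA ea -mulrA -a'b mulrA eb mulrA.
Qed.
End Two.

Lemma lsub_star k a b a' b' : linear k ->
  commuting a b -> commuting a' b -> commuting a' b' ->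
  lsub k a a' -> lsub k b b' -> lsub k (star Q a b) (star Q a' b').
Proof. by move=> lk ab a'b a'b' ea eb h z; rewrite /star; exact: lsub_ev2. Qed.

Lemma rsub_star k a b a' b' : linear k ->
  commuting a b -> commuting a' b -> commuting a' b' ->
  rsub k a a' -> rsub k b b' -> rsub k (star Q a b) (star Q a' b').
Proof. by move=> lk ab a'b a'b' ea eb h z; rewrite /star; exact: rsub_ev2. Qed.
End LinearForms.

Existing Class intertwines.

Section IntertwinesInstances.
Variables (K : fieldType) (H B : falgType K).
Implicit Types (a b c d : H -> B) (u v : B).

#[global] Instance commuting_intertwines a b x {ab : commuting a b} : intertwines (a x) b b.
Proof. exact: ab. Qed.

#[global] Instance intertwinesM_same u v a {iu : intertwines u a a} {iv : intertwines v a a} :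
  intertwines (u * v) a a.
Proof. exact: intertwinesM iv iu. Qed.

#[global] Instance intertwines_ev2_same t a b c {ac : commuting a c} {bc : commuting b c} :
  intertwines (ev2 t a b) c c.
Proof. exact: intertwines_ev2. Qed.

#[global] Instance intertwines_ev3_same t a b c d
  {ad : commuting a d} {bd : commuting b d} {cd : commuting c d} :
  intertwines (ev3 t a b c) d d.
Proof. exact: intertwines_ev3. Qed.

#[global] Instance intertwines_one a : intertwines 1 a a.
Proof. by move=> x; rewrite mulr1 mul1r. Qed.
End IntertwinesInstances.
#[global] Existing Instance intertwines_triv.
#[global] Existing Instance intertwines_star.
#[global] Existing Instance star_assoc.
#[global] Existing Instance star_assocV.
#[global] Existing Instance braid_star.

Section Substitution.
Variables (K : fieldType) (H : falgType K) (B : falgType K) (U : lmodType K).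
Variables (k : B -> U) (lk : linear k).
Implicit Types (a b c : H -> B) (u v z s : B) (t : (H ⊗ H ⊗ H)%type).

Lemma ev3_split t a b c : ev3 t a b c = tsum t (fun xy w => ev2 xy a b * c w).
Proof.
apply: eq_tsum => xy w.
by rewrite /ev2 (linear_tsum (g := fun y => y * c w)) //; lin.
Qed.

Lemma linear_mulk u v : linear (fun y => k (u * y * v)).
Proof. by move=> l x y; rewrite mulrDr mulrDl -scalerAr -scalerAl lk. Qed.

Lemma expand2 (t : (H ⊗ H)%type) a b u z :
  k (u * ev2 t a b * z) = \tsum_(x ⊗ y <- t) k (u * (a x * b y) * z).
Proof. exact: (linear_tsum (g := fun y => k (u * y * z)) _ _ (linear_mulk u z)). Qed.

Lemma expand3 t a b c u z :
  k (u * ev3 t a b c * z) = \tsum_(x ⊗ y ⊗ w <- t) k (u * (a x * b y * c w) * z).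
Proof.
rewrite /ev3 (linear_tsum (g := fun y => k (u * y * z)) _ _ (linear_mulk u z)).
apply: eq_tsum => xy w.
by rewrite (linear_tsum (g := fun y => k (u * y * z)) _ _ (linear_mulk u z)).
Qed.

Lemma slide2 u (t : (H ⊗ H)%type) a b {a' b'} {ia : intertwines u a a'} {ib : intertwines u b b'} :
  u * ev2 t a b = ev2 t a' b' * u.
Proof. exact: ev2_nat. Qed.

Lemma slide3 u t a b c {a' b' c'} {ia : intertwines u a a'} {ib : intertwines u b b'}
  {ic : intertwines u c c'} : u * ev3 t a b c = ev3 t a' b' c' * u.
Proof. exact: ev3_nat. Qed.

Section Slots.
Context (a b c a' : H -> B) {ab : commuting a b} {ac : commuting a c} {bc : commuting b c}.
Context {a'b : commuting a' b} {a'c : commuting a' c}.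

(** The replaced letter need not come first: it suffices that the prefix [u] commutes with both [a]
    and [a']. *)
Lemma lsub2_1 (t : (H ⊗ H)%type) u z : lsub k a a' ->
  forall {ia : intertwines u a a} {ia' : intertwines u a' a'},
  k (u * ev2 t a b * z) = k (u * ev2 t a' b * z).
Proof.
move=> e ia ia'; rewrite !expand2; apply: eq_tsum => x y.
by rewrite !mulrA ia ia' -!mulrA e.
Qed.

Lemma lsub2_2 (t : (H ⊗ H)%type) u z : lsub k a a' ->
  forall {ia : intertwines u a a} {ia' : intertwines u a' a'},
  k (u * ev2 t b a * z) = k (u * ev2 t b a' * z).
Proof.
move=> e ia ia'; rewrite !expand2; apply: eq_tsum => x y.
by rewrite -(ab y) -(a'b y) !mulrA ia ia' -!mulrA e.
Qed.

Lemma lsub3_1 t u z : lsub k a a' ->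
  forall {ia : intertwines u a a} {ia' : intertwines u a' a'},
  k (u * ev3 t a b c * z) = k (u * ev3 t a' b c * z).
Proof.
move=> e ia ia'; rewrite !expand3; apply: eq_tsum => xy w; apply: eq_tsum => x y.
by rewrite !mulrA ia ia' -!mulrA e.
Qed.

Lemma lsub3_2 t u z : lsub k a a' ->
  forall {ia : intertwines u a a} {ia' : intertwines u a' a'},
  k (u * ev3 t b a c * z) = k (u * ev3 t b a' c * z).
Proof.
move=> e ia ia'; rewrite !expand3; apply: eq_tsum => xy w; apply: eq_tsum => x y.
by rewrite -(ab y) -(a'b y) !mulrA ia ia' -!mulrA e.
Qed.

Lemma lsub3_3 t u z : lsub k a a' ->
  forall {ia : intertwines u a a} {ia' : intertwines u a' a'},
  k (u * ev3 t b c a * z) = k (u * ev3 t b c a' * z).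
Proof.
move=> e ia ia'; rewrite !expand3; apply: eq_tsum => xy w; apply: eq_tsum => x y.
rewrite -!(mulrA (b x)) -(ac w) -(a'c w) !(mulrA (b x)) -(ab w) -(a'b w).
by rewrite !mulrA ia ia' -!mulrA e.
Qed.

Lemma rsub2_1 (t : (H ⊗ H)%type) u z : rsub k a a' ->
  forall {ia : intertwines z a a} {ia' : intertwines z a' a'},
  k (u * ev2 t a b * z) = k (u * ev2 t a' b * z).
Proof.
move=> e ia ia'; rewrite !expand2; apply: eq_tsum => x y.
by rewrite ab a'b -!mulrA -ia -ia' !mulrA e.
Qed.

Lemma rsub2_2 (t : (H ⊗ H)%type) u z : rsub k a a' ->
  forall {ia : intertwines z a a} {ia' : intertwines z a' a'},
  k (u * ev2 t b a * z) = k (u * ev2 t b a' * z).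
Proof.
move=> e ia ia'; rewrite !expand2; apply: eq_tsum => x y.
by rewrite -!mulrA -ia -ia' !mulrA e.
Qed.

Lemma rsub3_1 t u z : rsub k a a' ->
  forall {ia : intertwines z a a} {ia' : intertwines z a' a'},
  k (u * ev3 t a b c * z) = k (u * ev3 t a' b c * z).
Proof.
move=> e ia ia'; rewrite !expand3; apply: eq_tsum => xy w; apply: eq_tsum => x y.
by rewrite ab a'b -!(mulrA (b y)) ac a'c -!mulrA -ia -ia' !mulrA e.
Qed.

Lemma rsub3_2 t u z : rsub k a a' ->
  forall {ia : intertwines z a a} {ia' : intertwines z a' a'},
  k (u * ev3 t b a c * z) = k (u * ev3 t b a' c * z).
Proof.
move=> e ia ia'; rewrite !expand3; apply: eq_tsum => xy w; apply: eq_tsum => x y.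
by rewrite -!(mulrA (b x)) ac a'c -!mulrA -ia -ia' !mulrA e.
Qed.

Lemma rsub3_3 t u z : rsub k a a' ->
  forall {ia : intertwines z a a} {ia' : intertwines z a' a'},
  k (u * ev3 t b c a * z) = k (u * ev3 t b c a' * z).
Proof.
move=> e ia ia'; rewrite !expand3; apply: eq_tsum => xy w; apply: eq_tsum => x y.
by rewrite -!mulrA -ia -ia' !mulrA e.
Qed.
End Slots.
Section SlotsGeneral.
Context (a b c a' : H -> B) {ab : commuting a b} {ac : commuting a c} {bc : commuting b c}.
Context {a'b : commuting a' b} {a'c : commuting a' c}.

(** Here the prefix [u] is made part of the form, so it need not commute with [a] and [a']. The
    hypothesis is supplied by [lsub_starr] or [lsub_starl]. *)
Lemma lsub3_1_after t u z : lsub (fun y => k (u * y)) a a' ->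
  k (u * ev3 t a b c * z) = k (u * ev3 t a' b c * z).
Proof.
move=> e; rewrite !expand3; apply: eq_tsum => xy w; apply: eq_tsum => x y.
by rewrite -!mulrA e.
Qed.

Lemma lsub3_2_after t u z : lsub (fun y => k (u * y)) a a' ->
  k (u * ev3 t b a c * z) = k (u * ev3 t b a' c * z).
Proof.
move=> e; rewrite !expand3; apply: eq_tsum => xy w; apply: eq_tsum => x y.
by rewrite -(ab y) -(a'b y) -!mulrA e.
Qed.

Lemma lsub2_1_after (t : (H ⊗ H)%type) u z : lsub (fun y => k (u * y)) a a' ->
  k (u * ev2 t a b * z) = k (u * ev2 t a' b * z).
Proof. by move=> e; rewrite !expand2; apply: eq_tsum => x y; rewrite -!mulrA e. Qed.

Lemma rsub2_1_before (t : (H ⊗ H)%type) u z : rsub (fun y => k (y * z)) a a' ->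
  k (u * ev2 t a b * z) = k (u * ev2 t a' b * z).
Proof.
move=> e; rewrite !expand2; apply: eq_tsum => x y.
by rewrite ab a'b !mulrA e.
Qed.

Lemma rsub3_1_before t u z : rsub (fun y => k (y * z)) a a' ->
  k (u * ev3 t a b c * z) = k (u * ev3 t a' b c * z).
Proof.
move=> e; rewrite !expand3; apply: eq_tsum => xy w; apply: eq_tsum => x y.
by rewrite ab a'b -!(mulrA (b y)) ac a'c !mulrA e.
Qed.

Lemma rsub3_2_before t u z : rsub (fun y => k (y * z)) a a' ->
  k (u * ev3 t b a c * z) = k (u * ev3 t b a' c * z).
Proof.
move=> e; rewrite !expand3; apply: eq_tsum => xy w; apply: eq_tsum => x y.
by rewrite -!(mulrA (b x)) ac a'c !mulrA e.
Qed.
End SlotsGeneral.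
End Substitution.

Section PartialSubstitution.
Variables (K : fieldType) (H : falgType K) (Q : quasiBialgebra H) (B : falgType K).
Variables (U : lmodType K) (k : B -> U) (lk : linear k).
Context (p q : H -> B) {hp : alghom p} {pq : commuting p q}.

(** Only the deletable leg [q] has to travel through [u] to the left end. The leg [p] stays where it
    is, so [u] may involve [p]. *)
Lemma lsub_starr u {iu : intertwines u q q} :
  lsub k q (@triv _ _ Q _) -> lsub (fun z => k (u * z)) (star Q p q) p.
Proof.
move=> e; rewrite -[X in lsub _ _ X](star_trivr Q).
apply: lsub_star => //; last exact: lsub_mul.
by apply: (lin_comp lk); lin.
Qed.

Lemma lsub_starl u {iu : intertwines u q q} :
  lsub k q (@triv _ _ Q _) -> lsub (fun z => k (u * z)) (star Q q p) p.
Proof.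
move=> e; rewrite -[X in lsub _ _ X](star_trivl Q).
apply: lsub_star => //; last exact: lsub_mul.
by apply: (lin_comp lk); lin.
Qed.

Lemma rsub_starr u {iu : intertwines u q q} :
  rsub k q (@triv _ _ Q _) -> rsub (fun z => k (z * u)) (star Q p q) p.
Proof.
move=> e; rewrite -[X in rsub _ _ X](star_trivr Q).
apply: rsub_star => //; last exact: rsub_mul.
by apply: (lin_comp lk); lin.
Qed.
End PartialSubstitution.

#[global] Arguments slide2 {K H B} u t a b {a' b' ia ib}.
#[global] Arguments slide3 {K H B} u t a b c {a' b' c' ia ib ic}.
#[global] Arguments lsub2_1 {K H B U k} lk {a b a' t u z} _ {ia ia'}.
#[global] Arguments lsub2_2 {K H B U k} lk {a b a' ab a'b t u z} _ {ia ia'}.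
#[global] Arguments lsub3_1 {K H B U k} lk {a b c a' t u z} _ {ia ia'}.
#[global] Arguments lsub3_2 {K H B U k} lk {a b c a' ab a'b t u z} _ {ia ia'}.
#[global] Arguments lsub3_3 {K H B U k} lk {a b c a' ab ac a'b a'c t u z} _ {ia ia'}.
#[global] Arguments rsub2_1 {K H B U k} lk {a b a' ab a'b t u z} _ {ia ia'}.
#[global] Arguments rsub2_2 {K H B U k} lk {a b a' t u z} _ {ia ia'}.
#[global] Arguments rsub3_1 {K H B U k} lk {a b c a' ab ac a'b a'c t u z} _ {ia ia'}.
#[global] Arguments rsub3_2 {K H B U k} lk {a b c a' ac a'c t u z} _ {ia ia'}.
#[global] Arguments rsub3_3 {K H B U k} lk {a b c a' t u z} _ {ia ia'}.

(** * The algebra of words *)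

(* This interface of H^{⊗6} is all that is used; the instance below is opaque because unfolding
   the iterated tensor product makes conversion intractable. *)
Section SixLegs.
Variables (K : fieldType) (H : falgType K).

Definition multilinear6 (U : lmodType K) (M : H -> H -> H -> H -> H -> H -> U) :=
  ((forall b c d e f, linear (fun a => M a b c d e f)) *
   (forall a c d e f, linear (fun b => M a b c d e f)) *
   (forall a b d e f, linear (fun c => M a b c d e f)) *
   (forall a b c e f, linear (fun d => M a b c d e f)) *
   (forall a b c d f, linear (fun e => M a b c d e f)) *
   (forall a b c d e, linear (fun f => M a b c d e f)))%type.

Record sixfold := Sixfold {
  six_alg : falgType K;
  six : H -> H -> H -> H -> H -> H -> six_alg;
  six_multilinear : multilinear6 six;
  six_mul : forall a b c d e f a' b' c' d' e' f',
    six a b c d e f * six a' b' c' d' e' f' =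
    six (a * a') (b * b') (c * c') (d * d') (e * e') (f * f');
  six_one : six 1 1 1 1 1 1 = 1;
  six_ind : forall (U : lmodType K) (k k' : six_alg -> U), linear k -> linear k' ->
    (forall a b c d e f, k (six a b c d e f) = k' (six a b c d e f)) ->
    forall z, k z = k' z;
  six_lift : forall U : lmodType K, (H -> H -> H -> H -> H -> H -> U) -> six_alg -> U;
  six_lift_linear : forall (U : lmodType K) (M : H -> H -> H -> H -> H -> H -> U),
    linear (six_lift M);
  six_liftE : forall (U : lmodType K) (M : H -> H -> H -> H -> H -> H -> U),
    multilinear6 M -> forall a b c d e f, six_lift M (six a b c d e f) = M a b c d e f
}.

Lemma six_rec (T : sixfold) (U : lmodType K) (M : H -> H -> H -> H -> H -> H -> U) :
  multilinear6 M ->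
  exists2 k : six_alg T -> U, linear k &
    forall a b c d e f, k (six T a b c d e f) = M a b c d e f.
Proof. by exists (six_lift M); [exact: six_lift_linear | exact: six_liftE]. Qed.

Lemma tensor_ext (V W : vectType K) (U : lmodType K) (k k' : (V ⊗ W)%type -> U) :
  linear k -> linear k' -> (forall v w, k (v ⊗ w) = k' (v ⊗ w)) -> forall z, k z = k' z.
Proof.
move=> lk lk' e; elim/tensor_ind => // s t es et.
by rewrite -[s]scale1r lk lk' es et.
Qed.

Lemma sixfold_tensor : sixfold.
Proof.
apply: (@Sixfold (H ⊗ H ⊗ H ⊗ H ⊗ H ⊗ H)%type
  (fun a b c d e f => a ⊗ b ⊗ c ⊗ d ⊗ e ⊗ f) _ _ _ _
  (fun U M z => tsum z (fun z e => tsum z (fun z d => tsum z (fun z c =>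
    tsum z (fun z b' => tsum z (fun a b => M a b b' c d e))))))).
- by do ![split] => *; lin.
- by move=> *; rewrite !pure_tensorM.
- by [].
- move=> U k k' lk lk' e.
  have step (V W : vectType K) (l l' : (V ⊗ W)%type -> U) : linear l -> linear l' ->
      (forall w, linear (fun v => l (v ⊗ w)) -> linear (fun v => l' (v ⊗ w)) ->
         forall v, l (v ⊗ w) = l' (v ⊗ w)) -> forall z, l z = l' z.
    move=> ll ll' el; apply: tensor_ext => // v w; apply: el => {v}.
      by apply: (lin_comp (f := l)) => //; lin.
    by apply: (lin_comp (f := l')) => //; lin.
  by do 4![apply: (step) => // ? ? ?]; apply: tensor_ext.
- by move=> U M; lin.
- move=> U M [[[[[l1 l2] l3] l4] l5] l6] a b c d e f.
  by rewrite !tsum_pure //; (split=> w /=; lin).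
Qed.
End SixLegs.
#[global] Arguments lsub3_1_after {K H B U k} lk {a b c a' t u z} _.
#[global] Arguments lsub3_2_after {K H B U k} lk {a b c a' ab a'b t u z} _.
#[global] Arguments lsub2_1_after {K H B U k} lk {a b a' t u z} _.
#[global] Arguments rsub2_1_before {K H B U k} lk {a b a' ab a'b t u z} _.
#[global] Arguments rsub3_1_before {K H B U k} lk {a b c a' ab ac a'b a'c t u z} _.
#[global] Arguments rsub3_2_before {K H B U k} lk {a b c a' ac a'c t u z} _.

(** * Legs of the word algebra and rewriting of words *)

Section Legs.
Variables (K : fieldType) (H : falgType K) (T : sixfold H).
Local Notation B := (six_alg T).

Definition slot (m n : nat) (x : H) : H := if m == n then x else 1.
Definition leg (n : nat) (x : H) : B :=
  six T (slot 0 n x) (slot 1 n x) (slot 2 n x) (slot 3 n x) (slot 4 n x) (slot 5 n x).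

Lemma leg_alghom n : (n < 6)%N -> alghom (leg n).
Proof.
have [[[[[l1 l2] l3] l4] l5] l6] := six_multilinear T.
move=> n6; split=> [||x y].
- by case: n n6 => [|[|[|[|[|[|]]]]]] // _; rewrite /leg /slot /=.
- by rewrite /leg /slot !if_same six_one.
- rewrite /leg six_mul /slot; congr six; by case: ifP => _ //; rewrite mulr1.
Qed.

Lemma commuting_leg m n : m != n -> commuting (leg m) (leg n).
Proof.
move=> mn x y; rewrite /leg !six_mul /slot; congr six;
  do 2![case: eqP => [?|_]]; rewrite ?mulr1 ?mul1r //; subst;
  by rewrite eqxx in mn.
Qed.
End Legs.
(** Words number the legs from 1, [leg] from 0. *)
Local Notation i1 := (leg (sixfold_tensor _) 0).
Local Notation i2 := (leg (sixfold_tensor _) 1).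
Local Notation i3 := (leg (sixfold_tensor _) 2).
Local Notation i4 := (leg (sixfold_tensor _) 3).
Local Notation i5 := (leg (sixfold_tensor _) 4).
Local Notation i6 := (leg (sixfold_tensor _) 5).
#[global] Hint Extern 1 (alghom (leg _ _)) => simple apply leg_alghom; exact isT : typeclass_instances.
#[global] Hint Extern 1 (commuting (leg _ _) (leg _ _)) => simple apply commuting_leg; exact isT : typeclass_instances.

Ltac tail_form w z :=
  lazymatch w with
  | ?a * ?b => let r := tail_form b z in tail_form a r
  | 1 => z
  | ?a => constr:(a * z)
  end.

Lemma mulr_tail (B : pzRingType) (u v : B) : u = v -> forall z, u * z = v * z.
Proof. by move=> ->. Qed.

Lemma mulr_tailP (B : pzRingType) (u v : B) : (forall z, u * z = v * z) -> u = v.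
Proof. by move=> e; rewrite -[u]mulr1 e mulr1. Qed.

Lemma mulr_lcancel (B : pzRingType) (p q u v : B) : q * p = 1 -> p * u = p * v -> u = v.
Proof. by move=> qp /(congr1 ( *%R q)); rewrite !mulrA qp !mul1r. Qed.

Lemma mulr_rcancel (B : pzRingType) (p q u v : B) : p * q = 1 -> u * p = v * p -> u = v.
Proof. by move=> qp /(congr1 ( *%R^~ q)); rewrite -!mulrA qp !mulr1. Qed.

(* Rewrites with a word identity u = v inside a right-associated product. *)
Ltac word_rw_with E :=
  let T := type of E in
  lazymatch T with
  | ?l = ?r =>
    let e := fresh "e" in
    assert (e : forall z, ltac:(let l' := tail_form l z in
                                let r' := tail_form r z in exact (l' = r')));
    [ let z := fresh "z" in move=> z; have := mulr_tail E z;
      rewrite -?mulrA ?mul1r; exact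
    | rewrite ?e; clear e ]
  end.
Tactic Notation "wr" uconstr(t) :=
  let E := fresh "E" in pose proof t as E; word_rw_with E; clear E.
Tactic Notation "wr" "<-" uconstr(t) :=
  let E := fresh "E" in pose proof (esym t) as E; word_rw_with E; clear E.
Tactic Notation "lcancel" uconstr(t) :=
  let E := fresh "E" in pose proof t as E; apply (mulr_lcancel E); clear E.
Tactic Notation "rcancel" uconstr(t) :=
  let E := fresh "E" in pose proof t as E; apply (mulr_rcancel E); clear E.
(** The generic tail added here lets [wr] also match at the right end of a word. *)
Ltac word := apply: mulr_tailP => ?; rewrite -?mulrA ?mul1r.

Section Expansion.
Variables (K : fieldType) (H : falgType K) (B : falgType K) (U : lmodType K).
Variables (k : B -> U) (lk : linear k).
Implicit Types (a b c : H -> B) (u v z s : B).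

Lemma expand2r (t : (H ⊗ H)%type) a b u z :
  k (u * (ev2 t a b * z)) = \tsum_(x ⊗ y <- t) k (u * (a x * b y) * z).
Proof. by rewrite mulrA expand2. Qed.

Lemma expand3r (t : (H ⊗ H ⊗ H)%type) a b c u z :
  k (u * (ev3 t a b c * z)) = \tsum_(x ⊗ y ⊗ w <- t) k (u * (a x * b y * c w) * z).
Proof. by rewrite mulrA expand3. Qed.

Lemma expand_last (t : (H ⊗ H)%type) a b u z p :
  k (u * (p * ev2 t a b) * z) = \tsum_(x ⊗ y <- t) k (u * (p * (a x * b y)) * z).
Proof. by rewrite mulrA expand2 //; apply: eq_tsum => x y; rewrite !mulrA. Qed.

Lemma expand_first (t : (H ⊗ H)%type) a b u z p :
  k (u * (ev2 t a b * p) * z) = \tsum_(x ⊗ y <- t) k (u * (a x * b y * p) * z).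
Proof. by rewrite mulrA -(mulrA _ p) expand2 //; apply: eq_tsum => x y; rewrite !mulrA. Qed.
End Expansion.

Lemma linfun_fun (K : fieldType) (V W : vectType K) (g : V -> W) :
  linear g -> forall x, linfun g x = g x.
Proof.
move=> lg; pose h := GRing.isLinear.Build _ _ _ _ g lg.
pose G : {linear V -> W} := HB.pack g h.
exact: (lfunE G).
Qed.

Section LeftInverse.
Variables (K : fieldType) (A : falgType K).

(** In finite dimension left multiplication by [v] is injective, hence onto, so a one-sided inverse
    is two-sided. *)
Lemma falg_left_inverse (u v : A) : u * v = 1 -> v \is a GRing.unit /\ v^-1 = u.
Proof.
move=> uv; pose f : 'End(A) := linfun (fun w => v * w).
have fE w : f w = v * w by apply: linfun_fun; lin.
have kf : lker f == 0%VS.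
  apply/lker0P => x y; rewrite !fE => /(congr1 ( *%R u)).
  by rewrite !mulrA uv !mul1r.
have vu : v * u = 1.
  have vg : v * (f^-1%VF 1) = 1 by rewrite -fE (lker0_lfunVK kf).
  by rewrite -[u]mulr1 -vg (mulrA u) uv mul1r vg.
have Uv : v \is a GRing.unit by apply/unitrP; exists u.
by split=> //; apply: (mulrI Uv); rewrite vu divrr.
Qed.
End LeftInverse.

(** * The antipode axioms as deletion rules *)

Section QuasiHopfForms.
Variables (K : fieldType) (H : falgType K) (Q : quasiHopf H) (T : sixfold H).
Local Notation Phi := (Phi Q).
Local Notation "a ⋆ b" := (star Q a b).
Local Notation alpha := (alpha Q).
Local Notation beta := (beta Q).
Local Notation S := (antipode Q).
Local Notation Delta := (Delta Q).
Local Notation ε := (counit Q).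

Lemma lin_counit (V : lmodType K) (g : V -> H) :
  linear g -> linear (fun x => ε (g x) : K^o).
Proof. by move=> lg; apply: (lin_comp (f := ε : H -> K^o)); [exact: counit_linear|]. Qed.

Lemma cap_alpha (U : lmodType K) (F : H -> U) h : linear F ->
  \tsum_(x ⊗ y <- Delta h) F (S x * alpha * y) = ε h *: F alpha.
Proof.
by move=> lF; rewrite -(linear_tsum _ _ lF) antipode_alpha (linear_scale _ _ lF).
Qed.

Lemma cup_beta (U : lmodType K) (F : H -> U) h : linear F ->
  \tsum_(x ⊗ y <- Delta h) F (x * beta * S y) = ε h *: F beta.
Proof.
by move=> lF; rewrite -(linear_tsum _ _ lF) antipode_beta (linear_scale _ _ lF).
Qed.

Section Forms.
Variables (U : lmodType K) (k : six_alg T -> U) (lk : linear k).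

(** A deletion need only be tested on pure tensors, where it becomes an antipode axiom. *)
Lemma lsub_six (p q : H -> six_alg T) {hp : alghom p} {hq : alghom q} {pq : commuting p q} :
  (forall h a b c d e f, \tsum_(x ⊗ y <- Delta h) k (p x * q y * six T a b c d e f) =
     ε h *: k (six T a b c d e f)) -> lsub k (p ⋆ q) (@triv _ _ Q _).
Proof.
move=> e h z; rewrite /triv -scalerAl mul1r.
have lZ l x : k (l *: x) = l *: k x by exact: linear_scale.
move: z; apply: six_ind => [||a b c d e' f].
- by apply: (lin_comp lk); lin.
- by move=> l x y; rewrite scalerDr scalerA mulrC -scalerA lk !lZ.
rewrite lZ -e; have := expand2 lk (Delta h) p q 1 (six T a b c d e' f).
rewrite mul1r => ->; apply: eq_tsum => x y; by rewrite mul1r.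
Qed.

Lemma rsub_six (p q : H -> six_alg T) {hp : alghom p} {hq : alghom q} {pq : commuting p q} :
  (forall h a b c d e f, \tsum_(x ⊗ y <- Delta h) k (six T a b c d e f * (p x * q y)) =
     ε h *: k (six T a b c d e f)) -> rsub k (p ⋆ q) (@triv _ _ Q _).
Proof.
move=> e h z; rewrite /triv -scalerAr mulr1.
have lZ l x : k (l *: x) = l *: k x by exact: linear_scale.
move: z; apply: six_ind => [||a b c d e' f].
- by apply: (lin_comp lk); lin.
- by move=> l x y; rewrite scalerDr scalerA mulrC -scalerA lk !lZ.
rewrite lZ -e; have := expand2 lk (Delta h) p q (six T a b c d e' f) 1.
rewrite mulr1 => ->; apply: eq_tsum => x y; by rewrite mulr1.
Qed.
End Forms.

Lemma zigzag (U : lmodType K) (F : H -> U) : linear F ->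
  \tsum_(x ⊗ y ⊗ z <- Phi) F (x * beta * S y * alpha * z) = F 1.
Proof.
move=> lF; rewrite -(Phi_antipode Q) (linear_tsum _ _ lF); apply: eq_tsum => xy z.
by rewrite (linear_tsum _ _ lF).
Qed.

Lemma zigzagV (U : lmodType K) (F : H -> U) : linear F ->
  \tsum_(x ⊗ y ⊗ z <- Phi^-1) F (S x * alpha * y * beta * S z) = F 1.
Proof.
move=> lF; rewrite -(Phi_inv_antipode Q) (linear_tsum _ _ lF); apply: eq_tsum => xy z.
by rewrite (linear_tsum _ _ lF).
Qed.
End QuasiHopfForms.
Ltac linc := do ?[lin1 | apply: lin_counit].
Ltac legs kM M := rewrite ?mul1r ?mulr1 /leg /slot /= ?six_mul ?mul1r ?mulr1 kM
  /M ?mul1r ?mulr1 ?antipodeM ?antipode1 ?mul1r ?mulr1 ?mulrA.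

#[global] Arguments cap_alpha {K H} Q {U} F h.
#[global] Arguments cup_beta {K H} Q {U} F h.
#[global] Arguments zigzag {K H} Q {U} F.
#[global] Arguments zigzagV {K H} Q {U} F.

(** * The Drinfeld twist *)

(* Drinfeld's uniqueness of antipodes: rho \o S and T are conjugate whenever (T, a, b) satisfies
   the antipode axioms along rho. The twist is the case rho = Δ, T = (S ⊗ S) \o Δ^op. *)
Section AntipodeUniqueness.
Variables (K : fieldType) (H : falgType K) (Q : quasiHopf H).
Local Notation Phi := (Phi Q).
Local Notation alpha := (alpha Q).
Local Notation beta := (beta Q).
Local Notation S := (antipode Q).
Local Notation Delta := (Delta Q).
Local Notation ε := (counit Q).
Local Notation "a ⋆ b" := (star Q a b).
Local Notation "X[ a , b , c ]" := (ev3 Phi a b c).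
Local Notation "x[ a , b , c ]" := (ev3 Phi^-1 a b c).

Variables (A : falgType K) (rho T : H -> A) (a b : A).
Context {hrho : alghom rho}.
Hypothesis (lT : linear T) (TM : forall x y, T (x * y) = T y * T x) (T1 : T 1 = 1).
Hypothesis (Ta : forall h, \tsum_(x ⊗ y <- Delta h) T x * a * rho y = ε h *: a).
Hypothesis (Tb : forall h, \tsum_(x ⊗ y <- Delta h) rho x * b * T y = ε h *: b).

Definition antipode_twist : A :=
  \tsum_(x1 ⊗ x2 ⊗ x3 <- Phi^-1) T x1 * a * rho (x2 * beta * S x3).
Definition antipode_twist_inv : A :=
  \tsum_(x1 ⊗ x2 ⊗ x3 <- Phi^-1) rho (S x1 * alpha * x2) * b * T x3.

Lemma lin_rho (V : lmodType K) (g : V -> H) : linear g -> linear (fun x => rho (g x)).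
Proof. by have [lr _ _] := hrho; apply: lin_comp. Qed.

Lemma lin_T (V : lmodType K) (g : V -> H) : linear g -> linear (fun x => T (g x)).
Proof. exact: lin_comp. Qed.

Ltac linT := do ?[lin1 | apply: lin_counit | apply: lin_rho | apply: lin_T].

Lemma cap_T (U : lmodType K) (F : A -> U) h : linear F ->
  \tsum_(x ⊗ y <- Delta h) F (T x * a * rho y) = ε h *: F a.
Proof. by move=> lF; rewrite -(linear_tsum _ _ lF) Ta (linear_scale _ _ lF). Qed.

Lemma cup_T (U : lmodType K) (F : A -> U) h : linear F ->
  \tsum_(x ⊗ y <- Delta h) F (rho x * b * T y) = ε h *: F b.
Proof. by move=> lF; rewrite -(linear_tsum _ _ lF) Tb (linear_scale _ _ lF). Qed.

Arguments cap_T {U} F h.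
Arguments cup_T {U} F h.

(** A straightened zigzag. The pentagon rearranges the word so that the caps on legs 1, 2 and 3, 4
    and the cup on legs 2, 3 delete all but one associator, whose value is the first zigzag
    axiom. *)
Lemma antipode_twist_alpha : antipode_twist * rho alpha = a.
Proof.
have [_ r1 rM] := hrho.
pose M (l1 l2 l3 l4 l5 l6 : H) : A :=
  ε l5 *: (ε l6 *: (T l1 * a * rho (l2 * beta * S l3 * alpha * l4))).
have lM : multilinear6 M by do ![split] => *; rewrite /M; linT.
have [k lk kM] := six_rec (sixfold_tensor H) lM.
have c12 : lsub k (i1 ⋆ i2) (@triv _ _ Q _).
  apply: lsub_six => // h l1 l2 l3 l4 l5 l6.
  rewrite kM -(cap_T (fun z => ε l5 *: (ε l6 *:
    (T l1 * z * rho (l2 * beta * S l3 * alpha * l4))))); last by linT.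
  by apply: eq_tsum => x y; legs kM M; rewrite ?rM ?TM ?mulrA.
have c34 : lsub k (i3 ⋆ i4) (@triv _ _ Q _).
  apply: lsub_six => // h l1 l2 l3 l4 l5 l6.
  rewrite kM -(cap_alpha Q (fun z => ε l5 *: (ε l6 *:
    (T l1 * a * rho (l2 * beta * S l3 * z * l4))))); last by linT.
  by apply: eq_tsum => x y; legs kM M.
have c23 : rsub k (i2 ⋆ i3) (@triv _ _ Q _).
  apply: rsub_six => // h l1 l2 l3 l4 l5 l6.
  rewrite kM -(cup_beta Q (fun z => ε l5 *: (ε l6 *:
    (T l1 * a * rho (l2 * z * S l3 * alpha * l4))))); last by linT.
  by apply: eq_tsum => x y; legs kM M.
have e1 : k x[i1, i2, i3] = antipode_twist * rho alpha.
  rewrite -[X in k X]mulr1 -[X in k (X * _)]mul1r expand3 //.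
  rewrite /antipode_twist (linear_tsum (g := fun y => y * _)); last by lin.
  apply: eq_tsum => xy z; rewrite (linear_tsum (g := fun y => y * _)); last by lin.
  apply: eq_tsum => x y; legs kM M.
  by rewrite counit1 !scale1r -!mulrA -rM !mulrA.
have e2 : k X[i2, i3, i4] = a.
  rewrite -[X in k X]mulr1 -[X in k (X * _)]mul1r expand3 //.
  rewrite -[RHS]mulr1 -[X in _ = _ * X]r1 -(zigzag Q (fun z => a * rho z)); last by linT.
  apply: eq_tsum => xy z; apply: eq_tsum => x y; legs kM M.
  by rewrite counit1 !scale1r T1 mul1r.
rewrite -e1 -[RHS]e2.
(* This associator may be inserted because the cap on legs 1 and 2 makes it trivial under [k]. The
   factor 1 is the empty prefix that the substitution lemmas expect. *)
have -> : k x[i1, i2, i3] = k (1 * X[i1 ⋆ i2, i3, i4] * x[i1, i2, i3]).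
  by rewrite (lsub3_1 lk c12) assoc_triv1 !mul1r.
have -> : 1 * X[i1 ⋆ i2, i3, i4] * x[i1, i2, i3] =
    1 * x[i1, i2, i3 ⋆ i4] * (X[i2, i3, i4] * X[i1, i2 ⋆ i3, i4]).
  lcancel (assocVK Q i1 i2 (i3 ⋆ i4)); word; wr (assocK Q i1 i2 (i3 ⋆ i4)).
  wr <- (pentagon Q i1 i2 i3 i4).
  by wr (assocK Q i1 i2 i3).
rewrite (lsub3_3 lk c34) assocV_triv3 !mul1r -[X in k X]mulr1.
by rewrite (rsub3_2 lk c23) assoc_triv2 !mulr1.
Qed.

(** On leg 3 at the left end, [h] is the same as [h] on the coproduct of all three legs.
    Coassociativity carries that letter to the right end, where the cup leaves only leg 1. *)
Lemma antipode_twist_conj h : antipode_twist * rho (S h) = T h * antipode_twist.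
Proof.
have [_ r1 rM] := hrho.
pose M (l1 l2 l3 l4 l5 l6 : H) : A :=
  ε l4 *: (ε l5 *: (ε l6 *: (T l1 * a * rho (l2 * beta * S l3)))).
have lM : multilinear6 M by do ![split] => *; rewrite /M; linT.
have [k lk kM] := six_rec (sixfold_tensor H) lM.
have c12 : lsub k (i1 ⋆ i2) (@triv _ _ Q _).
  apply: lsub_six => // p l1 l2 l3 l4 l5 l6.
  rewrite kM -(cap_T (fun z => ε l4 *: (ε l5 *: (ε l6 *:
    (T l1 * z * rho (l2 * beta * S l3)))))); last by linT.
  by apply: eq_tsum => x y; legs kM M; rewrite ?rM ?TM ?mulrA.
have c23 : rsub k (i2 ⋆ i3) (@triv _ _ Q _).
  apply: rsub_six => // p l1 l2 l3 l4 l5 l6.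
  rewrite kM -(cup_beta Q (fun z => ε l4 *: (ε l5 *: (ε l6 *:
    (T l1 * a * rho (l2 * z * S l3)))))); last by linT.
  by apply: eq_tsum => x y; legs kM M.
have e1 : k (i3 h * x[i1, i2, i3]) = antipode_twist * rho (S h).
  rewrite -[X in k X]mulr1 expand3 //.
  rewrite /antipode_twist (linear_tsum (g := fun y => y * _)); last by lin.
  apply: eq_tsum => xy z; rewrite (linear_tsum (g := fun y => y * _)); last by lin.
  apply: eq_tsum => x y; legs kM M.
  by rewrite counit1 !scale1r -(mulrA _ (rho _)) -rM ?mulrA.
have e2 : k (x[i1, i2, i3] * i1 h) = T h * antipode_twist.
  rewrite -[X in k (X * _)]mul1r expand3 //.
  rewrite /antipode_twist (linear_tsum (g := fun y => _ * y)); last by lin.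
  apply: eq_tsum => xy z; rewrite (linear_tsum (g := fun y => _ * y)); last by lin.
  apply: eq_tsum => x y; legs kM M.
  by rewrite counit1 !scale1r TM ?mulrA.
rewrite -e1 -e2.
have l3 : lsub k (i1 ⋆ i2 ⋆ i3) i3.
  by rewrite -[X in lsub _ _ X](@star_trivl _ _ Q); apply: lsub_star.
have r1' : rsub k (i1 ⋆ (i2 ⋆ i3)) i1.
  by rewrite -[X in rsub _ _ X](@star_trivr _ _ Q); apply: rsub_star.
by rewrite -l3 -r1' star_assocV.
Qed.

Lemma antipode_twist_inv_conj h : rho (S h) * antipode_twist_inv = antipode_twist_inv * T h.
Proof.
have [_ r1 rM] := hrho.
pose M (l1 l2 l3 l4 l5 l6 : H) : A :=
  ε l4 *: (ε l5 *: (ε l6 *: (rho (S l1 * alpha * l2) * b * T l3))).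
have lM : multilinear6 M by do ![split] => *; rewrite /M; linT.
have [k lk kM] := six_rec (sixfold_tensor H) lM.
have c12 : lsub k (i1 ⋆ i2) (@triv _ _ Q _).
  apply: lsub_six => // p l1 l2 l3 l4 l5 l6.
  rewrite kM -(cap_alpha Q (fun z => ε l4 *: (ε l5 *: (ε l6 *:
    (rho (S l1 * z * l2) * b * T l3))))); last by linT.
  by apply: eq_tsum => x y; legs kM M.
have c23 : rsub k (i2 ⋆ i3) (@triv _ _ Q _).
  apply: rsub_six => // p l1 l2 l3 l4 l5 l6.
  rewrite kM -(cup_T (fun z => ε l4 *: (ε l5 *: (ε l6 *:
    (rho (S l1 * alpha * l2) * z * T l3))))); last by linT.
  by apply: eq_tsum => x y; legs kM M; rewrite ?rM ?TM ?mulrA.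
have e1 : k (i3 h * x[i1, i2, i3]) = antipode_twist_inv * T h.
  rewrite -[X in k X]mulr1 expand3 //.
  rewrite /antipode_twist_inv (linear_tsum (g := fun y => y * _)); last by lin.
  apply: eq_tsum => xy z; rewrite (linear_tsum (g := fun y => y * _)); last by lin.
  apply: eq_tsum => x y; legs kM M.
  by rewrite counit1 !scale1r TM ?mulrA.
have e2 : k (x[i1, i2, i3] * i1 h) = rho (S h) * antipode_twist_inv.
  rewrite -[X in k (X * _)]mul1r expand3 //.
  rewrite /antipode_twist_inv (linear_tsum (g := fun y => _ * y)); last by lin.
  apply: eq_tsum => xy z; rewrite (linear_tsum (g := fun y => _ * y)); last by lin.
  apply: eq_tsum => x y; legs kM M.
  by rewrite counit1 !scale1r ?mulrA -rM ?mulrA.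
rewrite -e1 -e2.
have l3 : lsub k (i1 ⋆ i2 ⋆ i3) i3.
  by rewrite -[X in lsub _ _ X](@star_trivl _ _ Q); apply: lsub_star.
have r1' : rsub k (i1 ⋆ (i2 ⋆ i3)) i1.
  by rewrite -[X in rsub _ _ X](@star_trivr _ _ Q); apply: rsub_star.
by rewrite -l3 -r1' star_assocV.
Qed.

(** Mirror image of [antipode_twist_alpha], with caps and cups exchanged. *)
Lemma beta_antipode_twist_inv : rho beta * antipode_twist_inv = b.
Proof.
have [_ r1 rM] := hrho.
pose M (l1 l2 l3 l4 l5 l6 : H) : A :=
  ε l5 *: (ε l6 *: (rho (l1 * beta * S l2 * alpha * l3) * b * T l4)).
have lM : multilinear6 M by do ![split] => *; rewrite /M; linT.
have [k lk kM] := six_rec (sixfold_tensor H) lM.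
have c12 : rsub k (i1 ⋆ i2) (@triv _ _ Q _).
  apply: rsub_six => // p l1 l2 l3 l4 l5 l6.
  rewrite kM -(cup_beta Q (fun z => ε l5 *: (ε l6 *:
    (rho (l1 * z * S l2 * alpha * l3) * b * T l4)))); last by linT.
  by apply: eq_tsum => x y; legs kM M.
have c34 : rsub k (i3 ⋆ i4) (@triv _ _ Q _).
  apply: rsub_six => // p l1 l2 l3 l4 l5 l6.
  rewrite kM -(cup_T (fun z => ε l5 *: (ε l6 *:
    (rho (l1 * beta * S l2 * alpha * l3) * z * T l4)))); last by linT.
  by apply: eq_tsum => x y; legs kM M; rewrite ?rM ?TM ?mulrA.
have c23 : lsub k (i2 ⋆ i3) (@triv _ _ Q _).
  apply: lsub_six => // p l1 l2 l3 l4 l5 l6.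
  rewrite kM -(cap_alpha Q (fun z => ε l5 *: (ε l6 *:
    (rho (l1 * beta * S l2 * z * l3) * b * T l4)))); last by linT.
  by apply: eq_tsum => x y; legs kM M.
have e1 : k x[i2, i3, i4] = rho beta * antipode_twist_inv.
  rewrite -[X in k X]mulr1 -[X in k (X * _)]mul1r expand3 //.
  rewrite /antipode_twist_inv (linear_tsum (g := fun y => _ * y)); last by lin.
  apply: eq_tsum => xy z; rewrite (linear_tsum (g := fun y => _ * y)); last by lin.
  apply: eq_tsum => x y; legs kM M.
  by rewrite counit1 !scale1r ?mulrA -rM ?mulrA.
have e2 : k X[i1, i2, i3] = b.
  rewrite -[X in k X]mulr1 -[X in k (X * _)]mul1r expand3 //.
  rewrite -[RHS]mul1r -[X in _ = X * _]r1 -(zigzag Q (fun z => rho z * b)); last by linT.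
  apply: eq_tsum => xy z; apply: eq_tsum => x y; legs kM M.
  by rewrite counit1 !scale1r T1 mulr1.
rewrite -e1 -e2.
have -> : k x[i2, i3, i4] = k (x[i2, i3, i4] * X[i1, i2, i3 ⋆ i4] * 1).
  by rewrite (rsub3_3 lk c34) assoc_triv3 !mulr1.
have -> : x[i2, i3, i4] * X[i1, i2, i3 ⋆ i4] * 1 =
    1 * X[i1, i2 ⋆ i3, i4] * (X[i1, i2, i3] * x[i1 ⋆ i2, i3, i4]).
  lcancel (assocVK Q i2 i3 i4); word; wr (assocK Q i2 i3 i4).
  wr (pentagon Q i1 i2 i3 i4).
  by wr (assocK Q (i1 ⋆ i2) i3 i4).
rewrite (lsub3_2 lk c23) assoc_triv2 !mul1r -[X in k X]mulr1.
by rewrite (rsub3_1 lk c12) assocV_triv1 !mulr1.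
Qed.

(** Once S(x^3) has been moved through the inverse candidate and β absorbed into b, the product is
    literally the zigzag relation for (T, a, b). *)
Lemma antipode_twistK :
  \tsum_(x1 ⊗ x2 ⊗ x3 <- Phi^-1) T x1 * a * rho x2 * b * T x3 = 1 ->
  antipode_twist * antipode_twist_inv = 1.
Proof.
have [_ r1 rM] := hrho; move=> <-.
rewrite {1}/antipode_twist (linear_tsum (g := fun y => y * _)); last by lin.
apply: eq_tsum => xy z; rewrite (linear_tsum (g := fun y => y * _)); last by lin.
apply: eq_tsum => x y; rewrite !rM -!mulrA antipode_twist_inv_conj.
by rewrite (mulrA (rho beta)) beta_antipode_twist_inv ?mulrA.
Qed.
End AntipodeUniqueness.

(** * The antipode axioms along Δ, with γ and δ *)

Section DrinfeldTwist.
Variables (K : fieldType) (H : falgType K) (Q : quasiHopf H).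
Local Notation Phi := (Phi Q).
Local Notation alpha := (alpha Q).
Local Notation beta := (beta Q).
Local Notation S := (antipode Q).
Local Notation Delta := (Delta Q).
Local Notation ε := (counit Q).
Local Notation "a ⋆ b" := (star Q a b).
Local Notation "X[ a , b , c ]" := (ev3 Phi a b c).
Local Notation "x[ a , b , c ]" := (ev3 Phi^-1 a b c).

Definition tensor_antipode (h : H) : (H ⊗ H)%type := tmap S S (tflip (Delta h)).
Local Notation SS := tensor_antipode.

Lemma tensor_antipodeE h : SS h = \tsum_(x ⊗ y <- Delta h) S y ⊗ S x.
Proof.
rewrite /tensor_antipode /tmap (linear_tsum (g := fun t => tsum t _)); last exact: tsum_linear.
by apply: eq_tsum => x y; rewrite tsum_pure //; split=> ?; lin.
Qed.

Lemma tensor_antipode_linear : linear SS.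
Proof.
have -> : SS = fun h => \tsum_(x ⊗ y <- Delta h) S y ⊗ S x.
  by apply: functional_extensionality => h; exact: tensor_antipodeE.
by lin.
Qed.

Lemma tensor_antipode1 : SS 1 = 1.
Proof.
rewrite tensor_antipodeE rmorph1 tsum_one; last by split=> ?; lin.
by rewrite !antipode1.
Qed.

Lemma tensor_antipodeM x y : SS (x * y) = SS y * SS x.
Proof.
rewrite !tensor_antipodeE rmorphM tsum_mul; last by split=> ?; lin.
rewrite exchange_tsum (linear_tsum (g := fun z => z * _)); last by lin.
apply: eq_tsum => a b; rewrite (linear_tsum (g := fun z => _ * z)); last by lin.
by apply: eq_tsum => c d; rewrite pure_tensorM !antipodeM.
Qed.

Lemma Delta_alghom : alghom (fun h => Delta h).
Proof. by split=> [||x y]; [exact: linearP | exact: rmorph1 | exact: rmorphM]. Qed.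

Definition drinfeld_delta : (H ⊗ H)%type :=
  \tsum_(B1 ⊗ B2 ⊗ B3 ⊗ B4 <-
      (\tsum_(X1 ⊗ X2 ⊗ X3 <- Phi) (Delta X1 ⊗ X2 ⊗ X3)) * (Phi^-1 ⊗ 1))
    (B1 * beta * S B4) ⊗ (B2 * beta * S B3).
Local Notation gamma := (drinfeld_gamma Q).
Local Notation delta := drinfeld_delta.

Section FourLegs.
Variables (B : falgType K) (a b c d : H -> B).
Context {ha : alghom a} {hb : alghom b} {hc : alghom c} {hd : alghom d}.
Context {ab : commuting a b} {ac : commuting a c} {ad : commuting a d}.
Context {bc : commuting b c} {bd : commuting b d} {cd : commuting c d}.

Lemma ev4_expand (U : lmodType K) (k : B -> U) t u z : linear k ->
  k (u * ev4 t a b c d * z) =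
  \tsum_(x ⊗ y ⊗ w ⊗ v <- t) k (u * (a x * b y * c w * d v) * z).
Proof.
move=> lk; rewrite /ev4 (linear_tsum (g := fun y => k (u * y * z)) _ _ (linear_mulk lk u z)).
apply: eq_tsum => xyw v; rewrite (mulrA u) -(mulrA _ (d v)) expand3 //.
by apply: eq_tsum => xy w; apply: eq_tsum => x y; rewrite !mulrA.
Qed.

Lemma ev4_gamma : ev4 ((Phi ⊗ 1) * \tsum_(x1 ⊗ x2 ⊗ x3 <- Phi^-1) (Delta x1 ⊗ x2 ⊗ x3))
    a b c d = X[a, b, c] * x[a ⋆ b, c, d].
Proof.
have [[la a1 _] [lb b1 _] [lc c1 _] [ld d1 _]] := And4 ha hb hc hd.
rewrite ev4M // ev4_pure // d1 mulr1; congr (_ * _).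
rewrite (linear_tsum _ _ (ev4_linear a b c d)); apply: eq_tsum => xy z.
rewrite (linear_tsum _ _ (ev4_linear a b c d)); apply: eq_tsum => x y.
by rewrite ev4_pure // ev3_pure.
Qed.

Lemma ev4_delta : ev4 ((\tsum_(X1 ⊗ X2 ⊗ X3 <- Phi) (Delta X1 ⊗ X2 ⊗ X3)) * (Phi^-1 ⊗ 1))
    a b c d = X[a ⋆ b, c, d] * x[a, b, c].
Proof.
have [[la a1 _] [lb b1 _] [lc c1 _] [ld d1 _]] := And4 ha hb hc hd.
rewrite ev4M // [X in _ * X]ev4_pure // d1 mulr1; congr (_ * _).
rewrite (linear_tsum _ _ (ev4_linear a b c d)); apply: eq_tsum => xy z.
rewrite (linear_tsum _ _ (ev4_linear a b c d)); apply: eq_tsum => x y.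
by rewrite ev4_pure // ev3_pure.
Qed.
End FourLegs.
Arguments ev4_expand {B a b c d U k} t u z lk.

(** γ is a pair of nested caps, on legs 2, 3 inside legs 1, 4. Conjugation by the word of γ brings
    the coproduct of [h] into the shape 1 ⋆ (2 ⋆ 3) ⋆ 4, where the inner cap and then the outer one
    delete it. *)
Lemma cap_gamma h : \tsum_(x ⊗ y <- Delta h) SS x * gamma * Delta y = ε h *: gamma.
Proof.
pose M (l1 l2 l3 l4 l5 l6 : H) : (H ⊗ H)%type :=
  ε l5 *: (ε l6 *: ((S l2 * alpha * l3) ⊗ (S l1 * alpha * l4))).
have lM : multilinear6 M by do ![split] => *; rewrite /M; linc.
have [k lk kM] := six_rec (sixfold_tensor H) lM.
have c23 : lsub k (i2 ⋆ i3) (@triv _ _ Q _).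
  apply: lsub_six => // p l1 l2 l3 l4 l5 l6.
  rewrite kM -(cap_alpha Q (fun z => ε l5 *: (ε l6 *:
    ((S l2 * z * l3) ⊗ (S l1 * alpha * l4))))); last by linc.
  by apply: eq_tsum => x y; legs kM M.
have c14 : lsub k (i1 ⋆ i4) (@triv _ _ Q _).
  apply: lsub_six => // p l1 l2 l3 l4 l5 l6.
  rewrite kM -(cap_alpha Q (fun z => ε l5 *: (ε l6 *:
    ((S l2 * alpha * l3) ⊗ (S l1 * z * l4))))); last by linc.
  by apply: eq_tsum => x y; legs kM M.
pose W : six_alg (sixfold_tensor H) := X[i1, i2, i3] * x[i1 ⋆ i2, i3, i4].
have kW : k W = gamma.
  rewrite /W -ev4_gamma -[X in k X]mulr1 -[X in k (X * _)]mul1r ev4_expand //.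
  apply: eq_tsum => xyz t; apply: eq_tsum => xy z; apply: eq_tsum => x y; legs kM M.
  by rewrite counit1 !scale1r.
have l14 : lsub k (i1 ⋆ (i2 ⋆ i3) ⋆ i4) (@triv _ _ Q _).
  have l1 : lsub k (i1 ⋆ (i2 ⋆ i3)) i1.
    by rewrite -[X in lsub _ _ X](@star_trivr _ _ Q); apply: lsub_star.
  have l2 : lsub k (i1 ⋆ (i2 ⋆ i3) ⋆ i4) (i1 ⋆ i4) by apply: lsub_star.
  by move=> p z; rewrite l2 c14.
have kr z x y : k (z * ((i1 ⋆ i2) x * (i3 ⋆ i4) y)) = SS x * k z * Delta y.
  move: z; apply: six_ind => [p u v|p u v|l1 l2 l3 l4 l5 l6].
  - by rewrite mulrDl -scalerAl lk.
  - by rewrite lk mulrDr mulrDl -scalerAr -scalerAl.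
  rewrite -[X in k X]mulr1 expand_first // kM tensor_antipodeE.
  rewrite [Delta y]tensorE -mulrA (linear_tsum (g := fun z => z * _)); last by lin.
  apply: eq_tsum => x1 x2; rewrite expand_last //.
  rewrite mulrA (linear_tsum (g := fun z => _ * z)); last by lin.
  apply: eq_tsum => y1 y2; legs kM M.
  by rewrite /M -!scalerAr -!scalerAl !pure_tensorM !mulrA.
have e2 : k (W * (i1 ⋆ i2 ⋆ (i3 ⋆ i4)) h) = ε h *: gamma.
  have -> : W * (i1 ⋆ i2 ⋆ (i3 ⋆ i4)) h = (i1 ⋆ (i2 ⋆ i3) ⋆ i4) h * W.
    by rewrite /W -mulrA star_assocV !mulrA; congr (_ * _); apply: intertwines_star.
  by rewrite l14 /triv -scalerAl mul1r -kW (linear_scale _ _ lk).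
rewrite -e2 -[X in k X]mulr1 expand2 //; apply: eq_tsum => x y.
by rewrite mulr1 kr kW.
Qed.

Lemma cup_delta h : \tsum_(x ⊗ y <- Delta h) Delta x * delta * SS y = ε h *: delta.
Proof.
pose M (l1 l2 l3 l4 l5 l6 : H) : (H ⊗ H)%type :=
  ε l5 *: (ε l6 *: ((l1 * beta * S l4) ⊗ (l2 * beta * S l3))).
have lM : multilinear6 M by do ![split] => *; rewrite /M; linc.
have [k lk kM] := six_rec (sixfold_tensor H) lM.
have c23 : rsub k (i2 ⋆ i3) (@triv _ _ Q _).
  apply: rsub_six => // p l1 l2 l3 l4 l5 l6.
  rewrite kM -(cup_beta Q (fun z => ε l5 *: (ε l6 *:
    ((l1 * beta * S l4) ⊗ (l2 * z * S l3))))); last by linc.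
  by apply: eq_tsum => x y; legs kM M.
have c14 : rsub k (i1 ⋆ i4) (@triv _ _ Q _).
  apply: rsub_six => // p l1 l2 l3 l4 l5 l6.
  rewrite kM -(cup_beta Q (fun z => ε l5 *: (ε l6 *:
    ((l1 * z * S l4) ⊗ (l2 * beta * S l3))))); last by linc.
  by apply: eq_tsum => x y; legs kM M.
pose W : six_alg (sixfold_tensor H) := X[i1 ⋆ i2, i3, i4] * x[i1, i2, i3].
have kW : k W = delta.
  rewrite /W -ev4_delta -[X in k X]mulr1 -[X in k (X * _)]mul1r ev4_expand //.
  apply: eq_tsum => xyz t; apply: eq_tsum => xy z; apply: eq_tsum => x y; legs kM M.
  by rewrite counit1 !scale1r.
have r14 : rsub k (i1 ⋆ (i2 ⋆ i3) ⋆ i4) (@triv _ _ Q _).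
  have l1 : rsub k (i1 ⋆ (i2 ⋆ i3)) i1.
    by rewrite -[X in rsub _ _ X](@star_trivr _ _ Q); apply: rsub_star.
  have l2 : rsub k (i1 ⋆ (i2 ⋆ i3) ⋆ i4) (i1 ⋆ i4) by apply: rsub_star.
  by move=> p z; rewrite l2 c14.
have kr z x y : k ((i1 ⋆ i2) x * (i3 ⋆ i4) y * z) = Delta x * k z * SS y.
  move: z; apply: six_ind => [p u v|p u v|l1 l2 l3 l4 l5 l6].
  - by rewrite mulrDr -scalerAr lk.
  - by rewrite lk mulrDr mulrDl -scalerAr -scalerAl.
  rewrite -[X in k (X * _)]mul1r expand_first // kM tensor_antipodeE.
  rewrite [Delta x in RHS]tensorE -mulrA (linear_tsum (g := fun z => z * _)); last by lin.
  apply: eq_tsum => x1 x2; rewrite expand_last //.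
  rewrite mulrA (linear_tsum (g := fun z => _ * z)); last by lin.
  apply: eq_tsum => y1 y2; legs kM M.
  by rewrite /M -!scalerAr -!scalerAl !pure_tensorM !mulrA.
have e2 : k ((i1 ⋆ i2 ⋆ (i3 ⋆ i4)) h * W) = ε h *: delta.
  have -> : (i1 ⋆ i2 ⋆ (i3 ⋆ i4)) h * W = W * (i1 ⋆ (i2 ⋆ i3) ⋆ i4) h.
    rewrite /W mulrA -star_assoc -!mulrA; congr (_ * _); symmetry.
    exact: intertwines_star.
  by rewrite r14 /triv -scalerAr mulr1 -kW (linear_scale _ _ lk).
rewrite -e2 -[X in k (X * _)]mul1r expand2 //; apply: eq_tsum => x y.
by rewrite mul1r kr kW.
Qed.

(** Two nested zigzags: reassociation and deletions separate legs 1, 4, 5 from legs 2, 3, 6, and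
    each triple is then the second zigzag axiom. *)
Lemma zigzag_gamma_delta :
  \tsum_(x1 ⊗ x2 ⊗ x3 <- Phi^-1) SS x1 * gamma * Delta x2 * delta * SS x3 = 1.
Proof.
pose M (l1 l2 l3 l4 l5 l6 : H) : (H ⊗ H)%type :=
  (S l2 * alpha * l3 * beta * S l6) ⊗ (S l1 * alpha * l4 * beta * S l5).
have lM : multilinear6 M by do ![split] => *; rewrite /M; linc.
have [k lk kM] := six_rec (sixfold_tensor H) lM.
have c23 : lsub k (i2 ⋆ i3) (@triv _ _ Q _).
  apply: lsub_six => // p l1 l2 l3 l4 l5 l6.
  rewrite kM -(cap_alpha Q (fun z =>
    (S l2 * z * l3 * beta * S l6) ⊗ (S l1 * alpha * l4 * beta * S l5))); last by linc.
  by apply: eq_tsum => x y; legs kM M.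
have c14 : lsub k (i1 ⋆ i4) (@triv _ _ Q _).
  apply: lsub_six => // p l1 l2 l3 l4 l5 l6.
  rewrite kM -(cap_alpha Q (fun z =>
    (S l2 * alpha * l3 * beta * S l6) ⊗ (S l1 * z * l4 * beta * S l5))); last by linc.
  by apply: eq_tsum => x y; legs kM M.
have c45 : rsub k (i4 ⋆ i5) (@triv _ _ Q _).
  apply: rsub_six => // p l1 l2 l3 l4 l5 l6.
  rewrite kM -(cup_beta Q (fun z =>
    (S l2 * alpha * l3 * beta * S l6) ⊗ (S l1 * alpha * l4 * z * S l5))); last by linc.
  by apply: eq_tsum => x y; legs kM M.
have c36 : rsub k (i3 ⋆ i6) (@triv _ _ Q _).
  apply: rsub_six => // p l1 l2 l3 l4 l5 l6.
  rewrite kM -(cup_beta Q (fun z =>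
    (S l2 * alpha * l3 * z * S l6) ⊗ (S l1 * alpha * l4 * beta * S l5))); last by linc.
  by apply: eq_tsum => x y; legs kM M.
pose W : six_alg (sixfold_tensor H) :=
  X[i1, i2, i3] * x[i1 ⋆ i2, i3, i4] * x[i1 ⋆ i2, i3 ⋆ i4, i5 ⋆ i6] *
  (X[i3 ⋆ i4, i5, i6] * x[i3, i4, i5]).
have -> : \tsum_(x1 ⊗ x2 ⊗ x3 <- Phi^-1) SS x1 * gamma * Delta x2 * delta * SS x3 = k W.
  rewrite /W expand3 // -ev4_gamma -ev4_delta.
  apply: eq_tsum => xy c; apply: eq_tsum => a b.
  rewrite -[X in k (X * _ * _)]mul1r -[X in k X]mulr1 -!mulrA (mulrA 1) ev4_expand //.
  have lg : linear (fun z => SS a * (z * (Delta b * (delta * SS c)))) by lin.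
  rewrite {1}/gamma (linear_tsum _ _ lg); apply: eq_tsum => A123 A4.
  rewrite (linear_tsum _ _ lg); apply: eq_tsum => A12 A3.
  rewrite (linear_tsum _ _ lg); apply: eq_tsum => A1 A2 {lg}.
  set v := _ ⊗ _.
  have la : linear (fun z => z * (v * (Delta b * (delta * SS c)))) by lin.
  rewrite [in LHS]tensor_antipodeE.
  rewrite (linear_tsum _ _ la). rewrite {1}/star (expand2r lk).
  apply: eq_tsum => a1 a2 {la}; set va := _ ⊗ _.
  have lb : linear (fun z => va * (v * (z * (delta * SS c)))) by lin.
  rewrite [Delta b in LHS]tensorE (linear_tsum _ _ lb) {1}/star (expand2r lk).
  apply: eq_tsum => b1 b2 {lb}; set vb := _ ⊗ _.
  have lc : linear (fun z => va * (v * (vb * (delta * z)))) by lin.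
  rewrite [in LHS]tensor_antipodeE (linear_tsum _ _ lc) {1}/star (expand2r lk).
  apply: eq_tsum => c1 c2 {lc}; set vc := _ ⊗ _.
  have ld : linear (fun z => va * (v * (vb * (z * vc)))) by lin.
  rewrite [X in _ = k X]mulrA (ev4_expand _ _ _ lk) /delta (linear_tsum _ _ ld); apply: eq_tsum => B123 B4.
  rewrite (linear_tsum _ _ ld); apply: eq_tsum => B12 B3.
  rewrite (linear_tsum _ _ ld); apply: eq_tsum => B1 B2 {ld}.
  by legs kM M; rewrite /va /v /vb /vc !pure_tensorM !mulrA.
have l1 : lsub k (i1 ⋆ (i2 ⋆ i3)) i1.
  by rewrite -[X in lsub _ _ X](@star_trivr _ _ Q); apply: lsub_star.
have l14 : lsub k (i1 ⋆ (i2 ⋆ i3) ⋆ i4) (@triv _ _ Q _).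
  have l2 : lsub k (i1 ⋆ (i2 ⋆ i3) ⋆ i4) (i1 ⋆ i4) by apply: lsub_star.
  by move=> p z; rewrite l2 c14.
have r3 : rsub k (i3 ⋆ (i4 ⋆ i5)) i3.
  by rewrite -[X in rsub _ _ X](@star_trivr _ _ Q); apply: rsub_star.
(* Exposes 1 ⋆ (2 ⋆ 3) ⋆ 4 at the left end and 3 ⋆ (4 ⋆ 5) at the right end, so that caps and cups
   can reduce both. *)
have -> : W = 1 * X[i1 ⋆ (i2 ⋆ i3) ⋆ i4, i5, i6] * (x[i1 ⋆ (i2 ⋆ i3), i4, i5] *
    (X[i1, i2, i3] * (x[i1 ⋆ i2, i3, i4 ⋆ i5] * x[i1 ⋆ i2, i3 ⋆ (i4 ⋆ i5), i6]))).
  rewrite /W; word.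
  wr <- (slide3 X[i1, i2, i3] Phi^-1 (i1 ⋆ i2 ⋆ i3) i4 i5).
  wr <- (slide3 X[i1, i2, i3] Phi (i1 ⋆ i2 ⋆ i3 ⋆ i4) i5 i6).
  have e : x[i1 ⋆ i2 ⋆ i3, i4, i5] * x[i1 ⋆ i2, i3, i4 ⋆ i5] =
      x[i1 ⋆ i2, i3, i4] * x[i1 ⋆ i2, i3 ⋆ i4, i5] * x[i3, i4, i5].
    lcancel (assocVK Q (i1 ⋆ i2 ⋆ i3) i4 i5); lcancel (assocVK Q (i1 ⋆ i2) i3 (i4 ⋆ i5)).
    word; wr (assocK Q (i1 ⋆ i2 ⋆ i3) i4 i5); wr (assocK Q (i1 ⋆ i2) i3 (i4 ⋆ i5)).
    wr <- (pentagon Q (i1 ⋆ i2) i3 i4 i5).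
    wr (assocK Q (i1 ⋆ i2) i3 i4). wr (assocK Q (i1 ⋆ i2) (i3 ⋆ i4) i5).
    by wr (assocK Q i3 i4 i5).
  wr e; wr (slide3 x[i3, i4, i5] Phi^-1 (i1 ⋆ i2) (i3 ⋆ (i4 ⋆ i5)) i6).
  wr <- (slide3 x[i1 ⋆ i2, i3, i4] Phi (i1 ⋆ i2 ⋆ (i3 ⋆ i4)) i5 i6).
  congr (_ * (_ * _)); rewrite !mulrA; congr (_ * _ * _).
  lcancel (assocVK Q (i1 ⋆ i2) (i3 ⋆ i4) (i5 ⋆ i6)).
  word; wr (assocK Q (i1 ⋆ i2) (i3 ⋆ i4) (i5 ⋆ i6)).
  wr <- (pentagon Q (i1 ⋆ i2) (i3 ⋆ i4) i5 i6).
  wr (assocK Q (i1 ⋆ i2) (i3 ⋆ i4) i5).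
  by wr (assocK Q (i1 ⋆ i2) (i3 ⋆ i4 ⋆ i5) i6).
rewrite (lsub3_1 lk l14) assoc_triv1 !mul1r.
rewrite -[X in k (X * _)]mul1r (lsub3_1 lk l1).
rewrite -[X in k X]mulr1 !mulrA (rsub3_2 lk r3) mulr1.
rewrite (rsub3_3 lk c45) assocV_triv3 mulr1.
have -> : 1 * x[i1, i4, i5] * X[i1, i2, i3] * x[i1 ⋆ i2, i3, i6] =
    x[i1, i4, i5] * x[i1, i2 ⋆ i3, i6] * (x[i2, i3, i6] * X[i1, i2, i3 ⋆ i6] * 1).
  word; congr (_ * _).
  lcancel (assocVK Q i1 (i2 ⋆ i3) i6); lcancel (assocVK Q i2 i3 i6); word.
  wr (pentagon Q i1 i2 i3 i6). wr (assocK Q (i1 ⋆ i2) i3 i6).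
  wr (assocK Q i1 (i2 ⋆ i3) i6). by wr (assocK Q i2 i3 i6).
rewrite (lsub3_2 lk c23) assocV_triv2 !mulr1 !mulrA -[X in k X]mulr1 (rsub3_3 lk c36).
rewrite assoc_triv3 !mulr1.
rewrite -[X in k X]mulr1 -[X in k (X * _ * _)]mul1r -!mulrA (expand3r lk) tensor1E.
rewrite -(zigzagV Q (fun z => 1 ⊗ z)); last by lin.
apply: eq_tsum => xy x3; apply: eq_tsum => x1 x2; rewrite (expand3r lk).
rewrite -(zigzagV Q (fun z => z ⊗ (S x1 * alpha * x2 * beta * S x3))); last by lin.
by apply: eq_tsum => yy y3; apply: eq_tsum => y1 y2; legs kM M.
Qed.
End DrinfeldTwist.
#[global] Arguments ev4_expand {K H B a b c d U k} t u z lk.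
#[global] Arguments ev4_gamma {K H} Q {B} a b c d {_ _ _ _ _ _ _ _ _ _}.
#[global] Arguments ev4_delta {K H} Q {B} a b c d {_ _ _ _ _ _ _ _ _ _}.

(** * Words in anti-homomorphisms, for the images under S *)

Section AntiHoms.
Variables (K : fieldType) (H : falgType K) (Q : quasiBialgebra H) (B : falgType K).
Local Notation Phi := (Phi Q).
Local Notation Delta := (Delta Q).
Implicit Types (a b c : H -> B).

Definition antihom a := [/\ linear a, a 1 = 1 & forall x y, a (x * y) = a y * a x].
Existing Class antihom.

Lemma ev2M_anti s t a b {ha : antihom a} {hb : antihom b} {ab : commuting a b} :
  ev2 (s * t) a b = ev2 t a b * ev2 s a b.
Proof.
have [[la _ aM] [lb _ bM]] := conj ha hb.
rewrite /ev2 tsum_mul; last by split=> ?; [apply: lin_mulr | apply: lin_mull].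
rewrite exchange_tsum (linear_tsum (g := fun y => y * _)); last by lin.
apply: eq_tsum => p q; rewrite (linear_tsum (g := fun y => _ * y)); last by lin.
by apply: eq_tsum => p' q'; rewrite aM bM -!mulrA (mulrA (b q)) -(ab p') !mulrA.
Qed.

Lemma ev3M_anti s t a b c {ha : antihom a} {hb : antihom b} {hc : antihom c}
  {ab : commuting a b} {ac : commuting a c} {bc : commuting b c} :
  ev3 (s * t) a b c = ev3 t a b c * ev3 s a b c.
Proof.
have [lc _ cM] := hc; rewrite !ev3_split tsum_mul; last by split=> ? /=; lin.
rewrite exchange_tsum (linear_tsum (g := fun y => y * _)); last by lin.
apply: eq_tsum => p q; rewrite (linear_tsum (g := fun y => _ * y)); last by lin.
apply: eq_tsum => p' q'; rewrite ev2M_anti cM -!mulrA (mulrA (c q)).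
by rewrite -(intertwines_ev2 _ ac bc) -!mulrA.
Qed.

Lemma ev3_1_anti a b c {ha : antihom a} {hb : antihom b} {hc : antihom c} : ev3 1 a b c = 1.
Proof.
have [[la a1 _] [lb b1 _] [lc c1 _]] := And3 ha hb hc.
by rewrite tensor1E ev3_pure // tensor1E ev2_pure // a1 b1 c1 !mulr1.
Qed.

Lemma assocK_anti a b c {ha : antihom a} {hb : antihom b} {hc : antihom c}
  {ab : commuting a b} {ac : commuting a c} {bc : commuting b c} :
  ev3 Phi a b c * ev3 Phi^-1 a b c = 1.
Proof. by rewrite -ev3M_anti mulVr ?ev3_1_anti //; exact: Phi_unit. Qed.

Lemma assocVK_anti a b c {ha : antihom a} {hb : antihom b} {hc : antihom c}
  {ab : commuting a b} {ac : commuting a c} {bc : commuting b c} :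
  ev3 Phi^-1 a b c * ev3 Phi a b c = 1.
Proof. by rewrite -ev3M_anti divrr ?ev3_1_anti //; exact: Phi_unit. Qed.

#[global] Instance star_antihom a b {ha : antihom a} {hb : antihom b} {ab : commuting a b} :
  antihom (star Q a b).
Proof.
have [[la a1 _] [lb b1 _]] := conj ha hb.
split=> [||x y]; rewrite /star.
- by apply: lin_tsuml; apply: lin_lrmorph; exact: lin_id.
- by rewrite rmorph1 tensor1E ev2_pure // a1 b1 mulr1.
- by rewrite rmorphM ev2M_anti.
Qed.

(** Products are reversed, so Φ intertwines in the direction opposite to [star_assoc]. *)
Lemma star_assoc_anti a b c {ha : antihom a} {hb : antihom b} {hc : antihom c}
  {ab : commuting a b} {ac : commuting a c} {bc : commuting b c} :
  intertwines (ev3 Phi a b c) (star Q a (star Q b c)) (star Q (star Q a b) c).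
Proof.
have [[la _ _] [lb _ _] [lc _ _]] := And3 ha hb hc; move=> h.
have Er : star Q a (star Q b c) h = ev3 (\tsum_(h1 ⊗ h2 <- Delta h)
    \tsum_(h21 ⊗ h22 <- Delta h2) h1 ⊗ h21 ⊗ h22) a b c.
  rewrite (linear_tsum (g := fun t => ev3 t a b c)) //; last exact: ev3_linear.
  apply: eq_tsum => p q; rewrite (linear_tsum (g := fun t => ev3 t a b c)) //; last exact: ev3_linear.
  rewrite /star /ev2 (linear_tsum (g := fun y => _ * y)); last by lin.
  by apply: eq_tsum => r s; rewrite ev3_pure // ev2_pure // mulrA.
have El : star Q (star Q a b) c h = ev3 (\tsum_(h1 ⊗ h2 <- Delta h) Delta h1 ⊗ h2) a b c.
  rewrite (linear_tsum (g := fun t => ev3 t a b c)) //; last exact: ev3_linear.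
  by apply: eq_tsum => p q; rewrite ev3_pure.
by rewrite Er quasi_coassoc !ev3M_anti -El !mulrA assocK_anti mul1r.
Qed.

Lemma braid_star_anti R {hR : quasiTriangular Q R} a b {ha : antihom a} {hb : antihom b}
  {ab : commuting a b} : intertwines (ev2 R a b) (star Q b a) (star Q a b).
Proof.
have [[la _ _] [lb _ _]] := conj ha hb.
move=> h; have -> : star Q b a h = ev2 (tflip (Delta h)) a b.
  rewrite (linear_tsum _ _ (ev2_linear a b)); apply: eq_tsum => x y.
  by rewrite ev2_pure // ab.
by rewrite -ev2M_anti (Delta_op_R hR) ev2M_anti.
Qed.
End AntiHoms.
#[global] Existing Instance star_assoc_anti.
#[global] Existing Instance braid_star_anti.
Arguments assocK_anti {K H} Q {B} a b c {_ _ _ _ _ _}.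
Arguments assocVK_anti {K H} Q {B} a b c {_ _ _ _ _ _}.

(** * Basic laws of the twist *)

Section TwistProperties.
Variables (K : fieldType) (H : falgType K) (Q : quasiHopf H).
Local Notation Phi := (Phi Q).
Local Notation alpha := (alpha Q).
Local Notation beta := (beta Q).
Local Notation S := (antipode Q).
Local Notation Delta := (Delta Q).
Local Notation "a ⋆ b" := (star Q a b).

Local Notation SS := (tensor_antipode Q).
Local Notation gamma := (drinfeld_gamma Q).
Local Notation delta := (drinfeld_delta Q).
Local Notation f := (drinfeld_twist Q).

Lemma drinfeld_twistE : f = antipode_twist Q (fun h => Delta h) SS gamma.
Proof. by []. Qed.

(** Only one of the two products with the candidate inverse is computed; finite dimension gives the
    other. *)
Lemma drinfeld_twist_unit :
  f \is a GRing.unit /\ f^-1 = antipode_twist_inv Q (fun h => Delta h) SS delta.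
Proof.
have [hD lS] := conj (Delta_alghom Q) (@tensor_antipode_linear _ _ Q).
pose proof (antipode_twistK lS (@tensor_antipodeM _ _ Q) (tensor_antipode1 Q)
  (@cup_delta _ _ Q) (zigzag_gamma_delta Q)) as fK.
rewrite -drinfeld_twistE in fK; have [U <-] := falg_left_inverse fK.
by rewrite unitrV invrK.
Qed.

Lemma drinfeld_twist_conj h : f * Delta (S h) = SS h * f.
Proof.
have hD := Delta_alghom Q.
apply: (antipode_twist_conj (@tensor_antipode_linear _ _ Q) (@tensor_antipodeM _ _ Q)).
exact: cap_gamma.
Qed.

Lemma drinfeld_twist_alpha : f * Delta alpha = gamma.
Proof.
have hD := Delta_alghom Q.
apply: (antipode_twist_alpha (@tensor_antipode_linear _ _ Q) (@tensor_antipodeM _ _ Q)).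
  exact: tensor_antipode1.
exact: cap_gamma.
Qed.

Lemma beta_drinfeld_twistV : Delta beta * f^-1 = delta.
Proof.
have hD := Delta_alghom Q; rewrite (drinfeld_twist_unit).2.
apply: (beta_antipode_twist_inv (@tensor_antipode_linear _ _ Q) (@tensor_antipodeM _ _ Q)).
  exact: tensor_antipode1.
exact: cup_delta.
Qed.

Section Images.
Variable B : falgType K.
Implicit Types (a b c : H -> B).

Definition antip a : H -> B := fun h => a (S h).

#[global] Instance antip_antihom a {ha : alghom a} : antihom (antip a).
Proof.
have [la a1 aM] := ha; split=> [||x y]; rewrite /antip.
- by apply: lin_comp => //; lin.
- by rewrite antipode1.
- by rewrite antipodeM aM.
Qed.

#[global] Instance commuting_antipl a b {ab : commuting a b} : commuting (antip a) b.
Proof. by move=> x y; apply: ab. Qed.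

#[global] Instance commuting_antipr a b {ab : commuting a b} : commuting a (antip b).
Proof. by move=> x y; apply: ab. Qed.

Local Notation "F[ a , b ]" := (ev2 f a b).

Lemma ev2_tensor_antipode a b h {ha : alghom a} {hb : alghom b} {ab : commuting a b} :
  ev2 (SS h) a b = star Q (antip b) (antip a) h.
Proof.
have [[la _ _] [lb _ _]] := conj ha hb.
rewrite tensor_antipodeE (linear_tsum _ _ (ev2_linear a b)); apply: eq_tsum => x y.
by rewrite ev2_pure // /antip ab.
Qed.

Lemma twist_star a b {ha : alghom a} {hb : alghom b} {ab : commuting a b} :
  intertwines F[a, b] (antip (a ⋆ b)) (antip b ⋆ antip a).
Proof. by move=> h; rewrite -ev2_tensor_antipode -[RHS]ev2M // -drinfeld_twist_conj ev2M. Qed.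

Lemma twist_gamma a b {ha : alghom a} {hb : alghom b} {ab : commuting a b} :
  F[a, b] * (a ⋆ b) alpha = ev2 gamma a b.
Proof. by rewrite -ev2M // drinfeld_twist_alpha. Qed.

(* W = W rho(S(x^1) α x^2 β S(x^3)) = T(x^1) (W rho(α)) rho(x^2 β S(x^3)). *)
Lemma intertwiner_ext (rho T : H -> B) {hr : alghom rho} U V :
  intertwines U (antip rho) T -> intertwines V (antip rho) T ->
  U * rho alpha = V * rho alpha -> U = V.
Proof.
have [lr r1 rM] := hr.
have e W : intertwines W (antip rho) T -> W =
    \tsum_(x ⊗ y ⊗ z <- Phi^-1) (T x * (W * rho alpha) * rho (y * beta * S z)).
  move=> iW; rewrite -[LHS]mulr1 -r1 -(zigzagV Q (fun z => W * rho z)); last first.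
    by apply: lin_comp; [lin|].
  apply: eq_tsum => xy z; apply: eq_tsum => x y.
  have -> : S x * alpha * y * beta * S z = S x * (alpha * (y * beta * S z)).
    by rewrite !mulrA.
  by rewrite (rM (S x)) mulrA -[rho (S x)]/(antip rho x) iW (rM alpha) !mulrA.
by move=> /e eU /e eV UV; rewrite eU eV UV.
Qed.
End Images.
End TwistProperties.
#[global] Existing Instance twist_star.

(** * The twist, the associator and the braiding *)

Section TwistAssociator.
Variables (K : fieldType) (H : falgType K) (Q : quasiHopf H).
Local Notation Phi := (Phi Q).
Local Notation alpha := (alpha Q).
Local Notation S := (antipode Q).
Local Notation Delta := (Delta Q).
Local Notation "a ⋆ b" := (star Q a b).
Local Notation "X[ a , b , c ]" := (ev3 Phi a b c).
Local Notation "x[ a , b , c ]" := (ev3 Phi^-1 a b c).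

Local Notation gamma := (drinfeld_gamma Q).
Local Notation f := (drinfeld_twist Q).
Variable B : falgType K.
Local Notation "F[ a , b ]" := (ev2 f a b).

Lemma gamma_expand (a b : H -> B) u v {ha : alghom a} {hb : alghom b} :
  u * ev2 gamma a b * v =
  \tsum_(A1 ⊗ A2 ⊗ A3 ⊗ A4 <-
      (Phi ⊗ 1) * \tsum_(x1 ⊗ x2 ⊗ x3 <- Phi^-1) (Delta x1 ⊗ x2 ⊗ x3))
    (u * (a (S A2 * alpha * A3) * b (S A1 * alpha * A4)) * v).
Proof.
have [[la _ _] [lb _ _]] := conj ha hb.
have l : linear (fun t => u * ev2 t a b * v) by do 2![apply: lin_mulr || apply: lin_mull]; exact: ev2_linear.
rewrite (linear_tsum _ _ l); apply: eq_tsum => A123 A4.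
rewrite (linear_tsum _ _ l); apply: eq_tsum => A12 A3.
rewrite (linear_tsum _ _ l); apply: eq_tsum => A1 A2.
by rewrite ev2_pure.
Qed.

Context (a b c : H -> B) {ha : alghom a} {hb : alghom b} {hc : alghom c}.
Context {ab : commuting a b} {ac : commuting a c} {bc : commuting b c}.

(** Both sides are three nested caps, on legs 3, 4 inside 2, 5 inside 1, 6. On the left the two
    outer caps are grouped into one γ, on the right the two inner ones; deleting the innermost cap
    reduces the comparison to the pentagon. *)
Lemma twist_associator_gamma :
  F[b, c] * ev2 gamma a (b ⋆ c) * X[a, b, c] =
  ev3 Phi (antip Q c) (antip Q b) (antip Q a) * F[a, b] * ev2 gamma (a ⋆ b) c.
Proof.
have [[la a1 aM] [lb b1 bM] [lc c1 cM]] := And3 ha hb hc.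
pose M (l1 l2 l3 l4 l5 l6 : H) : B :=
  a (S l3 * alpha * l4) * b (S l2 * alpha * l5) * c (S l1 * alpha * l6).
have lM : multilinear6 M.
  by do ![split] => *; rewrite /M;
     do ?[lin1 | apply: (lin_comp la) | apply: (lin_comp lb) | apply: (lin_comp lc)].
have [k lk kM] := six_rec (sixfold_tensor H) lM.
have c34 : lsub k (i3 ⋆ i4) (@triv _ _ Q _).
  apply: lsub_six => // p l1 l2 l3 l4 l5 l6.
  rewrite kM -(cap_alpha Q (fun z =>
    a (S l3 * z * l4) * b (S l2 * alpha * l5) * c (S l1 * alpha * l6))).
    by apply: eq_tsum => x y; legs kM M.
  by do ?[lin1 | apply: (lin_comp la)].
have c25 : lsub k (i2 ⋆ i5) (@triv _ _ Q _).
  apply: lsub_six => // p l1 l2 l3 l4 l5 l6.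
  rewrite kM -(cap_alpha Q (fun z =>
    a (S l3 * alpha * l4) * b (S l2 * z * l5) * c (S l1 * alpha * l6))).
    by apply: eq_tsum => x y; legs kM M.
  by do ?[lin1 | apply: (lin_comp lb)].
have c16 : lsub k (i1 ⋆ i6) (@triv _ _ Q _).
  apply: lsub_six => // p l1 l2 l3 l4 l5 l6.
  rewrite kM -(cap_alpha Q (fun z =>
    a (S l3 * alpha * l4) * b (S l2 * alpha * l5) * c (S l1 * z * l6))).
    by apply: eq_tsum => x y; legs kM M.
  by do ?[lin1 | apply: (lin_comp lc)].
have lkl u : linear (fun z => k (z * u)) by apply: (lin_comp lk); lin.
have k1 z h : k (z * i1 h) = antip Q c h * k z.
  move: z; apply: six_ind => //; first by lin.
  move=> l1 l2 l3 l4 l5 l6; legs kM M; rewrite ?kM /M !cM /antip -!mulrA.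
  by rewrite [in RHS](mulrA (c (S h))) -ac -!mulrA [in RHS](mulrA (c (S h))) -bc -!mulrA.
have k2 z h : k (z * i2 h) = antip Q b h * k z.
  move: z; apply: six_ind => //; first by lin.
  move=> l1 l2 l3 l4 l5 l6; legs kM M; rewrite ?kM /M !bM /antip -!mulrA.
  by rewrite [in RHS](mulrA (b (S h))) -ab -!mulrA.
have k3 z h : k (z * i3 h) = antip Q a h * k z.
  move: z; apply: six_ind => //; first by lin.
  by move=> l1 l2 l3 l4 l5 l6; legs kM M; rewrite ?kM /M !aM !mulrA /antip.
have k4 z h : k (z * i4 h) = k z * a h.
  move: z; apply: six_ind => //; first by lin.
  by move=> l1 l2 l3 l4 l5 l6; legs kM M; rewrite ?kM /M !aM -!mulrA -ac [in RHS](mulrA (b _)) -ab -!mulrA.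
have k5 z h : k (z * i5 h) = k z * b h.
  move: z; apply: six_ind => //; first by lin.
  by move=> l1 l2 l3 l4 l5 l6; legs kM M; rewrite ?kM /M !bM -!mulrA -bc.
have k6 z h : k (z * i6 h) = k z * c h.
  move: z; apply: six_ind => //; first by lin.
  by move=> l1 l2 l3 l4 l5 l6; legs kM M; rewrite ?kM /M !cM !mulrA.
have kT z x y w : k (z * (i1 x * i2 y * i3 w)) = antip Q c x * antip Q b y * antip Q a w * k z.
  rewrite !mulrA k3 k2 k1 !mulrA; congr (_ * k z).
  by rewrite /antip -mulrA bc mulrA ac -mulrA ab mulrA.
have k12 z h : k (z * (i1 ⋆ i2) h) = (antip Q c ⋆ antip Q b) h * k z.
  rewrite /star -[X in k X]mulr1 (expand2 lk) /ev2.
  rewrite (linear_tsum (g := fun y => y * k z)); last by lin.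
  by apply: eq_tsum => x y; rewrite mulr1 mulrA k2 k1 mulrA /antip bc.
have k23 z h : k (z * (i2 ⋆ i3) h) = (antip Q b ⋆ antip Q a) h * k z.
  rewrite /star -[X in k X]mulr1 (expand2 lk) /ev2.
  rewrite (linear_tsum (g := fun y => y * k z)); last by lin.
  by apply: eq_tsum => x y; rewrite mulr1 mulrA k3 k2 mulrA /antip ab.
have k45 z h : k (z * (i4 ⋆ i5) h) = k z * (a ⋆ b) h.
  rewrite /star -[X in k X]mulr1 (expand2 lk) /ev2.
  rewrite (linear_tsum (g := fun y => k z * y)); last by lin.
  by apply: eq_tsum => x y; rewrite mulr1 mulrA k5 k4 mulrA.
have k56 z h : k (z * (i5 ⋆ i6) h) = k z * (b ⋆ c) h.
  rewrite /star -[X in k X]mulr1 (expand2 lk) /ev2.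
  rewrite (linear_tsum (g := fun y => k z * y)); last by lin.
  by apply: eq_tsum => x y; rewrite mulr1 mulrA k6 k5 mulrA.
have kX z : k (z * X[i4, i5, i6]) = k z * X[a, b, c].
  rewrite -[X in k X]mulr1 (expand3 lk) [in RHS]/ev3.
  rewrite (linear_tsum (g := fun y => k z * y)); last by lin.
  apply: eq_tsum => xy w; rewrite (linear_tsum (g := fun y => k z * y)); last by lin.
  by apply: eq_tsum => x y; rewrite mulr1 !mulrA k6 k5 k4.
have kS z : k (z * X[i1, i2, i3]) = ev3 Phi (antip Q c) (antip Q b) (antip Q a) * k z.
  rewrite -[X in k X]mulr1 (expand3 lk) [in RHS]/ev3.
  rewrite (linear_tsum (g := fun y => y * k z)); last by lin.
  apply: eq_tsum => xy w; rewrite (linear_tsum (g := fun y => y * k z)); last by lin.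
  by apply: eq_tsum => x y; rewrite mulr1 kT.
have k2g : k (X[i1, i2, i5] * x[i1 ⋆ i2, i5, i6]) = a alpha * ev2 gamma b c.
  rewrite -[RHS]mulr1 gamma_expand -(ev4_gamma Q i1 i2 i5 i6).
  rewrite -[X in k X]mulr1 -[X in k (X * _)]mul1r (ev4_expand _ _ _ lk).
  apply: eq_tsum => B123 B4; apply: eq_tsum => B12 B3; apply: eq_tsum => B1 B2.
  by legs kM M.
have k2g' : k (X[i2, i3, i4] * x[i2 ⋆ i3, i4, i5]) = ev2 gamma a b * c alpha.
  rewrite -[ev2 _ _ _]mul1r gamma_expand -(ev4_gamma Q i2 i3 i4 i5).
  rewrite -[X in k X]mulr1 -[X in k (X * _)]mul1r (ev4_expand _ _ _ lk).
  apply: eq_tsum => B123 B4; apply: eq_tsum => B12 B3; apply: eq_tsum => B1 B2.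
  by legs kM M.
have e1 : F[b, c] * ev2 gamma a (b ⋆ c) * X[a, b, c] =
    k (X[i1, i2, i5] * x[i1 ⋆ i2, i5, i6] *
       (X[i1 ⋆ i2, i3, i4] * x[i1 ⋆ i2 ⋆ i3, i4, i5 ⋆ i6]) * X[i4, i5, i6]).
  rewrite kX; congr (_ * _); rewrite -[LHS]mulr1 gamma_expand.
  rewrite -(ev4_gamma Q (i1 ⋆ i2) i3 i4 (i5 ⋆ i6)) -[X in k X]mulr1 (ev4_expand _ _ _ lk).
  apply: eq_tsum => A123 A4; apply: eq_tsum => A12 A3; apply: eq_tsum => A1 A2.
  rewrite !mulr1 !mulrA k56 k4 k3 k12 k2g.
  have [_ _ bcM] : alghom (b ⋆ c) by typeclasses eauto.
  set s := (antip Q c ⋆ antip Q b) A1; set p := b ⋆ c in bcM *.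
  have Fa h : F[b, c] * a h = a h * F[b, c].
    by move: h; change (intertwines F[b, c] a a); typeclasses eauto.
  have ga h : ev2 gamma b c * a h = a h * ev2 gamma b c.
    by move: h; change (intertwines (ev2 gamma b c) a a); typeclasses eauto.
  have sa h : s * a h = a h * s.
    by move: A1 @s h; change (commuting (antip Q c ⋆ antip Q b) a); typeclasses eauto.
  (* The twist carries S(A^1) out of the coproduct, and then turns the coproduct of α into γ on the
     legs [b] and [c]. *)
  have Fs : F[b, c] * p (S A1) = s * F[b, c] by apply: twist_star.
  have Fg : F[b, c] * p alpha = ev2 gamma b c by apply: twist_gamma.
  transitivity (a (S A2) * a alpha * a A3 * (s * ev2 gamma b c * p A4)).
    by rewrite Fa !aM !bcM -Fg -!mulrA (mulrA F[b, c]) Fs -!mulrA.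
  rewrite [in RHS](mulrA s) sa -!mulrA [in RHS](mulrA (ev2 gamma b c)) ga.
  by rewrite -!mulrA [in RHS](mulrA s) sa -!mulrA.
have e2 : ev3 Phi (antip Q c) (antip Q b) (antip Q a) * F[a, b] * ev2 gamma (a ⋆ b) c =
    k (X[i2, i3, i4] * x[i2 ⋆ i3, i4, i5] *
       (X[i1, i2 ⋆ i3, i4 ⋆ i5] * x[i1 ⋆ (i2 ⋆ i3), i4 ⋆ i5, i6]) * X[i1, i2, i3]).
  rewrite kS -mulrA; congr (_ * _); rewrite -[LHS]mulr1 gamma_expand.
  rewrite -(ev4_gamma Q i1 (i2 ⋆ i3) (i4 ⋆ i5) i6) -[X in k X]mulr1 (ev4_expand _ _ _ lk).
  apply: eq_tsum => A123 A4; apply: eq_tsum => A12 A3; apply: eq_tsum => A1 A2.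
  rewrite !mulr1 !mulrA k6 k45 k23 k1 k2g'.
  have [_ _ abM] : alghom (a ⋆ b) by typeclasses eauto.
  set s := (antip Q b ⋆ antip Q a) A2; set p := a ⋆ b in abM *.
  have pc x y : p x * c y = c y * p x by move: x y; change (commuting (a ⋆ b) c); typeclasses eauto.
  have gc h : ev2 gamma a b * c h = c h * ev2 gamma a b.
    by move: h; change (intertwines (ev2 gamma a b) c c); typeclasses eauto.
  have Fc h : F[a, b] * c h = c h * F[a, b].
    by move: h; change (intertwines F[a, b] c c); typeclasses eauto.
  have Fs : F[a, b] * p (S A2) = s * F[a, b] by apply: twist_star.
  have Fg : F[a, b] * p alpha = ev2 gamma a b by apply: twist_gamma.
  transitivity (s * ev2 gamma a b * p A3 * (c (S A1) * c alpha * c A4)).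
    by rewrite !cM !abM -Fg -!mulrA (mulrA F[a, b]) Fs -!mulrA.
  rewrite /antip -!mulrA [in LHS](mulrA (p A3)) pc -!mulrA.
  rewrite [in LHS](mulrA (ev2 gamma a b)) gc -!mulrA.
  by rewrite [in LHS](mulrA (p A3)) pc -!mulrA.
rewrite {}e1 {}e2.
(* [V] is the left word with letters on 3 ⋆ 4 put back by undoing deletions; as a word it equals the
   right one. *)
pose V : six_alg (sixfold_tensor H) :=
  1 * X[i1, i2 ⋆ (i3 ⋆ i4), i5] * (X[i1, i2, i3 ⋆ i4] * (x[i1 ⋆ i2 ⋆ (i3 ⋆ i4), i5, i6] *
    (X[i1 ⋆ i2, i3, i4] * (x[i1 ⋆ i2 ⋆ i3, i4, i5 ⋆ i6] * X[i4, i5, i6])))).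
transitivity (k V).
  symmetry; rewrite /V (lsub3_2_after lk (lsub_starr lk c34)) [X in k X = _]mulrA.
  rewrite (lsub3_3 lk c34) assoc_triv3 mulr1 [X in k X = _]mulrA.
  rewrite (lsub3_1_after lk (lsub_starr lk c34)).
  by congr (k _); word.
congr (k _); rewrite /V.
word; wr <- (slide3 X[i1 ⋆ i2, i3, i4] Phi^-1 (i1 ⋆ i2 ⋆ i3 ⋆ i4) i5 i6).
have e : x[i1 ⋆ i2 ⋆ i3 ⋆ i4, i5, i6] * x[i1 ⋆ i2 ⋆ i3, i4, i5 ⋆ i6] * X[i4, i5, i6] =
    x[i1 ⋆ i2 ⋆ i3, i4, i5] * x[i1 ⋆ i2 ⋆ i3, i4 ⋆ i5, i6].
  lcancel (assocVK Q (i1 ⋆ i2 ⋆ i3 ⋆ i4) i5 i6).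
  lcancel (assocVK Q (i1 ⋆ i2 ⋆ i3) i4 (i5 ⋆ i6)); word.
  wr (assocK Q (i1 ⋆ i2 ⋆ i3 ⋆ i4) i5 i6); wr (assocK Q (i1 ⋆ i2 ⋆ i3) i4 (i5 ⋆ i6)).
  wr <- (pentagon Q (i1 ⋆ i2 ⋆ i3) i4 i5 i6); wr (assocK Q (i1 ⋆ i2 ⋆ i3) i4 i5).
  by wr (assocK Q (i1 ⋆ i2 ⋆ i3) (i4 ⋆ i5) i6).
wr e; wr <- (pentagon Q i1 i2 i3 i4).
wr <- (slide3 X[i2, i3, i4] Phi i1 (i2 ⋆ i3 ⋆ i4) i5).
wr (slide3 X[i1, i2, i3] Phi^-1 (i1 ⋆ i2 ⋆ i3) i4 i5).
wr (slide3 X[i1, i2, i3] Phi^-1 (i1 ⋆ i2 ⋆ i3) (i4 ⋆ i5) i6).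
congr (_ * _); rewrite !mulrA; congr (_ * _ * _ * _).
lcancel (assocVK Q (i2 ⋆ i3) i4 i5); word.
wr (pentagon Q i1 (i2 ⋆ i3) i4 i5); wr (assocK Q (i1 ⋆ (i2 ⋆ i3)) i4 i5).
by wr (assocK Q (i2 ⋆ i3) i4 i5).
Qed.

(** By [intertwiner_ext] it suffices to compare after multiplication by the iterated coproduct of α,
    where [twist_gamma] turns the outer twist on each side into γ. *)
Lemma twist_associator : F[b, c] * F[a, b ⋆ c] * X[a, b, c] =
  ev3 Phi (antip Q c) (antip Q b) (antip Q a) * F[a, b] * F[a ⋆ b, c].
Proof.
apply: (intertwiner_ext (Q := Q) (rho := a ⋆ b ⋆ c)
  (T := (antip Q c ⋆ antip Q b) ⋆ antip Q a)).
- have e1 : intertwines X[a, b, c] (antip Q (a ⋆ b ⋆ c)) (antip Q (a ⋆ (b ⋆ c))).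
    by move=> h; exact (star_assoc Q a b c (S h)).
  have e2 : intertwines F[a, b ⋆ c] (antip Q (a ⋆ (b ⋆ c))) (antip Q (b ⋆ c) ⋆ antip Q a).
    typeclasses eauto.
  have e3 : intertwines F[b, c] (antip Q (b ⋆ c) ⋆ antip Q a)
      ((antip Q c ⋆ antip Q b) ⋆ antip Q a).
    typeclasses eauto.
  exact (intertwinesM e1 (intertwinesM e2 e3)).
- have e1 : intertwines F[a ⋆ b, c] (antip Q (a ⋆ b ⋆ c)) (antip Q c ⋆ antip Q (a ⋆ b)).
    typeclasses eauto.
  have e2 : intertwines F[a, b] (antip Q c ⋆ antip Q (a ⋆ b))
      (antip Q c ⋆ (antip Q b ⋆ antip Q a)).
    typeclasses eauto.
  have e3 : intertwines (ev3 Phi (antip Q c) (antip Q b) (antip Q a))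
      (antip Q c ⋆ (antip Q b ⋆ antip Q a)) ((antip Q c ⋆ antip Q b) ⋆ antip Q a).
    typeclasses eauto.
  exact (intertwinesM e1 (intertwinesM e2 e3)).
rewrite -!mulrA star_assoc (mulrA F[a, _]) twist_gamma twist_gamma !mulrA.
exact: twist_associator_gamma.
Qed.
End TwistAssociator.

Section TwistBraiding.
Variables (K : fieldType) (H : falgType K) (Q : quasiHopf H) (R : (H ⊗ H)%type).
Context {hR : quasiTriangular Q R}.
Local Notation Phi := (Phi Q).
Local Notation alpha := (alpha Q).
Local Notation S := (antipode Q).
Local Notation ε := (counit Q).
Local Notation "a ⋆ b" := (star Q a b).
Local Notation "X[ a , b , c ]" := (ev3 Phi a b c).
Local Notation "x[ a , b , c ]" := (ev3 Phi^-1 a b c).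
Local Notation "R[ a , b ]" := (ev2 R a b).

Local Notation gamma := (drinfeld_gamma Q).
Local Notation f := (drinfeld_twist Q).
Variable B : falgType K.
Local Notation "F[ a , b ]" := (ev2 f a b).
Context (a b : H -> B) {ha : alghom a} {hb : alghom b} {ab : commuting a b}.

(** The same two caps in both nestings: legs 2, 3 are innermost on the left, legs 1, 4 on the right.
    R on the S side and R on the other side are the two ways of exchanging them. *)
Lemma twist_braiding_gamma :
  ev2 R (antip Q a) (antip Q b) * ev2 gamma a b = ev2 gamma b a * R[a, b].
Proof.
have [[la a1 aM] [lb b1 bM]] := conj ha hb.
pose M (l1 l2 l3 l4 l5 l6 : H) : B :=
  ε l5 *: (ε l6 *: (a (S l2 * alpha * l3) * b (S l1 * alpha * l4))).
have lM : multilinear6 M.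
  by do ![split] => *; rewrite /M;
     do ?[lin1 | apply: lin_counit | apply: (lin_comp la) | apply: (lin_comp lb)].
have [k lk kM] := six_rec (sixfold_tensor H) lM.
have c23 : lsub k (i2 ⋆ i3) (@triv _ _ Q _).
  apply: lsub_six => // p l1 l2 l3 l4 l5 l6.
  rewrite kM -(cap_alpha Q (fun z => ε l5 *: (ε l6 *:
    (a (S l2 * z * l3) * b (S l1 * alpha * l4))))).
    by apply: eq_tsum => x y; legs kM M.
  by do ?[lin1 | apply: (lin_comp la)].
have c14 : lsub k (i1 ⋆ i4) (@triv _ _ Q _).
  apply: lsub_six => // p l1 l2 l3 l4 l5 l6.
  rewrite kM -(cap_alpha Q (fun z => ε l5 *: (ε l6 *:
    (a (S l2 * alpha * l3) * b (S l1 * z * l4))))).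
    by apply: eq_tsum => x y; legs kM M.
  by do ?[lin1 | apply: (lin_comp lb)].
have lkl u : linear (fun z => k (z * u)) by apply: (lin_comp lk); lin.
have k21 z h g : k (z * (i2 h * i1 g)) = a (S h) * b (S g) * k z.
  move: z; apply: six_ind => //; first by lin.
  move=> l1 l2 l3 l4 l5 l6; legs kM M; rewrite ?kM /M !aM !bM -!scalerAr -!mulrA.
  do 2!congr (_ *: _); congr (_ * _).
  by rewrite [in RHS](mulrA (b (S g))) -ab -!mulrA [in RHS](mulrA (b (S g))) -ab
     -!mulrA [in RHS](mulrA (b (S g))) -ab -!mulrA.
have k34 z h g : k (z * (i3 h * i4 g)) = k z * a h * b g.
  move: z; apply: six_ind => //; first by lin.
  move=> l1 l2 l3 l4 l5 l6; legs kM M; rewrite ?kM /M !aM !bM -!scalerAl -!mulrA.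
  do 2!congr (_ *: _); congr (_ * (_ * (_ * _))).
  by do 3![rewrite [in LHS](mulrA (a h)) ab -!mulrA; congr (_ * _)].
have e1 : ev2 R (antip Q a) (antip Q b) * ev2 gamma a b =
    k (X[i1, i2, i3] * x[i1 ⋆ i2, i3, i4] * R[i2, i1]).
  rewrite -[X in k X]mulr1 (expand2 lk) {1}/ev2.
  rewrite (linear_tsum (g := fun y => y * _)); last by lin.
  apply: eq_tsum => x y; rewrite mulr1 k21; congr (_ * _).
  rewrite -(ev4_gamma Q i1 i2 i3 i4) -[LHS]mul1r -[LHS]mulr1 gamma_expand.
  rewrite -[X in k X]mulr1 -[X in k (X * _)]mul1r (ev4_expand _ _ _ lk).
  apply: eq_tsum => B123 B4; apply: eq_tsum => B12 B3; apply: eq_tsum => B1 B2.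
  by legs kM M; rewrite counit1 !scale1r.
have e2 : ev2 gamma b a * R[a, b] =
    k (X[i2, i1, i4] * x[i2 ⋆ i1, i4, i3] * R[i3, i4]).
  rewrite -[X in k X]mulr1 (expand2 lk) {2}/ev2.
  rewrite (linear_tsum (g := fun y => _ * y)); last by lin.
  apply: eq_tsum => x y; rewrite mulr1 k34 -mulrA; congr (_ * _).
  rewrite -(ev4_gamma Q i2 i1 i4 i3) -[LHS]mul1r -[LHS]mulr1 gamma_expand.
  rewrite -[X in k X]mulr1 -[X in k (X * _)]mul1r (ev4_expand _ _ _ lk).
  apply: eq_tsum => B123 B4; apply: eq_tsum => B12 B3; apply: eq_tsum => B1 B2.
  by legs kM M; rewrite counit1 !scale1r ab.
rewrite e1 e2 {e1 e2}.
(* On each side letters are inserted that the innermost cap deletes, 2 ⋆ 3 here and 1 ⋆ 4 below. The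
   hexagons then identify the two words. *)
transitivity (k (1 * x[i1, i4, i2 ⋆ i3] * (R[i2 ⋆ i3, i4] * (X[i1, i2 ⋆ i3, i4] *
   (X[i1, i2, i3] * x[i1 ⋆ i2, i3, i4] * R[i2, i1]))))).
  rewrite (lsub3_3 lk c23) assocV_triv3 !mul1r -[X in _ = k X]mul1r mulrA.
  rewrite (lsub2_1 lk c23) braid_triv1 !mul1r -[X in _ = k X]mul1r mulrA.
  by rewrite (lsub3_2 lk c23) assoc_triv2 !mul1r.
transitivity (k (1 * X[i1 ⋆ i4, i2, i3] * (R[i2, i1 ⋆ i4] *
   (X[i2, i1, i4] * x[i2 ⋆ i1, i4, i3] * R[i3, i4])))); last first.
  rewrite (lsub3_1 lk c14) assoc_triv1 !mul1r -[X in k X]mul1r mulrA.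
  by rewrite (lsub2_2 lk c14) braid_triv2 !mul1r.
congr (k _); word.
wr (hexagon1 i2 i3 i4); wr (hexagon2 i2 i1 i4).
wr (pentagon Q i1 i2 i3 i4); wr (assocK Q (i1 ⋆ i2) i3 i4).
wr (slide3 R[i3, i4] Phi i1 i2 (i3 ⋆ i4)); wr (slide2 R[i3, i4] R i2 i1).
wr (assocVK Q i2 i1 i4); wr (slide3 R[i2, i1] Phi^-1 (i2 ⋆ i1) i4 i3).
have e1 : X[i1, i2, i4] * x[i1 ⋆ i2, i4, i3] =
    x[i1, i2 ⋆ i4, i3] * x[i2, i4, i3] * X[i1, i2, i4 ⋆ i3].
  lcancel (assocVK Q i1 (i2 ⋆ i4) i3); lcancel (assocVK Q i2 i4 i3); word.
  wr (pentagon Q i1 i2 i4 i3); wr (assocK Q (i1 ⋆ i2) i4 i3).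
  by wr (assocK Q i1 (i2 ⋆ i4) i3); wr (assocK Q i2 i4 i3).
have e2 : X[i1 ⋆ i4, i2, i3] * x[i1, i4, i2] * x[i1, i4 ⋆ i2, i3] =
    x[i1, i4, i2 ⋆ i3] * X[i4, i2, i3].
  lcancel (assocVK Q i1 i4 (i2 ⋆ i3)); word; wr (assocK Q i1 i4 (i2 ⋆ i3)).
  wr <- (pentagon Q i1 i4 i2 i3); wr (assocK Q i1 i4 i2).
  by wr (assocK Q i1 (i4 ⋆ i2) i3).
by wr e1; wr (slide3 R[i2, i4] Phi^-1 i1 (i2 ⋆ i4) i3); wr e2.
Qed.

Lemma twist_braiding : ev2 R (antip Q a) (antip Q b) * F[a, b] = F[b, a] * R[a, b].
Proof.
apply: (intertwiner_ext (Q := Q) (rho := a ⋆ b) (T := antip Q a ⋆ antip Q b)).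
- have e1 : intertwines F[a, b] (antip Q (a ⋆ b)) (antip Q b ⋆ antip Q a).
    typeclasses eauto.
  have e2 : intertwines (ev2 R (antip Q a) (antip Q b))
      (antip Q b ⋆ antip Q a) (antip Q a ⋆ antip Q b).
    typeclasses eauto.
  exact (intertwinesM e1 e2).
- have e1 : intertwines R[a, b] (antip Q (a ⋆ b)) (antip Q (b ⋆ a)).
    by move=> h; exact (braid_star a b (S h)).
  have e2 : intertwines F[b, a] (antip Q (b ⋆ a)) (antip Q a ⋆ antip Q b).
    typeclasses eauto.
  exact (intertwinesM e1 e2).
rewrite -mulrA twist_gamma twist_braiding_gamma -twist_gamma -!mulrA.
by rewrite (braid_star a b).
Qed.
End TwistBraiding.
#[global] Arguments twist_associator {K H} Q {B} a b c {_ _ _ _ _ _}.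
#[global] Arguments twist_braiding {K H} Q {R hR B} a b {_ _ _}.

(** * The Drinfeld element *)

Section Bijectivity.
Variables (K : fieldType) (H : falgType K) (Q : quasiHopf H) (R : (H ⊗ H)%type).
Context {hR : quasiTriangular Q R}.
Local Notation Phi := (Phi Q).
Local Notation alpha := (alpha Q).
Local Notation beta := (beta Q).
Local Notation S := (antipode Q).
Local Notation ε := (counit Q).
Local Notation "a ⋆ b" := (star Q a b).
Local Notation "X[ a , b , c ]" := (ev3 Phi a b c).
Local Notation "x[ a , b , c ]" := (ev3 Phi^-1 a b c).
Local Notation "R[ a , b ]" := (ev2 R a b).

Local Notation trivial := (@triv _ _ Q _).

(** Rigidity inverts the braiding: the candidate is R with its first leg turned around by β, S and
    α. The hexagon merges the two copies of R into one on the leg 2 ⋆ 3, which the cap deletes, and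
    a zigzag remains. *)
Lemma braid_unit : R \is a GRing.unit.
Proof.
pose M (l1 l2 l3 l4 l5 l6 : H) : (H ⊗ H)%type :=
  ε l5 *: (ε l6 *: ((l1 * beta * S l2 * alpha * l3) ⊗ l4)).
have lM : multilinear6 M by do ![split] => *; rewrite /M; linc.
have [k lk kM] := six_rec (sixfold_tensor H) lM.
have c23 : lsub k (i2 ⋆ i3) trivial.
  apply: lsub_six => // p l1 l2 l3 l4 l5 l6.
  rewrite kM -(cap_alpha Q (fun z => ε l5 *: (ε l6 *:
    ((l1 * beta * S l2 * z * l3) ⊗ l4)))); last by linc.
  by apply: eq_tsum => x y; legs kM M.
have c12 : rsub k (i1 ⋆ i2) trivial.
  apply: rsub_six => // p l1 l2 l3 l4 l5 l6.
  rewrite kM -(cup_beta Q (fun z => ε l5 *: (ε l6 *: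
    ((l1 * z * S l2 * alpha * l3) ⊗ l4)))); last by linc.
  by apply: eq_tsum => x y; legs kM M.
have kR (z : six_alg (sixfold_tensor H)) (t : (H ⊗ H)%type) : k (z * ev2 t i3 i4) = k z * t.
  move: z; apply: six_ind => [||l1 l2 l3 l4 l5 l6].
  - by apply: (lin_comp lk); lin.
  - by move=> l x y; rewrite lk mulrDl -scalerAl.
  rewrite -[X in k X = _]mulr1 (expand2 lk) kM [t in RHS]tensorE.
  rewrite (linear_tsum (g := fun y => _ * y)); last by lin.
  by apply: eq_tsum => x y; legs kM M; rewrite /M -!scalerAl pure_tensorM.
pose W : six_alg (sixfold_tensor H) :=
  X[i4, i2, i3] * R[i2, i4] * x[i2, i4, i3] * X[i1, i2, i4 ⋆ i3].
suff kW : k W * R = 1.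
  have [] := falg_left_inverse kW; by [].
rewrite -kR.
have -> : W * R[i3, i4] =
    1 * R[i2 ⋆ i3, i4] * (X[i1, i2 ⋆ i3, i4] * (X[i1, i2, i3] * x[i1 ⋆ i2, i3, i4])).
  rewrite /W; word; wr <- (slide3 R[i3, i4] Phi i1 i2 (i3 ⋆ i4)).
  wr (hexagon1 i2 i3 i4); wr (pentagon Q i1 i2 i3 i4).
  by wr (assocK Q (i1 ⋆ i2) i3 i4).
rewrite (lsub2_1 lk c23) braid_triv1 mul1r [X in k X]mulrA.
rewrite (lsub3_2 lk c23) assoc_triv2 !mul1r -[X in k X]mulr1.
rewrite (rsub3_1 lk c12) assocV_triv1 !mulr1 -[X in k X]mul1r -[X in k X]mulr1 (expand3 lk).
rewrite tensor1E -(zigzag Q (fun z => z ⊗ 1)); last by lin.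
apply: eq_tsum => xy w; apply: eq_tsum => x y.
by legs kM M; rewrite counit1 !scale1r.
Qed.

(** For trivial Φ, α and β these two elements are Drinfeld's S(R^2) R^1 and R^2 S^2(R^1). *)
Definition drinfeld_elt : H :=
  \tsum_(R1 ⊗ R2 <- R) \tsum_(x1 ⊗ x2 ⊗ x3 <- Phi^-1)
    S (R2 * x2 * beta * S x3) * alpha * R1 * x1.
Definition drinfeld_elt_inv : H :=
  \tsum_(X1 ⊗ X2 ⊗ X3 <- Phi) \tsum_(R1 ⊗ R2 <- R) \tsum_(x1 ⊗ x2 ⊗ x3 <- Phi^-1)
    X1 * R2 * x2 * beta * S (S (X2 * R1 * x1) * alpha * X3 * x3).
Local Notation u := drinfeld_elt.
Local Notation v := drinfeld_elt_inv.

(** The carrying argument of [antipode_twist_conj]; passing R exchanges legs 1 and 2, which is why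
    the cap sits on 2 ⋆ 1. *)
Lemma drinfeld_elt_conj h : S (S h) * u = u * h.
Proof.
pose M (l1 l2 l3 l4 l5 l6 : H) : H :=
  ε l4 *: (ε l5 *: (ε l6 *: (S (l2 * beta * S l3) * alpha * l1))).
have lM : multilinear6 M by do ![split] => *; rewrite /M; linc.
have [k lk kM] := six_rec (sixfold_tensor H) lM.
have c21 : lsub k (i2 ⋆ i1) trivial.
  apply: lsub_six => // p l1 l2 l3 l4 l5 l6.
  rewrite kM -(cap_alpha Q (fun z => ε l4 *: (ε l5 *: (ε l6 *:
    (S (l2 * beta * S l3) * z * l1))))); last by linc.
  by apply: eq_tsum => x y; legs kM M.
have c23 : rsub k (i2 ⋆ i3) trivial.
  apply: rsub_six => // p l1 l2 l3 l4 l5 l6.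
  rewrite kM -(cup_beta Q (fun z => ε l4 *: (ε l5 *: (ε l6 *:
    (S (l2 * z * S l3) * alpha * l1))))); last by linc.
  by apply: eq_tsum => x y; legs kM M.
have kW : k (R[i1, i2] * x[i1, i2, i3]) = u.
  rewrite -[X in k X]mulr1 -[X in k X]mul1r -!mulrA (expand2r lk).
  apply: eq_tsum => x y; rewrite (expand3r lk).
  apply: eq_tsum => ab c; apply: eq_tsum => a b; legs kM M.
  by rewrite counit1 !scale1r.
have lkr z : linear (fun y => k (y * z)) by apply: (lin_comp lk); lin.
have lkl z : linear (fun y => k (z * y)) by apply: (lin_comp lk); lin.
have k1 z : k (z * i1 h) = k z * h.
  move: z; apply: six_ind => //; first by lin.
  by move=> l1 l2 l3 l4 l5 l6; legs kM M; rewrite ?kM /M -!scalerAl ?antipodeM ?mulrA.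
have k3 z : k (i3 h * z) = S (S h) * k z.
  move: z; apply: six_ind => //; first by lin.
  by move=> l1 l2 l3 l4 l5 l6; legs kM M; rewrite ?kM /M -!scalerAr ?antipodeM ?mulrA.
have l213 : lsub k (i2 ⋆ i1 ⋆ i3) i3.
  by rewrite -[X in lsub _ _ X](@star_trivl _ _ Q); apply: lsub_star.
have r123 : rsub k (i1 ⋆ (i2 ⋆ i3)) i1.
  by rewrite -[X in rsub _ _ X](@star_trivr _ _ Q); apply: rsub_star.
rewrite -kW -k1 -k3 -l213 -r123; congr (k _); rewrite -mulrA star_assocV !mulrA.
by congr (_ * _); symmetry; apply intertwines_star; typeclasses eauto.
Qed.

Lemma drinfeld_elt_invK : v * u = 1.
Proof.
pose M (l1 l2 l3 l4 l5 l6 : H) : H :=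
  ε l6 *: (l2 * beta * S (l5 * beta * S l1 * alpha * l3) * alpha * l4).
have lM : multilinear6 M by do ![split] => *; rewrite /M; linc.
have [k lk kM] := six_rec (sixfold_tensor H) lM.
have c54 : lsub k (i5 ⋆ i4) trivial.
  apply: lsub_six => // p l1 l2 l3 l4 l5 l6.
  rewrite kM -(cap_alpha Q (fun z => ε l6 *:
    (l2 * beta * S (l5 * beta * S l1 * alpha * l3) * z * l4))); last by linc.
  by apply: eq_tsum => x y; legs kM M.
have c13 : lsub k (i1 ⋆ i3) trivial.
  apply: lsub_six => // p l1 l2 l3 l4 l5 l6.
  rewrite kM -(cap_alpha Q (fun z => ε l6 *:
    (l2 * beta * S (l5 * beta * S l1 * z * l3) * alpha * l4))); last by linc.
  by apply: eq_tsum => x y; legs kM M.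
have c51 : rsub k (i5 ⋆ i1) trivial.
  apply: rsub_six => // p l1 l2 l3 l4 l5 l6.
  rewrite kM -(cup_beta Q (fun z => ε l6 *:
    (l2 * beta * S (l5 * z * S l1 * alpha * l3) * alpha * l4))); last by linc.
  by apply: eq_tsum => x y; legs kM M.
pose M' (l1 l2 l3 l4 l5 l6 : H) : H :=
  ε l1 *: (ε l5 *: (ε l6 *: (l2 * beta * S l3 * alpha * l4))).
have lM' : multilinear6 M' by do ![split] => *; rewrite /M'; linc.
have [k' lk' kM'] := six_rec (sixfold_tensor H) lM'.
have c23 : rsub k' (i2 ⋆ i3) trivial.
  apply: rsub_six => // p l1 l2 l3 l4 l5 l6.
  rewrite kM' -(cup_beta Q (fun z =>
    ε l1 *: (ε l5 *: (ε l6 *: (l2 * z * S l3 * alpha * l4))))); last by linc.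
  by apply: eq_tsum => x y; legs kM' M'.
have -> : v * u = k (1 * X[i2, i1, i3] *
    (R[i1, i2] * (x[i1, i2, i3] * (R[i4, i5] * (x[i4, i5, i1] * 1))))).
  rewrite (expand3 lk) /v (linear_tsum (g := fun y => y * u)); last by lin.
  apply: eq_tsum => xy X3; rewrite (linear_tsum (g := fun y => y * u)); last by lin.
  apply: eq_tsum => X1 X2; rewrite (expand2r lk).
  rewrite (linear_tsum (g := fun y => y * u)); last by lin.
  apply: eq_tsum => R1 R2; rewrite (expand3r lk).
  rewrite (linear_tsum (g := fun y => y * u)); last by lin.
  apply: eq_tsum => yy x3; rewrite (linear_tsum (g := fun y => y * u)); last by lin.
  apply: eq_tsum => x1 x2; rewrite (expand2r lk).
  rewrite (linear_tsum (g := fun y => _ * y)); last by lin.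
  apply: eq_tsum => r1 r2; rewrite (expand3r lk).
  rewrite (linear_tsum (g := fun y => _ * y)); last by lin.
  apply: eq_tsum => zz y3; rewrite (linear_tsum (g := fun y => _ * y)); last by lin.
  apply: eq_tsum => y1 y2; legs kM M.
  by rewrite counit1 scale1r.
(* Undoing the cap on 5 ⋆ 4 enlarges leg 1 to 5 ⋆ 4 ⋆ 1. The inner R and associator carry this leg
   to 4 ⋆ (5 ⋆ 1), and the cup on 5 ⋆ 1 then leaves leg 4. *)
transitivity (k (1 * X[i2, i5 ⋆ i4 ⋆ i1, i3] * (R[i5 ⋆ i4 ⋆ i1, i2] *
    (x[i5 ⋆ i4 ⋆ i1, i2, i3] * (R[i4, i5] * (x[i4, i5, i1] * 1)))))).
  symmetry; rewrite (lsub3_2_after lk (lsub_starl lk c54)) [X in k X = _]mulrA.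
  rewrite (lsub2_1_after lk (lsub_starl lk c54)) [X in k X = _]mulrA.
  rewrite (lsub3_1_after lk (lsub_starl lk c54)).
  by congr (k _); word.
transitivity (k (R[i4, i5] * x[i4, i5, i1] * X[i2, i4 ⋆ (i5 ⋆ i1), i3] *
    R[i4 ⋆ (i5 ⋆ i1), i2] * x[i4 ⋆ (i5 ⋆ i1), i2, i3] * 1)).
  congr (k _); word.
  wr (slide3 x[i4, i5, i1] Phi i2 (i4 ⋆ (i5 ⋆ i1)) i3).
  wr (slide2 x[i4, i5, i1] R (i4 ⋆ (i5 ⋆ i1)) i2).
  wr (slide3 x[i4, i5, i1] Phi^-1 (i4 ⋆ (i5 ⋆ i1)) i2 i3).
  wr (slide3 R[i4, i5] Phi i2 (i4 ⋆ i5 ⋆ i1) i3).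
  wr (slide2 R[i4, i5] R (i4 ⋆ i5 ⋆ i1) i2).
  by wr (slide3 R[i4, i5] Phi^-1 (i4 ⋆ i5 ⋆ i1) i2 i3).
rewrite (rsub3_1_before lk (rsub_starr lk c51)) -!mulrA [X in k X]mulrA [X in k X]mulrA.
rewrite [X in k X]mulrA (rsub2_1_before lk (rsub_starr lk c51)).
rewrite -[X in k X]mulrA (rsub3_2_before lk (rsub_starr lk c51)).
pose Y : six_alg (sixfold_tensor H) := X[i2, i4, i3] * (R[i4, i2] * (x[i4, i2, i3] * 1)).
rewrite -[X in k X]mulrA -[X[_, _, _] * _]/Y.
transitivity (k (1 * X[i5 ⋆ i4, i1, i3] * (R[i4, i5] * (x[i4, i5, i1] * Y)))).
  by rewrite (lsub3_1 lk c54) assoc_triv1 !mul1r mulrA.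
transitivity (k (R[i4, i5] * x[i4, i5, i1 ⋆ i3] * (X[i5, i1, i3] * (X[i4, i5 ⋆ i1, i3] * Y)))).
  congr (k _); word; wr <- (slide3 R[i4, i5] Phi (i4 ⋆ i5) i1 i3); congr (_ * _).
  lcancel (assocVK Q i4 i5 (i1 ⋆ i3)); wr <- (pentagon Q i4 i5 i1 i3).
  by wr (assocK Q i4 i5 i1); wr (assocK Q i4 i5 (i1 ⋆ i3)).
rewrite (lsub3_3 lk c13) assocV_triv3 mulr1 [X in k X]mulrA [X in k X]mulrA (rsub3_2 lk c51).
rewrite assoc_triv2 mulr1.
(* Legs 5, 1, 3 now form a zigzag. Straightening it leaves a single leg, called 3, under the smaller
   form [k']. *)
have -> : k (R[i4, i5] * X[i5, i1, i3] * Y) = k' (1 * R[i4, i3] * Y).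
  rewrite -[R[i4, i5]]mul1r -[X in k X]mulrA -[X in k X]mulrA (expand2r lk) (expand2 lk').
  apply: eq_tsum => r1 r2.
  have -> : k' (1 * (i4 r1 * i3 r2) * Y) = k' (1 * (i4 r1 * i3 (r2 * 1)) * Y) by rewrite mulr1.
  have li3 : linear (fun z : H => i3 z) by have [] := @leg_alghom K H (sixfold_tensor H) 2 isT.
  rewrite -(zigzag Q (fun z => k' (1 * (i4 r1 * i3 (r2 * z)) * Y))); last first.
    by apply: (lin_comp lk'); lin; apply: (lin_comp li3); lin.
  rewrite (expand3r lk); apply: eq_tsum => xy X3; apply: eq_tsum => X1 X2.
  rewrite /Y (expand3r lk) (expand3r lk'); apply: eq_tsum => yy Y3; apply: eq_tsum => Y1 Y2.
  rewrite (expand2r lk) (expand2r lk'); apply: eq_tsum => R1 R2.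
  rewrite (expand3r lk) (expand3r lk'); apply: eq_tsum => zz y3; apply: eq_tsum => y1 y2.
  by legs kM M; legs kM' M'; rewrite counit1 !scale1r.
have -> : 1 * R[i4, i3] * Y = X[i2, i3, i4] * R[i4, i2 ⋆ i3] * 1.
  rewrite /Y; word; wr (hexagon2 i4 i2 i3).
  by wr (assocK Q i2 i3 i4).
rewrite (rsub2_2 lk' c23) braid_triv2 !mulr1 -[X in k' X]mul1r -[X in k' X]mulr1 (expand3 lk').
rewrite -(zigzag Q (fun z => z)); last by lin.
apply: eq_tsum => xy z; apply: eq_tsum => x y.
by legs kM' M'; rewrite counit1 !scale1r.
Qed.

Lemma drinfeld_elt_unit : u \is a GRing.unit /\ u^-1 = v.
Proof. exact: falg_left_inverse drinfeld_elt_invK. Qed.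

Lemma antipode_inj : injective S.
Proof.
have [U _] := drinfeld_elt_unit.
move=> x y Sxy; apply: (mulrI U); by rewrite -!drinfeld_elt_conj Sxy.
Qed.

Lemma antipode_Sinv h : S (Sinv Q h) = h.
Proof. by apply: lker0_lfunVK; apply/lker0P; exact: antipode_inj. Qed.

Lemma drinfeld_elt_inv_conj h : h * v = v * S (S h).
Proof.
have [U <-] := drinfeld_elt_unit.
by apply: (mulrI U); rewrite !mulrA -drinfeld_elt_conj divrr // mul1r -mulrA divrr // mulr1.
Qed.
End Bijectivity.

(** * The map lambda *)

Section TwistInverse.
Variables (K : fieldType) (H : falgType K) (Q : quasiHopf H) (R : (H ⊗ H)%type).
Local Notation Phi := (Phi Q).
Local Notation alpha := (alpha Q).
Local Notation beta := (beta Q).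
Local Notation S := (antipode Q).
Local Notation Delta := (Delta Q).
Local Notation ε := (counit Q).
Local Notation "a ⋆ b" := (star Q a b).
Local Notation "X[ a , b , c ]" := (ev3 Phi a b c).
Local Notation "x[ a , b , c ]" := (ev3 Phi^-1 a b c).

Local Notation trivial := (@triv _ _ Q _).
Local Notation SS := (tensor_antipode Q).
Local Notation delta := (drinfeld_delta Q).
Local Notation f := (drinfeld_twist Q).

Lemma counit_antipode h : ε (S h) = ε h.
Proof.
have la : linear (fun z => ε z : K^o) by exact: (@counit_linear _ _ Q).
have lS : linear (fun z => ε (S z) : K^o) by apply: (lin_comp la); lin.
have e := cap_alpha Q (U := K^o) _ h la; rewrite [ε alpha]eps_alpha in e.
have cZ l x : ε (l *: x) = l * ε x by rewrite /counit linearZ.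
have -> : ε h = ε h *: (1 : K^o) by rewrite /GRing.scale /= mulr1.
rewrite -e -[in LHS](counitr Q h) (linear_tsum (U' := K^o) _ _ lS).
apply: eq_tsumK => x y; rewrite linearZ /= cZ.
by rewrite !counitM [ε alpha]eps_alpha mulr1 mulrC.
Qed.

Section Images.
Variable B : falgType K.
Implicit Types (a b c : H -> B).
Local Notation "F[ a , b ]" := (ev2 f a b).
Local Notation "G[ a , b ]" := (ev2 f^-1 a b).
Context (a b c : H -> B) {ha : alghom a} {hb : alghom b} {hc : alghom c}.
Context {ab : commuting a b} {ac : commuting a c} {bc : commuting b c}.

Lemma twistK : F[a, b] * G[a, b] = 1.
Proof. by rewrite -ev2M // divrr ?ev2_1 //; exact: (drinfeld_twist_unit Q).1. Qed.

Lemma twistVK : G[a, b] * F[a, b] = 1.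
Proof. by rewrite -ev2M // mulVr ?ev2_1 //; exact: (drinfeld_twist_unit Q).1. Qed.

Lemma twistV_star : intertwines G[a, b] (antip Q b ⋆ antip Q a) (antip Q (a ⋆ b)).
Proof.
move=> h; rewrite -[LHS]mulr1 -twistK !mulrA -(mulrA G[a, b]) -twist_star.
by rewrite !mulrA twistVK mul1r.
Qed.
End Images.
#[global] Arguments twistK {B} a b {_ _ _}.
#[global] Arguments twistVK {B} a b {_ _ _}.
#[global] Existing Instance twistV_star.

Section Associator.
Variable B : falgType K.
Local Notation "G[ a , b ]" := (ev2 f^-1 a b).
Context (a b c : H -> B) {ha : alghom a} {hb : alghom b} {hc : alghom c}.
Context {ab : commuting a b} {ac : commuting a c} {bc : commuting b c}.

Lemma twistV_associator : X[a, b, c] * G[a ⋆ b, c] * G[a, b] =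
  G[a, b ⋆ c] * G[b, c] * ev3 Phi (antip Q c) (antip Q b) (antip Q a).
Proof.
lcancel (twistVK a (b ⋆ c)); lcancel (twistVK b c); word.
wr (twistK a (b ⋆ c)); wr (twistK b c); wr (twist_associator Q a b c).
by wr (twistK (a ⋆ b) c); wr (twistK a b).
Qed.

Lemma twistV_associatorV : x[a, b, c] * G[a, b ⋆ c] * G[b, c] =
  G[a ⋆ b, c] * G[a, b] * ev3 Phi^-1 (antip Q c) (antip Q b) (antip Q a).
Proof.
lcancel (assocVK Q a b c); word; wr (assocK Q a b c).
wr twistV_associator; by wr (assocK_anti Q (antip Q c) (antip Q b) (antip Q a)).
Qed.
End Associator.
#[global] Arguments twistV_associator {B} a b c {_ _ _ _ _ _}.
#[global] Arguments twistV_associatorV {B} a b c {_ _ _ _ _ _}.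

Section Sums.

(** If [E] absorbs coproducts on the left, f^{-1} may be replaced by Δ(β) f^{-1} = δ, because ε(β) =
    1. This makes sums over f^{-1} computable. *)
Lemma tsum_twistV_cap (U : lmodType K) (E : H -> H -> U) : bilinear_fun E ->
  (forall h x y, \tsum_(h1 ⊗ h2 <- Delta h) E (h1 * x) (h2 * y) = ε h *: E x y) ->
  tsum f^-1 E = tsum delta E.
Proof.
move=> bE cE; rewrite -beta_drinfeld_twistV tsum_mul // exchange_tsum.
by apply: eq_tsum => x y; rewrite cE [ε beta]eps_beta scale1r.
Qed.

Lemma tsum_delta (U : lmodType K) (E : H -> H -> U) : bilinear_fun E ->
  tsum delta E = \tsum_(B1 ⊗ B2 ⊗ B3 ⊗ B4 <-
      (\tsum_(X1 ⊗ X2 ⊗ X3 <- Phi) (Delta X1 ⊗ X2 ⊗ X3)) * (Phi^-1 ⊗ 1))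
    E (B1 * beta * S B4) (B2 * beta * S B3).
Proof.
move=> bE; have l := tsum_linear E.
rewrite (linear_tsum _ _ l); apply: eq_tsum => A123 A4.
rewrite (linear_tsum _ _ l); apply: eq_tsum => A12 A3.
rewrite (linear_tsum _ _ l); apply: eq_tsum => A1 A2.
by rewrite tsum_pure.
Qed.

(** With δ in place of f^{-1}, the cap on 1 ⋆ 2 deletes one of the two associators in δ, and the
    other is a zigzag. *)
Lemma twistV_alpha : \tsum_(g1 ⊗ g2 <- f^-1) S g1 * alpha * g2 = S beta.
Proof.
rewrite tsum_twistV_cap; last 2 first.
- by split=> ?; lin.
- move=> h x y; rewrite -(cap_alpha Q (fun z => S x * z * y)); last by lin.
  by apply: eq_tsum => h1 h2; rewrite antipodeM !mulrA.
pose M (l1 l2 l3 l4 l5 l6 : H) : H :=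
  ε l5 *: (ε l6 *: (S (l1 * beta * S l4) * alpha * (l2 * beta * S l3))).
have lM : multilinear6 M by do ![split] => *; rewrite /M; linc.
have [k lk kM] := six_rec (sixfold_tensor H) lM.
have c12 : lsub k (i1 ⋆ i2) trivial.
  apply: lsub_six => // p l1 l2 l3 l4 l5 l6.
  rewrite kM -(cap_alpha Q (fun z => ε l5 *: (ε l6 *:
    (S (l1 * beta * S l4) * z * (l2 * beta * S l3))))); last by linc.
  by apply: eq_tsum => x y; legs kM M.
have -> : tsum delta (fun g1 g2 => S g1 * alpha * g2) =
    k (1 * X[i1 ⋆ i2, i3, i4] * x[i1, i2, i3]).
  rewrite tsum_delta; last by split=> ?; lin.
  rewrite mul1r -(ev4_delta Q i1 i2 i3 i4) -[X in k X]mulr1 -[X in k (X * _)]mul1r.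
  rewrite (ev4_expand _ _ _ lk).
  apply: eq_tsum => A123 A4; apply: eq_tsum => A12 A3; apply: eq_tsum => A1 A2.
  by legs kM M; rewrite counit1 !scale1r.
rewrite (lsub3_1 lk c12) assoc_triv1 !mul1r -[X in k X]mulr1 -[X in k (X * _)]mul1r (expand3 lk).
rewrite -[RHS]mulr1 -(zigzagV Q (fun z => S beta * z)); last by lin.
apply: eq_tsum => xy z; apply: eq_tsum => x y.
by legs kM M; rewrite counit1 !scale1r.
Qed.

(** The map whose transpose is [lambda]; written this way it does not involve the inverse of S. *)
Definition lambda_map (x : H) : H := \tsum_(g1 ⊗ g2 <- f^-1) g1 * S (g2 * x).
Local Notation T := lambda_map.

Lemma lambda_map_linear : linear T.
Proof. by rewrite /T; lin. Qed.

Lemma twistV_conj h : f^-1 * SS h = Delta (S h) * f^-1.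
Proof.
have [U _] := drinfeld_twist_unit Q.
by apply: (mulrI U); rewrite !mulrA drinfeld_twist_conj divrr // mul1r mulrK.
Qed.

(** This is [twistV_conj] read under g^1 ⊗ g^2 ↦ g^1 S(g^2 x); its transpose is the H-linearity of
    [lambda]. *)
Lemma lambda_map_ad h x :
  \tsum_(h1 ⊗ h2 <- Delta h) T (S h1 * x * h2) = ad Q (S h) (T x).
Proof.
pose E t := \tsum_(g1 ⊗ g2 <- t : (H ⊗ H)%type) g1 * S (g2 * x).
have bE : bilinear_fun (fun g1 g2 => g1 * S (g2 * x)) by split=> ?; lin.
transitivity (E (f^-1 * SS h)).
  rewrite /E tsum_mul // [RHS]exchange_tsum tensor_antipodeE.
  rewrite (linear_tsum (g := fun t => tsum t _)); last by lin.
  apply: eq_tsum => h1 h2; rewrite tsum_pure; last by split=> ?; lin.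
  by apply: eq_tsum => g1 g2; rewrite !antipodeM !mulrA.
rewrite twistV_conj /E tsum_mul //; apply: eq_tsum => h1 h2.
rewrite (linear_tsum (g := fun y => h1 * y * _)); last by lin.
by apply: eq_tsum => g1 g2; rewrite !antipodeM !mulrA.
Qed.

Lemma antip_trivial (B : falgType K) : antip Q (@triv _ _ Q B) = trivial.
Proof. by apply: functional_extensionality => h; rewrite /antip /triv counit_antipode. Qed.

Lemma twistV_triv2 (B : falgType K) : ev2 f^-1 trivial trivial = 1 :> B.
Proof.
have [lt t1 tM] := @triv_alghom _ _ Q B.
have tr h : ε h = 1 -> triv Q B h = 1 by move=> e; rewrite /triv e scale1r.
have e : triv Q B (S beta) = 1 by apply: tr; rewrite counit_antipode; exact: eps_beta.
rewrite -e -twistV_alpha (linear_tsum _ _ lt).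
apply: eq_tsum => x y; rewrite !tM (tr alpha (eps_alpha Q)) mulr1.
by rewrite -[triv Q B (S x)]/(antip Q (triv Q B) x) antip_trivial.
Qed.

(** Needed for a leg of the form a∘S, which is not an algebra map: the value is first computed on
    the identity leg. *)
Lemma ev3_triv (B : falgType K) (t : (H ⊗ H ⊗ H)%type) (c : H -> B) : linear c ->
  ev3 t trivial trivial c = c (ev3 t trivial trivial (fun z => z)).
Proof.
move=> lc; have cZ l z : c (l *: z) = l *: c z by exact: linear_scale.
rewrite /ev3 (linear_tsum _ _ lc); apply: eq_tsum => xy z; rewrite (linear_tsum _ _ lc).
by apply: eq_tsum => x y; rewrite /triv -!scalerAl !mul1r -!scalerAl !mul1r !cZ.
Qed.

(** [twistV_associator] with two trivial legs makes this value idempotent, and it is invertible. *)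
Lemma twistV_triv (B : falgType K) (a : H -> B) {ha : alghom a} : ev2 f^-1 a trivial = 1.
Proof.
have [la a1 _] := ha.
pose proof (twistV_associator a trivial trivial) as E.
have hi : alghom (fun z : H => z) by split.
have lS : linear (antip Q a) by apply: (lin_comp la); lin.
rewrite !antip_trivial !star_trivr twistV_triv2 mulr1 assoc_triv3 mul1r in E.
rewrite (ev3_triv _ lS) assoc_triv1 /antip antipode1 a1 mulr1 in E.
by lcancel (twistK a trivial); rewrite mulr1 E.
Qed.

Lemma delta_dual : \tsum_(g1 ⊗ g2 <- delta) g1 * S (g2 * alpha) = beta.
Proof.
rewrite tsum_delta; last by split=> ?; lin.
pose M (l1 l2 l3 l4 l5 l6 : H) : H :=
  ε l5 *: (ε l6 *: (l1 * beta * S (l2 * beta * S l3 * alpha * l4))).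
have lM : multilinear6 M by do ![split] => *; rewrite /M; linc.
have [k lk kM] := six_rec (sixfold_tensor H) lM.
have c34 : lsub k (i3 ⋆ i4) trivial.
  apply: lsub_six => // p l1 l2 l3 l4 l5 l6.
  rewrite kM -(cap_alpha Q (fun z => ε l5 *: (ε l6 *:
    (l1 * beta * S (l2 * beta * S l3 * z * l4))))); last by linc.
  by apply: eq_tsum => x y; legs kM M.
have c23 : rsub k (i2 ⋆ i3) trivial.
  apply: rsub_six => // p l1 l2 l3 l4 l5 l6.
  rewrite kM -(cup_beta Q (fun z => ε l5 *: (ε l6 *:
    (l1 * beta * S (l2 * z * S l3 * alpha * l4))))); last by linc.
  by apply: eq_tsum => x y; legs kM M.
transitivity (k (1 * x[i1, i2, i3 ⋆ i4] * (X[i2, i3, i4] * X[i1, i2 ⋆ i3, i4]))).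
  transitivity (k (1 * (X[i1 ⋆ i2, i3, i4] * x[i1, i2, i3]) * 1)).
    rewrite -(ev4_delta Q i1 i2 i3 i4) (ev4_expand _ _ _ lk).
    apply: eq_tsum => A123 A4; apply: eq_tsum => A12 A3; apply: eq_tsum => A1 A2.
    by legs kM M; rewrite counit1 !scale1r.
  congr (k _); lcancel (assocVK Q i1 i2 (i3 ⋆ i4)); word.
  wr (assocK Q i1 i2 (i3 ⋆ i4)); wr <- (pentagon Q i1 i2 i3 i4).
  by wr (assocK Q i1 i2 i3).
rewrite (lsub3_3 lk c34) assocV_triv3 !mul1r -[X in k X]mulr1 (rsub3_2 lk c23) assoc_triv2 !mulr1.
rewrite -[X in k X]mul1r -[X in k X]mulr1 (expand3 lk).
rewrite -[RHS]mulr1 -(antipode1 Q) -(zigzag Q (fun z => beta * S z)); last by lin.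
apply: eq_tsum => xy z; apply: eq_tsum => x y.
by legs kM M; rewrite counit1 !scale1r.
Qed.

(** By [lambda_map_ad] and the cap axiom, S(h) ▷ T(α) = ε(h) T(α). As S is onto and ε(β) = 1, T(α) =
    β ▷ T(α), and expanding this brings in Δ(β) f^{-1} = δ, which [delta_dual] evaluates to β. *)
Lemma lambda_map_alpha {hR : quasiTriangular Q R} : T alpha = beta.
Proof.
have e h : ad Q (S h) (T alpha) = ε h *: T alpha.
  rewrite -lambda_map_ad -(cap_alpha Q (fun z => T z)) //; exact: lambda_map_linear.
rewrite -delta_dual -beta_drinfeld_twistV tsum_mul; last by split=> ?; lin.
transitivity (ad Q beta (T alpha)).
  rewrite -(@antipode_Sinv _ _ Q R hR beta) e -counit_antipode (@antipode_Sinv _ _ Q R hR) [ε beta]eps_beta.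
  by rewrite scale1r.
apply: eq_tsum => x y; rewrite (linear_tsum (g := fun z => x * z * _)); last by lin.
by apply: eq_tsum => g1 g2; rewrite !antipodeM !mulrA.
Qed.
End Sums.
End TwistInverse.

(** * Functionals, and pairings for the tensor square of the dual *)

Section Lambda.
Variables (K : fieldType) (H : falgType K) (Q : quasiHopf H) (R : (H ⊗ H)%type).
Context {hR : quasiTriangular Q R}.
Local Notation Phi := (Phi Q).
Local Notation beta := (beta Q).
Local Notation S := (antipode Q).
Local Notation Delta := (Delta Q).

Local Notation f := (drinfeld_twist Q).
Local Notation T := (lambda_map Q).
Local Notation dualH := 'Hom(H, K^o).
Implicit Types (chi psi : dualH).

Lemma hitsE a chi b x : hits a chi b x = chi (b * x * a).
Proof. by rewrite linfun_fun //; apply: lin_lfun; lin. Qed.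

Lemma tsum_lfunE (V W U U' : vectType K) (t : (V ⊗ W)%type) (E : V -> W -> 'Hom(U, U')) x :
  (tsum t E) x = tsum t (fun a b => E a b x).
Proof. apply: (linear_tsum (g := fun h : 'Hom(U, U') => h x)) => l a b.
by rewrite add_lfunE scale_lfunE. Qed.

Lemma lambdaE chi x : lambda Q chi x = chi (T x).
Proof.
rewrite /lambda tsum_lfunE /lambda_map (linear_tsum (g := fun y => chi y)); last by lin.
apply: eq_tsum => g1 g2; rewrite hitsE comp_lfunE !antipodeM.
by rewrite (@antipode_Sinv _ _ Q R hR).
Qed.

Lemma lambda_linear : linear (@lambda K H Q).
Proof.
move=> l x y; apply/lfunP => h.
by rewrite add_lfunE scale_lfunE !lambdaE add_lfunE scale_lfunE.
Qed.

(** The twist undoes its inverse: f^1 T(x) S(f^2) = S(x), and S is injective. *)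
Lemma lambda_map_inj : injective T.
Proof.
have e x : \tsum_(f1 ⊗ f2 <- f) f1 * T x * S f2 = S x.
  transitivity (\tsum_(a ⊗ b <- (f * f^-1)) (a * S (b * x))).
    rewrite tsum_mul; last by split=> ?; lin.
    apply: eq_tsum => f1 f2; rewrite (linear_tsum (g := fun y => f1 * y * _)); last by lin.
    by apply: eq_tsum => g1 g2; rewrite !antipodeM !mulrA.
  rewrite divrr; last exact: (drinfeld_twist_unit Q).1.
  by rewrite tsum_one ?mul1r //; split=> ?; lin.
move=> x y Txy; apply: (@antipode_inj _ _ Q R hR); by rewrite -!e Txy.
Qed.

Lemma lambda_bij : bijective (@lambda K H Q).
Proof.
pose t : 'End(H) := linfun T.
have tE x : t x = T x by rewrite linfun_fun //; exact: lambda_map_linear.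
have kt : lker t == 0%VS by apply/lker0P => x y; rewrite !tE; exact: lambda_map_inj.
exists (fun psi => (psi \o t^-1)%VF) => chi; apply/lfunP => x.
  by rewrite comp_lfunE lambdaE -tE lker0_lfunVK.
by rewrite lambdaE comp_lfunE -tE lker0_lfunK.
Qed.

(** In finite dimension every functional on the dual is evaluation at an element of H; in particular
    each coordinate function is. *)
Lemma dual_pair_ext (s t : (dualH ⊗ dualH)%type) :
  (forall x y, tsum s (fun phi psi => (phi x : K^o) * psi y) =
               tsum t (fun phi psi => (phi x : K^o) * psi y)) -> s = t.
Proof.
move=> e.
have ev (c : dualH -> K^o) : linear c -> exists x, forall phi : dualH, c phi = phi x.
  move=> lc; pose C : 'Hom(dualH, K^o) := linfun c.
  have CE phi : C phi = c phi by exact: linfun_fun.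
  exists (\sum_(k < \dim {:H}) c (dual_basis k) *: (vbasis {:H})`_k) => phi.
  have phiE : phi = \sum_(k < \dim {:H}) phi (vbasis {:H})`_k *: dual_basis k.
    apply/lfunP => x; rewrite [x in LHS](coord_vbasis (memvf x)) linear_sum sum_lfunE.
    apply: eq_bigr => k _; rewrite scale_lfunE linearZ /= [LHS]mulrC.
    by rewrite linfun_fun //; exact: linearP.
  rewrite -CE [in LHS]phiE !linear_sum; apply: eq_bigr => k _.
  by rewrite !linearZ /= CE [LHS]mulrC.
apply/matrixP => i j.
have [x xE] := ev (fun phi => coord (vbasis {:dualH}) i phi) (linearP _).
have [y yE] := ev (fun phi => coord (vbasis {:dualH}) j phi) (linearP _).
have sE (r : (dualH ⊗ dualH)%type) : (r : 'M_(_, _)) i j =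
    tsum r (fun phi psi => (phi x : K^o) * psi y).
  rewrite [r in LHS]tensorE
    (linear_tsum (U' := K^o) (g := fun r : (dualH ⊗ dualH)%type => (r : 'M_(_, _)) i j)).
    by apply: eq_tsumK => phi psi; rewrite mxE xE yE.
  by move=> l a b; rewrite !mxE.
by rewrite !sE e.
Qed.

Definition dual_pair (s : (dualH ⊗ dualH)%type) (x y : H) : K^o :=
  tsum s (fun phi psi => (phi x : K^o) * psi y).

Lemma dual_pair_bil x y : bilinear_fun (fun phi psi : dualH => (phi x : K^o) * psi y).
Proof.
split=> phi l a b; rewrite add_lfunE scale_lfunE ?mulrDl ?mulrDr //.
  by rewrite scalerAl.
by rewrite scalerAr.
Qed.

Lemma dual_pair_linear x y : linear (fun s => dual_pair s x y).
Proof. exact: tsum_linear. Qed.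

Lemma dual_pair_pure phi psi x y : dual_pair (phi ⊗ psi) x y = (phi x : K^o) * psi y.
Proof. by rewrite /dual_pair tsum_pure //; exact: dual_pair_bil. Qed.

Lemma dual_pair_tmap s x y :
  dual_pair (tmap (@lambda K H Q) (@lambda K H Q) s) x y = dual_pair s (T x) (T y).
Proof.
rewrite /tmap (linear_tsum _ _ (dual_pair_linear x y)).
by apply: eq_tsumK => phi psi; rewrite dual_pair_pure !lambdaE.
Qed.

Lemma dual_basisE i x : dual_basis i x = coord (vbasis {:H}) i x.
Proof. by rewrite linfun_fun //; exact: linearP. Qed.

Lemma tsum_basis (U : lmodType K) (E : H -> H -> U) x y : bilinear_fun E ->
  \sum_i \sum_j (coord (vbasis {:H}) i x * coord (vbasis {:H}) j y)
    *: E (vbasis {:H})`_i (vbasis {:H})`_j = E x y.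
Proof.
move=> /(tsum_pure x y) <-; rewrite /tsum; apply: eq_bigr => i _; apply: eq_bigr => j _.
by rewrite mxE.
Qed.

Lemma dual_pair_sum (I J : finType) (s : I -> J -> (dualH ⊗ dualH)%type) x y :
  dual_pair (\sum_i \sum_j s i j) x y = \sum_i \sum_j dual_pair (s i j) x y.
Proof.
have l := dual_pair_linear x y; rewrite (linear_bigsum _ l).
by apply: eq_bigr => i _; rewrite (linear_bigsum _ l).
Qed.

Lemma dual_pairZ l s x y : dual_pair (l *: s) x y = l *: dual_pair s x y.
Proof. exact: linear_scale (dual_pair_linear x y). Qed.

Lemma dual_pair_mul_transpose chi x y : dual_pair (mul_transpose chi) x y = chi (x * y).
Proof.
rewrite dual_pair_sum -(tsum_basis (E := fun a b => chi (a * b))); last by split=> ?; lin.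
apply: eq_bigr => i _; apply: eq_bigr => j _.
by rewrite dual_pairZ dual_pair_pure !dual_basisE [LHS]mulrC.
Qed.

Lemma ad_linear h : linear (ad Q h).
Proof. by rewrite /ad; lin. Qed.

Lemma env_mul_linearl y : linear (fun x => env_mul Q x y).
Proof. by rewrite /env_mul; lin. Qed.

Lemma env_mul_linearr x : linear (env_mul Q x).
Proof. by rewrite /env_mul; lin. Qed.

(** The dual coproduct uses e^j ⊗ e^i, so [x] and [y] trade places. *)
Lemma dual_pair_comul chi x y : dual_pair (dual_comul Q R chi) x y =
  chi (\tsum_(g1 ⊗ g2 <- f^-1) env_mul Q (ad Q g1 y) (ad Q g2 x)).
Proof.
rewrite dual_pair_sum (linear_tsum (g := fun y => chi y)); last by lin.
pose E a b : K^o := \tsum_(g1 ⊗ g2 <- f^-1) chi (env_mul Q (ad Q g1 a) (ad Q g2 b)).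
rewrite -[RHS]/(E y x) -(tsum_basis (E := E)).
  apply: eq_bigr => i _; apply: eq_bigr => j _.
  by rewrite dual_pairZ dual_pair_pure !dual_basisE [LHS]mulrC (mulrC (coord _ j x)).
split=> w; apply: lin_tsumr => a b; apply: lin_lfun.
  by apply: (lin_comp (env_mul_linearl _)); exact: ad_linear.
by apply: (lin_comp (env_mul_linearr _)); exact: ad_linear.
Qed.

Lemma dual_pair_fun_comul chi x y : dual_pair (fun_comul Q chi) x y =
  chi (\tsum_(x1 ⊗ x2 ⊗ x3 <- Phi^-1) \tsum_(x31 ⊗ x32 <- Delta x3)
    \tsum_(X1 ⊗ X2 ⊗ X3 <- Phi)
      (S x1 * x * 1) * (x2 * X1 * beta * S (x31 * X2) * y * (x32 * X3))).
Proof.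
have ld := dual_pair_linear x y.
rewrite /fun_comul (linear_tsum _ _ ld).
transitivity (\tsum_(x1 ⊗ x2 ⊗ x3 <- Phi^-1) \tsum_(x31 ⊗ x32 <- Delta x3)
    \tsum_(X1 ⊗ X2 ⊗ X3 <- Phi)
    dual_pair (mul_transpose chi) (S x1 * x * 1)
      (x2 * X1 * beta * S (x31 * X2) * y * (x32 * X3))); last first.
  rewrite [RHS](linear_tsum (g := fun y => chi y)); last by lin.
  apply: eq_tsumK => x12 x3.
  rewrite [RHS](linear_tsum (g := fun y => chi y)); last by lin.
  apply: eq_tsumK => x1 x2.
  rewrite [RHS](linear_tsum (g := fun y => chi y)); last by lin.
  apply: eq_tsumK => x31 x32.
  rewrite [RHS](linear_tsum (g := fun y => chi y)); last by lin.
  apply: eq_tsumK => X12 X3.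
  rewrite [RHS](linear_tsum (g := fun y => chi y)); last by lin.
  by apply: eq_tsumK => X1 X2; rewrite dual_pair_mul_transpose.
transitivity (tsum (mul_transpose chi) (fun phi psi =>
  \tsum_(x1 ⊗ x2 ⊗ x3 <- Phi^-1) \tsum_(x31 ⊗ x32 <- Delta x3)
  \tsum_(X1 ⊗ X2 ⊗ X3 <- Phi)
    ((phi (S x1 * x * 1) : K^o) * psi (x2 * X1 * beta * S (x31 * X2) * y * (x32 * X3))))).
  apply: eq_tsumK => phi psi.
  rewrite (linear_tsum _ _ ld); apply: eq_tsumK => x12 x3.
  rewrite (linear_tsum _ _ ld); apply: eq_tsumK => x1 x2.
  rewrite (linear_tsum _ _ ld); apply: eq_tsumK => x31 x32.
  rewrite (linear_tsum _ _ ld); apply: eq_tsumK => X12 X3.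
  rewrite (linear_tsum _ _ ld); apply: eq_tsumK => X1 X2.
  by rewrite dual_pair_pure !hitsE !mulrA.
rewrite exchange_tsum; apply: eq_tsumK => x12 x3.
rewrite exchange_tsum; apply: eq_tsumK => x1 x2.
rewrite exchange_tsum; apply: eq_tsumK => x31 x32.
rewrite exchange_tsum; apply: eq_tsumK => X12 X3.
by rewrite exchange_tsum.
Qed.
End Lambda.

(** * Coproducts *)

Section Comultiplication.
Variables (K : fieldType) (H : falgType K) (Q : quasiHopf H) (R : (H ⊗ H)%type).
Local Notation Phi := (Phi Q).
Local Notation alpha := (alpha Q).
Local Notation beta := (beta Q).
Local Notation S := (antipode Q).
Local Notation Delta := (Delta Q).
Local Notation ε := (counit Q).
Local Notation "a ⋆ b" := (star Q a b).
Local Notation "X[ a , b , c ]" := (ev3 Phi a b c).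
Local Notation "x[ a , b , c ]" := (ev3 Phi^-1 a b c).

Local Notation trivial := (@triv _ _ Q _).
Local Notation f := (drinfeld_twist Q).
Local Notation T := (lambda_map Q).
Local Notation "G[ a , b ]" := (ev2 f^-1 a b).

(** The shape of the product A • B: legs 1, 2 surround [A], legs 3, 4 surround [B], α caps legs 2,
    3, and ε closes the two spare legs. *)
Definition env_word (A B l1 l2 l3 l4 l5 l6 : H) : H :=
  ε l5 *: (ε l6 *: (l1 * A * S l2 * alpha * l3 * B * S l4)).
Definition env_form A B := six_lift (s := sixfold_tensor H) (env_word A B).
Local Notation M := env_word.
Local Notation k := env_form.

Lemma env_formE A B l1 l2 l3 l4 l5 l6 :
  k A B (six (sixfold_tensor H) l1 l2 l3 l4 l5 l6) = M A B l1 l2 l3 l4 l5 l6.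
Proof. by apply: six_liftE; do ![split] => *; rewrite /M; linc. Qed.

Lemma env_form_linear A B : linear (k A B).
Proof. exact: six_lift_linear. Qed.

(** A letter at the right end stands next to [A] or [B] and can be absorbed into it. *)
Lemma env_form_pure A B z (t : (H ⊗ H)%type) :
  (k A B (z * ev2 t i1 i2) = k (\tsum_(x ⊗ y <- t) x * A * S y) B z) *
  (k A B (z * ev2 t i3 i4) = k A (\tsum_(x ⊗ y <- t) x * B * S y) z).
Proof.
have lk := env_form_linear; have kM := env_formE.
split; move: z; apply: six_ind => [||l1 l2 l3 l4 l5 l6] //.
- by apply: (lin_comp (lk A B)); lin.
- rewrite kM /M.
  rewrite -[X in k A B X]mulr1 (expand2 (lk A B)).
  rewrite [in RHS](linear_tsum (g := fun y =>
    ε l5 *: (ε l6 *: (l1 * y * S l2 * alpha * l3 * B * S l4)))); last by linc.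
  by apply: eq_tsum => x y; legs kM M.
- by apply: (lin_comp (lk A B)); lin.
- rewrite kM /M -[X in k A B X]mulr1 (expand2 (lk A B)).
  rewrite (linear_tsum (g := fun y =>
    ε l5 *: (ε l6 *: (l1 * A * S l2 * alpha * l3 * y * S l4)))); last by linc.
  by apply: eq_tsum => x y; legs kM M.
Qed.

Lemma env_form_mul A B : k A B (x[i2, i3, i4] * X[i1, i2, i3 ⋆ i4]) = env_mul Q A B.
Proof.
have lk := env_form_linear A B; have kM := env_formE A B.
rewrite -[X in k A B X]mulr1 (expand3 lk).
apply: eq_tsum => X12 X3; apply: eq_tsum => X1 X2.
rewrite -[x[_, _, _]]mul1r -[X in k A B X]mulrA (expand3 lk).
apply: eq_tsum => x12 x3; apply: eq_tsum => x1 x2.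
rewrite [X in k _ _ X]mulrA /star (expand_last lk).
apply: eq_tsum => X31 X32.
by legs kM M; rewrite counit1 !scale1r.
Qed.

Lemma env_form_ad A B z (t : (H ⊗ H)%type) :
  k A B (z * ev2 t (i1 ⋆ i2) (i3 ⋆ i4)) = \tsum_(x ⊗ y <- t) k (ad Q x A) (ad Q y B) z.
Proof.
have lk := env_form_linear.
rewrite -[X in k A B X]mulr1 (expand2 (lk A B)); apply: eq_tsum => x y.
rewrite mulr1 mulrA [X in _ * X]/star (env_form_pure _ _ _ _).2.
by rewrite /star (env_form_pure _ _ _ _).1.
Qed.

(** The right side has three copies of f^{-1}: one on each factor, producing T(q) and T(p), and one
    on the two arguments of the product. [twistV_associator] and [twistV_associatorV] regroup them
    so that the cap on legs 2, 3 leaves a copy on 1, 4 and a copy on 2, 3. The first is the T on the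
    left side, and the second collapses to S(β). *)
Lemma lambda_map_comul p q :
  \tsum_(x1 ⊗ x2 ⊗ x3 <- Phi^-1) \tsum_(x31 ⊗ x32 <- Delta x3) \tsum_(X1 ⊗ X2 ⊗ X3 <- Phi)
    T ((S x1 * p * 1) * (x2 * X1 * beta * S (x31 * X2) * q * (x32 * X3))) =
  \tsum_(g1 ⊗ g2 <- f^-1) env_mul Q (ad Q g1 (T q)) (ad Q g2 (T p)).
Proof.
pose kk := k (S q) (S p).
have lk : linear kk by exact: env_form_linear.
have kM l1 l2 l3 l4 l5 l6 : kk (six _ l1 l2 l3 l4 l5 l6) = M (S q) (S p) l1 l2 l3 l4 l5 l6.
  exact: env_formE.
have c23 : lsub kk (i2 ⋆ i3) trivial.
  apply: lsub_six => // h l1 l2 l3 l4 l5 l6.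
  rewrite kM -(cap_alpha Q (fun z => ε l5 *: (ε l6 *:
    (l1 * S q * S l2 * z * l3 * S p * S l4)))); last by linc.
  by apply: eq_tsum => x y; legs kM M.
have -> : \tsum_(g1 ⊗ g2 <- f^-1) env_mul Q (ad Q g1 (T q)) (ad Q g2 (T p)) =
    kk (x[i2, i3, i4] * X[i1, i2, i3 ⋆ i4] * G[i1 ⋆ i2, i3 ⋆ i4] * G[i1, i2] * G[i3, i4]).
  rewrite /kk (env_form_pure _ _ _ _).2 (env_form_pure _ _ _ _).1 env_form_ad.
  have TE y : \tsum_(g1 ⊗ g2 <- f^-1) g1 * S y * S g2 = T y.
    by apply: eq_tsum => g1 g2; rewrite antipodeM mulrA.
  by rewrite !TE; apply: eq_tsum => g1 g2; rewrite env_form_mul.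
transitivity (kk (1 * G[i1, i4] * (G[i2, i3] *
   (ev3 Phi (antip Q i3) (antip Q i2) (antip Q i1) *
    (ev3 Phi^-1 (antip Q i4) (antip Q i3) (antip Q i2 ⋆ antip Q i1) * 1))))).
  symmetry.
  have -> : 1 * G[i1, i4] * (G[i2, i3] *
     (ev3 Phi (antip Q i3) (antip Q i2) (antip Q i1) *
      (ev3 Phi^-1 (antip Q i4) (antip Q i3) (antip Q i2 ⋆ antip Q i1) * 1))) =
    G[i1, i4] * G[i2, i3] * ev3 Phi (antip Q i3) (antip Q i2) (antip Q i1) *
     ev3 Phi^-1 (antip Q i4) (antip Q i3) (antip Q i2 ⋆ antip Q i1) * 1.
    by rewrite !mulrA mul1r.
  rewrite (expand3 lk); apply: eq_tsum => x12 x3; apply: eq_tsum => x1 x2.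
  rewrite {1}/star (expand_last lk); apply: eq_tsum => x31 x32.
  rewrite -[X in kk X]mulrA (expand3 lk); apply: eq_tsum => X12 X3; apply: eq_tsum => X1 X2.
  rewrite -!mulrA -[X in kk X]mul1r (expand2r lk); apply: eq_tsum => g1 g2.
  rewrite (expand2r lk).
  pose F z := g1 * S X3 * S x32 * S q * S (S x31) * S (S X2) * z * S X1 * S x2 * S p *
    S (S x1) * S g2.
  (* The S(β) of the left side is S(h^1) α h^2 for the copy of f^{-1} on legs 2 and 3. *)
  transitivity (F (S beta)); last by rewrite /F !antipodeM antipode1 ?mulrA ?mulr1.
  rewrite -twistV_alpha (linear_tsum (g := F)); last by rewrite /F; lin.
  apply: eq_tsum => h1 h2; rewrite /antip; legs kM M; rewrite counit1 !scale1r.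
  by rewrite /F !mulrA.
transitivity (kk (1 * X[i1, i2 ⋆ i3, i4] * (G[i1 ⋆ (i2 ⋆ i3), i4] * (G[i1, i2 ⋆ i3] * (G[i2, i3] *
   (ev3 Phi (antip Q i3) (antip Q i2) (antip Q i1) *
    (ev3 Phi^-1 (antip Q i4) (antip Q i3) (antip Q i2 ⋆ antip Q i1) * 1))))))).
  symmetry; rewrite (lsub3_2 lk c23) assoc_triv2 !mul1r -[X in kk X = _]mul1r [X in kk X = _]mulrA.
  rewrite (lsub2_1_after lk (lsub_starr lk c23)) [X in kk X = _]mulrA (lsub2_2 lk c23).
  by rewrite twistV_triv !mulr1 ?mul1r !mulrA.
congr (kk _); word.
have e : x[i2, i3, i4] * X[i1, i2, i3 ⋆ i4] = X[i1, i2 ⋆ i3, i4] * X[i1, i2, i3] * x[i1 ⋆ i2, i3, i4].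
  lcancel (assocVK Q i2 i3 i4); word; wr (assocK Q i2 i3 i4).
  by wr (pentagon Q i1 i2 i3 i4); wr (assocK Q (i1 ⋆ i2) i3 i4).
wr e; wr (slide2 G[i1, i2] f^-1 i3 i4); wr (twistV_associatorV Q (i1 ⋆ i2) i3 i4).
wr <- (slide3 G[i1, i2] Phi^-1 (antip Q i4) (antip Q i3) (antip Q i2 ⋆ antip Q i1)).
wr (slide2 X[i1, i2, i3] f^-1 (i1 ⋆ i2 ⋆ i3) i4).
by wr (twistV_associator Q i1 i2 i3).
Qed.
End Comultiplication.

(** * Products *)

Section TwistWord.
Variables (K : fieldType) (H : falgType K) (Q : quasiHopf H) (R : (H ⊗ H)%type).
Context {hR : quasiTriangular Q R}.
Local Notation Phi := (Phi Q).
Local Notation "a ⋆ b" := (star Q a b).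
Local Notation "X[ a , b , c ]" := (ev3 Phi a b c).
Local Notation "x[ a , b , c ]" := (ev3 Phi^-1 a b c).
Local Notation "R[ a , b ]" := (ev2 R a b).

Local Notation f := (drinfeld_twist Q).
Local Notation "F[ a , b ]" := (ev2 f a b).
Local Notation "G[ a , b ]" := (ev2 f^-1 a b).
Local Notation "'SX[' a , b , c ]" := (ev3 Phi (antip Q a) (antip Q b) (antip Q c)).
Local Notation "'Sx[' a , b , c ]" := (ev3 Phi^-1 (antip Q a) (antip Q b) (antip Q c)).
Local Notation "'SR[' a , b ]" := (ev2 R (antip Q a) (antip Q b)).

Section Associator.
Variable B : falgType K.
Context (a b c : H -> B) {ha : alghom a} {hb : alghom b} {hc : alghom c}.
Context {ab : commuting a b} {ac : commuting a c} {bc : commuting b c}.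

Lemma twist_associatorV :
  Sx[c, b, a] * F[b, c] * F[a, b ⋆ c] = F[a, b] * F[a ⋆ b, c] * x[a, b, c].
Proof.
lcancel (assocVK_anti Q (antip Q c) (antip Q b) (antip Q a)); word.
wr (assocK_anti Q (antip Q c) (antip Q b) (antip Q a)).
by wr <- (twist_associator Q a b c); wr (assocK Q a b c).
Qed.
End Associator.
#[global] Arguments twist_associatorV {B} a b c {_ _ _ _ _ _}.

Section Word.
Variable B : falgType K.
Context (l1 l2 l3 l4 : H -> B) {h1 : alghom l1} {h2 : alghom l2} {h3 : alghom l3} {h4 : alghom l4}.
Context {c12 : commuting l1 l2} {c13 : commuting l1 l3} {c14 : commuting l1 l4}.
Context {c23 : commuting l2 l3} {c24 : commuting l2 l4} {c34 : commuting l3 l4}.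

(** The hexagon splits R on the leg 1 ⋆ 2, and pentagons place the two resulting copies in the order
    in which the product of [fun_group] has them. *)
Lemma braid_associator_word :
  x[l3, l4, l1 ⋆ l2] * R[l1 ⋆ l2, l4] * x[l1, l2, l4] * X[l3, l1, l2 ⋆ l4] =
  X[l3 ⋆ l4, l1, l2] * x[l3, l4, l1] * R[l1, l4] * X[l3, l1, l4] * x[l3 ⋆ l1, l4, l2] * R[l2, l4].
Proof.
have [c21 c31 c41] := And3 (commuting_sym c12) (commuting_sym c13) (commuting_sym c14).
have [c32 c42 c43] := And3 (commuting_sym c23) (commuting_sym c24) (commuting_sym c34).
word; wr (hexagon1 l1 l2 l4); wr (assocK Q l1 l2 l4).
wr (slide3 R[l2, l4] Phi l3 l1 (l2 ⋆ l4)).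
have e : x[l1, l4, l2] * X[l3, l1, l4 ⋆ l2] = X[l3, l1 ⋆ l4, l2] * X[l3, l1, l4] * x[l3 ⋆ l1, l4, l2].
  lcancel (assocVK Q l1 l4 l2); word; wr (assocK Q l1 l4 l2).
  by wr (pentagon Q l3 l1 l4 l2); wr (assocK Q (l3 ⋆ l1) l4 l2).
wr e; wr (slide3 R[l1, l4] Phi l3 (l1 ⋆ l4) l2).
have e' : x[l3, l4, l1 ⋆ l2] * X[l4, l1, l2] * X[l3, l4 ⋆ l1, l2] = X[l3 ⋆ l4, l1, l2] * x[l3, l4, l1].
  lcancel (assocVK Q l3 l4 (l1 ⋆ l2)); word; wr (assocK Q l3 l4 (l1 ⋆ l2)).
  by wr <- (pentagon Q l3 l4 l1 l2); wr (assocK Q l3 l4 l1).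
by wr e'.
Qed.

(** The twist is pushed through the word of [braid_associator_word]. Each associator it passes, and
    R on legs 1, 4, is replaced by its image under S; R on legs 2, 4 survives unchanged together
    with one twist, as in f^2 R^1 ⊗ f^1 R^2. *)
Lemma twist_braid_word :
  F[l3 ⋆ l4, l1 ⋆ l2] * (x[l3, l4, l1 ⋆ l2] * R[l1 ⋆ l2, l4] * x[l1, l2, l4] *
    X[l3, l1, l2 ⋆ l4]) * G[l3 ⋆ l1, l2 ⋆ l4] * G[l3, l1] =
  G[l1, l2] * G[l3, l4] * ev3 Phi (antip Q l2) (antip Q l1) (antip Q l4 ⋆ antip Q l3) *
    Sx[l1, l4, l3] * SR[l1, l4] * SX[l4, l1, l3] *
    ev3 Phi^-1 (antip Q l2) (antip Q l4) (antip Q l1 ⋆ antip Q l3) * (F[l4, l2] * R[l2, l4]).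
Proof.
have [c21 c31 c41] := And3 (commuting_sym c12) (commuting_sym c13) (commuting_sym c14).
have [c32 c42 c43] := And3 (commuting_sym c23) (commuting_sym c24) (commuting_sym c34).
rewrite braid_associator_word.
lcancel (twistVK Q l1 l2); lcancel (twistVK Q l3 l4).
rcancel (twistK Q l3 l1); rcancel (twistK Q (l3 ⋆ l1) (l2 ⋆ l4)); word.
wr (twistVK Q l3 l1); wr (twistVK Q (l3 ⋆ l1) (l2 ⋆ l4)).
wr (twistK Q l1 l2); wr (twistK Q l3 l4).
wr (slide2 R[l2, l4] f l3 l1).
wr (slide2 F[l4, l2] f l3 l1).
wr (slide2 R[l2, l4] f (l3 ⋆ l1) (l2 ⋆ l4)).
wr <- (slide3 F[l3, l1] Phi^-1 (antip Q l2) (antip Q l4) (antip Q (l3 ⋆ l1))).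
wr (twist_associatorV (l3 ⋆ l1) l4 l2).
wr <- (twist_associator Q l3 l1 l4).
wr (slide2 X[l3, l1, l4] f (l3 ⋆ l1 ⋆ l4) l2).
wr (twist_braiding Q (R := R) l1 l4).
wr (slide2 R[l1, l4] f l3 (l1 ⋆ l4)).
wr (slide2 R[l1, l4] f (l3 ⋆ (l1 ⋆ l4)) l2).
wr (twist_associatorV l3 l4 l1).
wr (slide2 x[l3, l4, l1] f (l3 ⋆ (l4 ⋆ l1)) l2).
wr <- (slide3 F[l3, l4] Phi (antip Q l2) (antip Q l1) (antip Q (l3 ⋆ l4))).
by wr <- (twist_associator Q (l3 ⋆ l4) l1 l2).
Qed.
End Word.
End TwistWord.

(** * Linear forms for the two products *)

Section Multiplication.
Variables (K : fieldType) (H : falgType K) (Q : quasiHopf H) (R : (H ⊗ H)%type).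
Context {hR : quasiTriangular Q R}.
Local Notation Phi := (Phi Q).
Local Notation S := (antipode Q).
Local Notation Delta := (Delta Q).
Local Notation ε := (counit Q).
Local Notation "a ⋆ b" := (star Q a b).
Local Notation "X[ a , b , c ]" := (ev3 Phi a b c).
Local Notation "x[ a , b , c ]" := (ev3 Phi^-1 a b c).
Local Notation "R[ a , b ]" := (ev2 R a b).

Local Notation f := (drinfeld_twist Q).
Local Notation dualH := 'Hom(H, K^o).
Local Notation T := (lambda_map Q).
Local Notation SS := (tensor_antipode Q).
Local Notation "F[ a , b ]" := (ev2 f a b).
Local Notation "G[ a , b ]" := (ev2 f^-1 a b).
Implicit Types (c d chi psi : dualH) (P : (H ⊗ H)%type).

Definition coad c h : dualH := (c \o linfun (ad Q h))%VF.

Lemma coadE c h x : coad c h x = c (ad Q h x).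
Proof. by rewrite comp_lfunE linfun_fun //; exact: ad_linear. Qed.

Lemma ad_mul h h' x : ad Q (h * h') x = ad Q h (ad Q h' x).
Proof.
rewrite /ad rmorphM tsum_mul; last by split=> ?; lin.
apply: eq_tsum => h1 h2; rewrite (linear_tsum (g := fun y => h1 * y * _)); last by lin.
by apply: eq_tsum => h1' h2'; rewrite antipodeM !mulrA.
Qed.

(** The components of [P] are crossed because the product on the dual pairs its first factor with
    the second component of the coproduct. *)
Definition ad_word c d P (l1 l2 l3 l4 l5 l6 : H) : K^o :=
  ε l5 *: (ε l6 *: \tsum_(a ⊗ b <- P) c (l1 * b * S l2) * d (l3 * a * S l4)).
Definition ad_form c d P := six_lift (s := sixfold_tensor H) (ad_word c d P).
Local Notation M := ad_word.
Local Notation k := ad_form.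

Lemma ad_formE c d P l1 l2 l3 l4 l5 l6 :
  k c d P (six (sixfold_tensor H) l1 l2 l3 l4 l5 l6) = M c d P l1 l2 l3 l4 l5 l6.
Proof. by apply: six_liftE; do ![split] => *; rewrite /M; linc. Qed.

Lemma ad_form_linear c d P : linear (k c d P).
Proof. exact: six_lift_linear. Qed.

Lemma ad_form_ad c d P h z :
  (k c d P ((i1 ⋆ i2) h * z) = k (coad c h) d P z) *
  (k c d P ((i3 ⋆ i4) h * z) = k c (coad d h) P z).
Proof.
have lk := ad_form_linear; have kM := ad_formE.
split; move: z; apply: six_ind => [||l1 l2 l3 l4 l5 l6] //.
- by apply: (lin_comp (lk c d P)); lin.
- rewrite kM /M /star -[X in k _ _ _ (X * _)]mul1r (expand2 (lk c d P)).
  transitivity (\tsum_(h1 ⊗ h2 <- Delta h) (ε l5 *: (ε l6 *: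
    (\tsum_(a ⊗ b <- P) (c (h1 * (l1 * b * S l2) * S h2) * d (l3 * a * S l4) : K^o))))).
    by apply: eq_tsumK => x y; legs kM M;
       do 2!congr (_ *: _); apply: eq_tsumK => a b; rewrite !mulrA.
  rewrite -(linear_tsum (g := fun y : K^o => ε l5 *: (ε l6 *: y))); last by lin.
  do 2!congr (_ *: _); rewrite exchange_tsum; apply: eq_tsumK => a b.
  rewrite coadE /ad (linear_tsum (g := fun y => (c y * d (l3 * a * S l4) : K^o))) //.
  by lin.
- by apply: (lin_comp (lk c d P)); lin.
- rewrite kM /M /star -[X in k _ _ _ (X * _)]mul1r (expand2 (lk c d P)).
  transitivity (\tsum_(h1 ⊗ h2 <- Delta h) (ε l5 *: (ε l6 *:
    (\tsum_(a ⊗ b <- P) (c (l1 * b * S l2) * d (h1 * (l3 * a * S l4) * S h2) : K^o))))).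
    by apply: eq_tsumK => x y; legs kM M;
       do 2!congr (_ *: _); apply: eq_tsumK => a b; rewrite !mulrA.
  rewrite -(linear_tsum (g := fun y : K^o => ε l5 *: (ε l6 *: y))); last by lin.
  do 2!congr (_ *: _); rewrite exchange_tsum; apply: eq_tsumK => a b.
  rewrite coadE /ad (linear_tsum (g := fun y => (c (l1 * b * S l2) * d y : K^o))) //.
  by lin.
Qed.

Lemma ad_form_comul c d h :
  \tsum_(h1 ⊗ h2 <- env_comul Q R h) (c h2 * d h1 : K^o) =
  k c d (Delta h * f^-1) (x[i3, i4, i1 ⋆ i2] * R[i1 ⋆ i2, i4] * x[i1, i2, i4] * X[i3, i1, i2 ⋆ i4]).
Proof.
have lk := ad_form_linear; have kM := ad_formE.
have bcd : bilinear_fun (fun h1 h2 => (c h2 * d h1 : K^o)) by split=> ?; lin.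
have lcd := @tsum_linear _ _ _ _ (fun h1 h2 => (c h2 * d h1 : K^o)).
set P := Delta h * f^-1.
pose E x1 x2 x3 X1 X2 X3 a b : K^o :=
  \tsum_(R1 ⊗ R2 <- R) \tsum_(y1 ⊗ y2 ⊗ y3 <- Phi^-1) \tsum_(X31 ⊗ X32 <- Delta X3)
    (c (ad Q (x3 * R1) (y1 * X2 * b * S (y2 * X31))) * d (x1 * X1 * a * S (x2 * R2 * y3 * X32))).
transitivity (\tsum_(x1 ⊗ x2 ⊗ x3 <- Phi^-1) \tsum_(X1 ⊗ X2 ⊗ X3 <- Phi)
   tsum P (E x1 x2 x3 X1 X2 X3)).
  rewrite /env_comul (linear_tsum _ _ lcd); apply: eq_tsumK => x12 x3.
  rewrite (linear_tsum _ _ lcd); apply: eq_tsumK => x1 x2.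
  rewrite (linear_tsum _ _ lcd); apply: eq_tsumK => X12 X3.
  rewrite (linear_tsum _ _ lcd); apply: eq_tsumK => X1 X2.
  rewrite tsum_mul; last first.
    rewrite /E; split=> w; lin; first by apply: (lin_comp (@ad_linear _ _ Q _)); lin.
  rewrite (linear_tsum _ _ lcd); apply: eq_tsumK => h1 h2.
  rewrite (linear_tsum _ _ lcd); apply: eq_tsumK => g1 g2.
  rewrite (linear_tsum _ _ lcd); apply: eq_tsumK => R1 R2.
  rewrite (linear_tsum _ _ lcd); apply: eq_tsumK => y12 y3.
  rewrite (linear_tsum _ _ lcd); apply: eq_tsumK => y1 y2.
  rewrite (linear_tsum _ _ lcd); apply: eq_tsumK => X31 X32.
  by rewrite tsum_pure // !mulrA.
symmetry; rewrite -[X in k _ _ _ X]mul1r -!mulrA (expand3r (lk c d P)).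
apply: eq_tsumK => x12 x3; apply: eq_tsumK => x1 x2.
rewrite !mulrA -[X in k _ _ _ X]mulr1 (expand3 (lk c d P)).
apply: eq_tsumK => X12 X3; apply: eq_tsumK => X1 X2.
pose p := i1 ⋆ i2.
set w := (X in k _ _ _ X); have {w}-> : w =
    i3 x1 * i4 x2 * p x3 * (R[p, i4] * (x[i1, i2, i4] * (i3 X1 * i1 X2 * ev2 (Delta X3) i2 i4 * 1))).
  by rewrite /w !mulrA !mul1r.
rewrite (expand2r (lk c d P)) /E exchange_tsum; apply: eq_tsumK => R1 R2.
rewrite (expand3r (lk c d P)) exchange_tsum; apply: eq_tsumK => y12 y3.
rewrite exchange_tsum; apply: eq_tsumK => y1 y2.
rewrite [X in k _ _ _ X]mulrA (expand_last (lk c d P)) exchange_tsum.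
apply: eq_tsumK => X31 X32.
have comm a b z y : p a * (i3 b * (i4 z * y)) = i3 b * (i4 z * (p a * y)).
  have p3 : commuting p i3 by typeclasses eauto.
  have p4 : commuting p i4 by typeclasses eauto.
  by rewrite mulrA p3 -mulrA (mulrA (p a)) p4 -mulrA.
rewrite -!mulrA -comm -comm /p !(ad_form_ad _ _ _ _ _).1.
legs kM M; rewrite counit1 !scale1r; apply: eq_tsumK => a b.
by rewrite !coadE ad_mul.
Qed.

Definition conv_word c d x (l1 l2 l3 l4 l5 l6 : H) : K^o :=
  ε l5 *: (ε l6 *: \tsum_(a ⊗ b <- Delta x) c (l1 * S (l2 * a)) * d (l3 * S (l4 * b))).
Definition conv_form c d x := six_lift (s := sixfold_tensor H) (conv_word c d x).
Local Notation MC := conv_word.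
Local Notation kc := conv_form.

Lemma conv_formE c d x l1 l2 l3 l4 l5 l6 :
  kc c d x (six (sixfold_tensor H) l1 l2 l3 l4 l5 l6) = MC c d x l1 l2 l3 l4 l5 l6.
Proof. by apply: six_liftE; do ![split] => *; rewrite /MC; linc. Qed.

Lemma conv_form_linear c d x : linear (kc c d x).
Proof. exact: six_lift_linear. Qed.

Lemma conv_form_ad c d x h z :
  (kc c d x ((i1 ⋆ i2) h * z) = kc (coad c h) d x z) *
  (kc c d x ((i3 ⋆ i4) h * z) = kc c (coad d h) x z).
Proof.
have lk := conv_form_linear; have kM := conv_formE.
split; move: z; apply: six_ind => [||l1 l2 l3 l4 l5 l6] //.
- by apply: (lin_comp (lk c d x)); lin.
- rewrite kM /MC /star -[X in kc _ _ _ (X * _)]mul1r (expand2 (lk c d x)).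
  transitivity (\tsum_(h1 ⊗ h2 <- Delta h) (ε l5 *: (ε l6 *:
    (\tsum_(a ⊗ b <- Delta x) (c (h1 * (l1 * S (l2 * a)) * S h2) * d (l3 * S (l4 * b)) : K^o))))).
    by apply: eq_tsumK => y y'; legs kM MC;
       do 2!congr (_ *: _); apply: eq_tsumK => a b; rewrite !antipodeM !mulrA.
  rewrite -(linear_tsum (g := fun y : K^o => ε l5 *: (ε l6 *: y))); last by lin.
  do 2!congr (_ *: _); rewrite exchange_tsum; apply: eq_tsumK => a b.
  rewrite coadE /ad (linear_tsum (g := fun y => (c y * d (l3 * S (l4 * b)) : K^o))) //.
  by lin.
- by apply: (lin_comp (lk c d x)); lin.
- rewrite kM /MC /star -[X in kc _ _ _ (X * _)]mul1r (expand2 (lk c d x)).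
  transitivity (\tsum_(h1 ⊗ h2 <- Delta h) (ε l5 *: (ε l6 *:
    (\tsum_(a ⊗ b <- Delta x) (c (l1 * S (l2 * a)) * d (h1 * (l3 * S (l4 * b)) * S h2) : K^o))))).
    by apply: eq_tsumK => y y'; legs kM MC;
       do 2!congr (_ *: _); apply: eq_tsumK => a b; rewrite !antipodeM !mulrA.
  rewrite -(linear_tsum (g := fun y : K^o => ε l5 *: (ε l6 *: y))); last by lin.
  do 2!congr (_ *: _); rewrite exchange_tsum; apply: eq_tsumK => a b.
  rewrite coadE /ad (linear_tsum (g := fun y => (c (l1 * S (l2 * a)) * d y : K^o))) //.
  by lin.
Qed.

(** Δ(T(x)) f^{-1} = Δ(g^1) f^{-1} (S ⊗ S)Δ^op(g^2 x). The reversed coproduct meets the crossed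
    components of [ad_word], which is exactly the convolution. *)
Lemma conv_form_twistV c d x z :
  kc c d x (z * G[i3 ⋆ i1, i2 ⋆ i4] * G[i3, i1]) = ad_form c d (Delta (T x) * f^-1) z.
Proof.
have lk := conv_form_linear c d x; have kM := conv_formE c d x.
have -> : Delta (T x) * f^-1 = \tsum_(g1 ⊗ g2 <- f^-1) Delta g1 * f^-1 * SS (g2 * x).
  rewrite /lambda_map (linear_tsum (g := fun y => Delta y * f^-1)); last by lin.
  by apply: eq_tsum => g1 g2; rewrite rmorphM -!mulrA -twistV_conj.
have lP := @ad_form_linear c d.
move: z; apply: six_ind => [||l1 l2 l3 l4 l5 l6] //.
  by apply: (lin_comp lk); lin.
rewrite ad_formE /ad_word.
pose E a b : K^o := ε l5 *: (ε l6 *: (c (l1 * b * S l2) * d (l3 * a * S l4))).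
have bE : bilinear_fun E by rewrite /E; split=> ?; lin.
transitivity (tsum (\tsum_(g1 ⊗ g2 <- f^-1) Delta g1 * f^-1 * SS (g2 * x)) E); last first.
  rewrite /E -(linear_tsum (g := fun y : K^o => ε l5 *: (ε l6 *: y))) //.
  by lin.
rewrite [RHS](linear_tsum _ _ (tsum_linear E)) (expand2 lk).
apply: eq_tsumK => g1 g2.
rewrite -[X in kc _ _ _ X]mulr1 -(mulrA _ G[i3, i1]) {1}/star (expand_first lk).
rewrite tsum_mul // tsum_mul; last first.
  split=> w; apply: lin_tsumr => a b; [apply: (lin_comp (bE.1 _))|apply: (lin_comp (bE.2 _))]; lin.
apply: eq_tsumK => g11 g12.
rewrite [X in kc _ _ _ X]mulrA (expand2 lk); apply: eq_tsumK => h1 h2.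
rewrite tensor_antipodeE [RHS](linear_tsum (g := fun t => tsum t _)); last by lin.
transitivity (\tsum_(a ⊗ b <- Delta (g2 * x)) E (g11 * h1 * S b) (g12 * h2 * S a)); last first.
  apply: eq_tsumK => a b; rewrite tsum_pure //.
  by rewrite /E; split=> ?; lin.
rewrite rmorphM tsum_mul; last by rewrite /E; split=> ?; lin.
rewrite -[X in kc _ _ _ X]mulrA {1}/star (expand_last lk); apply: eq_tsumK => g21 g22.
legs kM MC; rewrite (linear_tsum (g := fun y : K^o => ε l5 *: (ε l6 *: y))); last by lin.
by apply: eq_tsumK => a b; rewrite /E !antipodeM !mulrA.
Qed.

Lemma lambda_map_dual_mul chi psi x :
  \tsum_(f1 ⊗ f2 <- f) \tsum_(h1 ⊗ h2 <- env_comul Q R (T x))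
    (chi (ad Q f2 h2) * psi (ad Q f1 h1) : K^o) =
  kc chi psi x (F[i3 ⋆ i4, i1 ⋆ i2] * (x[i3, i4, i1 ⋆ i2] * R[i1 ⋆ i2, i4] * x[i1, i2, i4] *
    X[i3, i1, i2 ⋆ i4]) * G[i3 ⋆ i1, i2 ⋆ i4] * G[i3, i1]).
Proof.
have lk := conv_form_linear chi psi x.
rewrite -!(mulrA F[_, _]) -[X in kc _ _ _ X]mul1r (expand2r lk).
apply: eq_tsumK => f1 f2; rewrite mul1r -mulrA.
rewrite (conv_form_ad _ _ _ _ _).2 (conv_form_ad _ _ _ _ _).1 conv_form_twistV -ad_form_comul.
by apply: eq_tsumK => h1 h2; rewrite !coadE.
Qed.

(** The two copies of f^{-1} at the left end complete the factors to values of T. *)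
Lemma conv_form_lambda c d x l1 l2 l3 l4 :
  kc c d x (G[i1, i2] * G[i3, i4] * six _ (S l1) l2 (S l3) l4 1 1) =
  \tsum_(a ⊗ b <- Delta x) (c (T (l2 * a * l1)) * d (T (l4 * b * l3)) : K^o).
Proof.
have lk := conv_form_linear c d x; have kM := conv_formE c d x.
rewrite -mulrA -[X in kc _ _ _ X]mul1r (expand2r lk) /lambda_map.
transitivity (\tsum_(g1 ⊗ g2 <- f^-1) \tsum_(g3 ⊗ g4 <- f^-1) \tsum_(a ⊗ b <- Delta x)
  (c (g1 * S (g2 * (l2 * a * l1))) * d (g3 * S (g4 * (l4 * b * l3))) : K^o)).
  apply: eq_tsumK => g1 g2; rewrite (expand2r lk).
  apply: eq_tsumK => g3 g4; legs kM MC; rewrite counit1 !scale1r.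
  by apply: eq_tsumK => a b; rewrite !antipodeM !mulrA.
transitivity (\tsum_(g1 ⊗ g2 <- f^-1) \tsum_(a ⊗ b <- Delta x) \tsum_(g3 ⊗ g4 <- f^-1)
  (c (g1 * S (g2 * (l2 * a * l1))) * d (g3 * S (g4 * (l4 * b * l3))) : K^o)).
  by apply: eq_tsumK => g1 g2; rewrite exchange_tsum.
rewrite exchange_tsum; apply: eq_tsumK => a b.
rewrite [RHS](linear_tsum (g := fun y => (c y * d _ : K^o))); last by lin.
apply: eq_tsumK => g1 g2.
by rewrite [RHS](linear_tsum (g := fun y => (_ * d y : K^o))); last by lin.
Qed.

Lemma fun_mul_lambda chi psi x :
  fun_mul Q R (lambda Q chi) (lambda Q psi) x = kc chi psi x (G[i1, i2] * G[i3, i4] *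
    ev3 Phi (antip Q i2) (antip Q i1) (antip Q i4 ⋆ antip Q i3) *
    ev3 Phi^-1 (antip Q i1) (antip Q i4) (antip Q i3) * ev2 R (antip Q i1) (antip Q i4) *
    ev3 Phi (antip Q i4) (antip Q i1) (antip Q i3) *
    ev3 Phi^-1 (antip Q i2) (antip Q i4) (antip Q i1 ⋆ antip Q i3) * (F[i4, i2] * R[i2, i4])).
Proof.
have lk := conv_form_linear chi psi x; have kM := conv_formE chi psi x.
rewrite /fun_mul tsum_lfunE (expand3 lk); apply: eq_tsumK => x12 x3.
rewrite tsum_lfunE; apply: eq_tsumK => x1 x2.
rewrite tsum_lfunE {1}/star (expand_last lk); apply: eq_tsumK => x31 x32.
rewrite tsum_lfunE -[X in kc _ _ _ X]mulrA (expand3 lk); apply: eq_tsumK => Y12 Y3.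
rewrite tsum_lfunE; apply: eq_tsumK => Y1 Y2.
rewrite tsum_lfunE -[X in kc _ _ _ X]mulrA (expand2 lk); apply: eq_tsumK => r1 r2.
rewrite tsum_lfunE -[X in kc _ _ _ X]mulrA (expand3 lk); apply: eq_tsumK => y12 y3.
rewrite tsum_lfunE; apply: eq_tsumK => y1 y2.
rewrite tsum_lfunE -[X in kc _ _ _ X]mulrA (expand3 lk); apply: eq_tsumK => X12 X3.
rewrite tsum_lfunE; apply: eq_tsumK => X1 X2.
rewrite tsum_lfunE (expand_last lk); apply: eq_tsumK => X31 X32.
rewrite tsum_lfunE !mulrA (expand2 lk); apply: eq_tsumK => f1 f2.
rewrite tsum_lfunE -[X in kc _ _ _ X]mulr1 (expand2 lk); apply: eq_tsumK => R1 R2.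
transitivity (kc chi psi x (G[i1, i2] * G[i3, i4] * six _ (S (x31 * Y2 * r1 * y1 * X2))
  (S (x1 * X1) * f2 * R1) (S (x32 * Y3 * y3 * X32)) (S (x2 * Y1 * r2 * y2 * X31) * f1 * R2) 1 1)).
  rewrite conv_form_lambda linfun_fun; last by lin.
  by apply: eq_tsumK => a b; rewrite !hitsE !(@lambdaE _ _ _ _ hR).
congr (kc _ _ _ _); rewrite -!mulrA; apply: (congr1 (fun z => G[i1, i2] * (G[i3, i4] * z))).
rewrite /antip /leg /slot /=.
by rewrite mulr1 !(six_mul (sixfold_tensor H)) ?mul1r ?mulr1 !antipodeM -!mulrA.
Qed.

(** Both products are values of one linear form, on the two sides of [twist_braid_word]. *)
Lemma lambda_dual_mul chi psi :
  lambda Q (dual_mul Q R chi psi) = fun_mul Q R (lambda Q chi) (lambda Q psi).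
Proof.
apply/lfunP => x; rewrite (@lambdaE _ _ _ _ hR) fun_mul_lambda.
have W := twist_braid_word (Q := Q) (R := R) (l1 := i1) (l2 := i2) (l3 := i3) (l4 := i4).
rewrite -W -lambda_map_dual_mul linfun_fun //.
apply: lin_tsumr => f1 f2; apply: lin_tsuml.
by rewrite /= /env_comul; lin.
Qed.
End Multiplication.

(** * Antipodes *)

Section InverseBraiding.
Variables (K : fieldType) (H : falgType K) (Q : quasiHopf H) (R : (H ⊗ H)%type).
Context {hR : quasiTriangular Q R}.
Local Notation Phi := (Phi Q).
Local Notation alpha := (alpha Q).
Local Notation beta := (beta Q).
Local Notation S := (antipode Q).
Local Notation ε := (counit Q).
Local Notation "a ⋆ b" := (star Q a b).
Local Notation "X[ a , b , c ]" := (ev3 Phi a b c).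
Local Notation "x[ a , b , c ]" := (ev3 Phi^-1 a b c).
Local Notation "R[ a , b ]" := (ev2 R a b).

Local Notation trivial := (@triv _ _ Q _).
Local Notation "r[ a , b ]" := (ev2 R^-1 a b).
Local Notation u := (drinfeld_elt Q R).
Local Notation v := (drinfeld_elt_inv Q R).

Section Images.
Variable B : falgType K.
Context (a b c : H -> B) {ha : alghom a} {hb : alghom b} {hc : alghom c}.
Context {ab : commuting a b} {ac : commuting a c} {bc : commuting b c}.

Lemma braidK : R[a, b] * r[a, b] = 1.
Proof. by rewrite -ev2M // divrr ?ev2_1 //; exact: (@braid_unit _ _ _ _ hR). Qed.

Lemma braidVK : r[a, b] * R[a, b] = 1.
Proof. by rewrite -ev2M // mulVr ?ev2_1 //; exact: (@braid_unit _ _ _ _ hR). Qed.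

Lemma braidV_star : intertwines r[a, b] (b ⋆ a) (a ⋆ b).
Proof.
move=> h; rewrite -[LHS]mulr1 -braidK !mulrA -(mulrA r[a, b]) -(@braid_star _ _ _ _ hR).
by rewrite !mulrA braidVK mul1r.
Qed.

Lemma braidV_triv2 : r[b, trivial] = 1.
Proof.
rewrite -[LHS]mul1r -[X in X * _](@braid_triv2 _ _ _ _ hR _ b) -ev2M // divrr ?ev2_1 //.
exact: (@braid_unit _ _ _ _ hR).
Qed.
End Images.
#[global] Arguments braidV_star {B} a b {_ _ _}.
#[global] Arguments braidK {B} a b {_ _ _}.
#[global] Arguments braidVK {B} a b {_ _ _}.

(** The factor S(α) closes the cup in u to a zigzag, which straightens and leaves only R. *)
Lemma antipode_alpha_elt : S alpha * u = \tsum_(R1 ⊗ R2 <- R) S R2 * alpha * R1.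
Proof.
pose M (l1 l2 l3 l4 l5 l6 : H) : H :=
  ε l5 *: (ε l6 *: (S (l2 * beta * S l3 * alpha * l4) * alpha * l1)).
have lM : multilinear6 M by do ![split] => *; rewrite /M; linc.
have [k lk kM] := six_rec (sixfold_tensor H) lM.
have c21 : lsub k (i2 ⋆ i1) trivial.
  apply: lsub_six => // p l1 l2 l3 l4 l5 l6.
  rewrite kM -(cap_alpha Q (fun z => ε l5 *: (ε l6 *:
    (S (l2 * beta * S l3 * alpha * l4) * z * l1)))); last by linc.
  by apply: eq_tsum => x y; legs kM M.
have c34 : lsub k (i3 ⋆ i4) trivial.
  apply: lsub_six => // p l1 l2 l3 l4 l5 l6.
  rewrite kM -(cap_alpha Q (fun z => ε l5 *: (ε l6 *:
    (S (l2 * beta * S l3 * z * l4) * alpha * l1)))); last by linc.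
  by apply: eq_tsum => x y; legs kM M.
have c23 : rsub k (i2 ⋆ i3) trivial.
  apply: rsub_six => // p l1 l2 l3 l4 l5 l6.
  rewrite kM -(cup_beta Q (fun z => ε l5 *: (ε l6 *:
    (S (l2 * z * S l3 * alpha * l4) * alpha * l1)))); last by linc.
  by apply: eq_tsum => x y; legs kM M.
transitivity (k (1 * X[i2 ⋆ i1, i3, i4] * (R[i1, i2] * (x[i1, i2, i3] * 1)))).
  rewrite (lsub3_1 lk c21) assoc_triv1 !mul1r -[X in k X]mul1r (expand2r lk).
  rewrite (linear_tsum (g := fun z => S alpha * z)); last by lin.
  apply: eq_tsum => R1 R2; rewrite (expand3r lk).
  rewrite (linear_tsum (g := fun z => S alpha * z)); last by lin.
  apply: eq_tsum => x12 x3; rewrite (linear_tsum (g := fun z => S alpha * z)); last by lin.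
  by apply: eq_tsum => x1 x2; legs kM M; rewrite counit1 !scale1r ?antipodeM ?mulrA.
transitivity (k (R[i1, i2] * X[i1, i2, i3 ⋆ i4] * (X[i1 ⋆ i2, i3, i4] * x[i1, i2, i3]))).
  rewrite (lsub3_3 lk c34) assoc_triv3 mulr1; congr (k _); word.
  by wr (slide3 R[i1, i2] Phi (i1 ⋆ i2) i3 i4).
transitivity (k (R[i1, i2] * X[i2, i3, i4] * X[i1, i2 ⋆ i3, i4] * 1)).
  congr (k _); word; wr <- (pentagon Q i1 i2 i3 i4).
  by wr (assocK Q i1 i2 i3).
rewrite (rsub3_2 lk c23) assoc_triv2 !mulr1.
rewrite -[X in k X]mul1r -[X in k (1 * X)]mulr1 -[X in k (1 * X)]mulrA (expand2r lk).
apply: eq_tsum => R1 R2; rewrite (expand3r lk).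
rewrite -[in RHS](mulr1 R2) -(zigzag Q (fun z => S (R2 * z) * alpha * R1)); last by lin.
apply: eq_tsum => X12 X3; apply: eq_tsum => X1 X2; legs kM M.
by rewrite counit1 !scale1r.
Qed.

(** A second formula for the inverse of u, through R^{-1}, which is what the antipode of [fun_group]
    produces. It is verified by multiplying with u: the hexagons reduce the word to the second
    zigzag axiom. *)
Lemma drinfeld_elt_inv_braidV :
  S (\tsum_(X1 ⊗ X2 ⊗ X3 <- Phi) \tsum_(r1 ⊗ r2 <- R^-1)
      S (X2 * r2 * beta * S (X1 * r1)) * alpha * X3) = v.
Proof.
set w := tsum Phi _; have [U vE] := @drinfeld_elt_unit _ _ Q _ hR.
rewrite -vE; apply: (mulIr U); rewrite mulVr //.
pose M (l1 l2 l3 l4 l5 l6 : H) : H :=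
  ε l4 *: (ε l5 *: (ε l6 *: (S l1 * alpha * l2 * beta * S l3))).
have lM : multilinear6 M by do ![split] => *; rewrite /M; linc.
have [k lk kM] := six_rec (sixfold_tensor H) lM.
have c12 : lsub k (i1 ⋆ i2) trivial.
  apply: lsub_six => // p l1 l2 l3 l4 l5 l6.
  rewrite kM -(cap_alpha Q (fun z => ε l4 *: (ε l5 *: (ε l6 *:
    (S l1 * z * l2 * beta * S l3))))); last by linc.
  by apply: eq_tsum => x y; legs kM M.
have c23 : rsub k (i2 ⋆ i3) trivial.
  apply: rsub_six => // p l1 l2 l3 l4 l5 l6.
  rewrite kM -(cup_beta Q (fun z => ε l4 *: (ε l5 *: (ε l6 *:
    (S l1 * alpha * l2 * z * S l3))))); last by linc.
  by apply: eq_tsum => x y; legs kM M.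
have -> : S w * u = k (R[i2, i1] * (X[i3, i2, i1] * (r[i3, i2] * 1))).
  rewrite -[X in k X]mul1r (expand2r lk) [RHS]/=.
  transitivity (\tsum_(X1 ⊗ X2 ⊗ X3 <- Phi) \tsum_(r1 ⊗ r2 <- R^-1) \tsum_(R1 ⊗ R2 <- R)
     S (R2 * X3) * alpha * R1 * X2 * r2 * beta * S (X1 * r1)).
    rewrite /w (linear_tsum (g := fun z => S z * u)); last by lin.
    apply: eq_tsum => X12 X3; rewrite (linear_tsum (g := fun z => S z * u)); last by lin.
    apply: eq_tsum => X1 X2; rewrite (linear_tsum (g := fun z => S z * u)); last by lin.
    apply: eq_tsum => r1 r2.
    transitivity (S X3 * (S alpha * u) * (X2 * r2 * beta * S (X1 * r1))).
      set b := X2 * r2 * beta * S (X1 * r1).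
      by rewrite antipodeM antipodeM -!mulrA (@drinfeld_elt_conj _ _ Q _ hR).
    rewrite antipode_alpha_elt (linear_tsum (g := fun z => S X3 * z * _)); last by lin.
    by apply: eq_tsum => R1 R2; rewrite !antipodeM !mulrA.
  transitivity (\tsum_(X1 ⊗ X2 ⊗ X3 <- Phi) \tsum_(R1 ⊗ R2 <- R) \tsum_(r1 ⊗ r2 <- R^-1)
     S (R2 * X3) * alpha * R1 * X2 * r2 * beta * S (X1 * r1)).
    by apply: eq_tsum => X12 X3; apply: eq_tsum => X1 X2; rewrite exchange_tsum.
  transitivity (\tsum_(R1 ⊗ R2 <- R) \tsum_(X1 ⊗ X2 ⊗ X3 <- Phi) \tsum_(r1 ⊗ r2 <- R^-1)
     S (R2 * X3) * alpha * R1 * X2 * r2 * beta * S (X1 * r1)).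
    rewrite exchange_tsum /=; apply: eq_tsum => R1 R2; rewrite exchange_tsum.
    by apply: eq_tsum => X1 X2.
  apply: eq_tsum => R1 R2; rewrite (expand3r lk).
  apply: eq_tsum => X12 X3; apply: eq_tsum => X1 X2; rewrite (expand2r lk).
  apply: eq_tsum => r1 r2; legs kM M; rewrite counit1 !scale1r.
  by rewrite ?antipodeM ?mulrA.
transitivity (k (1 * r[i3, i1 ⋆ i2] * x[i1, i2, i3])).
  transitivity (k (X[i3, i1, i2] * r[i3, i1] * x[i1, i3, i2] * r[i3, i2] * R[i2 ⋆ i3, i1] * 1)).
    congr (k _); word.
    have e : R[i2, i1] * X[i3, i2, i1] = X[i3, i1, i2] * r[i3, i1] * x[i1, i3, i2] * R[i3 ⋆ i2, i1].
      word; wr (hexagon1 (R := R) i3 i2 i1); wr (assocVK Q i1 i3 i2).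
      by wr (braidVK i3 i1); wr (assocK Q i3 i1 i2).
    by wr e; wr <- (slide2 r[i3, i2] R (i2 ⋆ i3) i1 (ia := braidV_star i3 i2)).
  rewrite (rsub2_1 lk c23) braid_triv1 !mulr1; congr (k _); rewrite mul1r.
  lcancel (braidVK i3 (i1 ⋆ i2)); word; wr (braidK i3 (i1 ⋆ i2)).
  wr (hexagon2 (R := R) i3 i1 i2); wr (assocVK Q i3 i1 i2); wr (braidK i3 i1).
  by wr (assocK Q i1 i3 i2); wr (braidK i3 i2).
rewrite (lsub2_2 lk c12) braidV_triv2 !mul1r -[X in k X]mul1r -[X in k X]mulr1 (expand3 lk).
rewrite -(zigzagV Q (fun z => z)); last by lin.
apply: eq_tsum => xy z; apply: eq_tsum => x y.
by legs kM M; rewrite counit1 !scale1r.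
Qed.
End InverseBraiding.

(** * The two antipodes composed with T *)

Section Antipode.
Variables (K : fieldType) (H : falgType K) (Q : quasiHopf H) (R : (H ⊗ H)%type).
Context {hR : quasiTriangular Q R}.
Local Notation Phi := (Phi Q).
Local Notation alpha := (alpha Q).
Local Notation beta := (beta Q).
Local Notation S := (antipode Q).
Local Notation Delta := (Delta Q).
Local Notation ε := (counit Q).
Local Notation "a ⋆ b" := (star Q a b).
Local Notation "X[ a , b , c ]" := (ev3 Phi a b c).
Local Notation "x[ a , b , c ]" := (ev3 Phi^-1 a b c).
Local Notation "R[ a , b ]" := (ev2 R a b).

Local Notation trivial := (@triv _ _ Q _).
Local Notation f := (drinfeld_twist Q).
Local Notation T := (lambda_map Q).
Local Notation "G[ a , b ]" := (ev2 f^-1 a b).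
Local Notation "r[ a , b ]" := (ev2 R^-1 a b).
Local Notation v := (drinfeld_elt_inv Q R).

Lemma tsum_pR (U : lmodType K) (E : H -> H -> U) : bilinear_fun E ->
  tsum (pR Q) E = \tsum_(x1 ⊗ x2 ⊗ x3 <- Phi^-1) E x1 (x2 * beta * S x3).
Proof.
move=> bE; have l := tsum_linear E; rewrite /pR (linear_tsum _ _ l); apply: eq_tsum => x12 x3.
by rewrite (linear_tsum _ _ l); apply: eq_tsum => x1 x2; rewrite tsum_pure.
Qed.

Lemma tsum_qR (U : lmodType K) (E : H -> H -> U) : bilinear_fun E ->
  tsum (qR Q) E = \tsum_(X1 ⊗ X2 ⊗ X3 <- Phi) E X1 (Sinv Q (alpha * X3) * X2).
Proof.
move=> bE; have l := tsum_linear E; rewrite /qR (linear_tsum _ _ l); apply: eq_tsum => x12 x3.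
by rewrite (linear_tsum _ _ l); apply: eq_tsum => x1 x2; rewrite tsum_pure.
Qed.

Lemma tsum_pL (U : lmodType K) (E : H -> H -> U) : bilinear_fun E ->
  tsum (pL Q) E = \tsum_(X1 ⊗ X2 ⊗ X3 <- Phi) E (X2 * Sinv Q (X1 * beta)) X3.
Proof.
move=> bE; have l := tsum_linear E; rewrite /pL (linear_tsum _ _ l); apply: eq_tsum => x12 x3.
by rewrite (linear_tsum _ _ l); apply: eq_tsum => x1 x2; rewrite tsum_pure.
Qed.

Definition antipode_word h (l1 l2 l3 l4 l5 l6 : H) : H :=
  ε l5 *: (ε l6 *: (l3 * beta * S (l1 * h * S l2 * alpha * l4))).
Definition antipode_form h := six_lift (s := sixfold_tensor H) (antipode_word h).
Local Notation M := antipode_word.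
Local Notation k := antipode_form.

Lemma antipode_formE h l1 l2 l3 l4 l5 l6 :
  k h (six (sixfold_tensor H) l1 l2 l3 l4 l5 l6) = M h l1 l2 l3 l4 l5 l6.
Proof. by apply: six_liftE; do ![split] => *; rewrite /M; linc. Qed.

Lemma antipode_form_linear h : linear (k h).
Proof. exact: six_lift_linear. Qed.

Lemma antipode_form_pure h z (t : (H ⊗ H)%type) :
  k h (z * ev2 t i1 i2) = k (\tsum_(x ⊗ y <- t) x * h * S y) z.
Proof.
have lk := antipode_form_linear; have kM := antipode_formE.
move: z; apply: six_ind => [||l1 l2 l3 l4 l5 l6] //.
  by apply: (lin_comp (lk h)); lin.
rewrite kM /M -[X in k h X]mulr1 (expand2 (lk h)).
rewrite [in RHS](linear_tsum (g := fun y => ε l5 *: (ε l6 *: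
  (l3 * beta * S (l1 * y * S l2 * alpha * l4))))); last by linc.
by apply: eq_tsum => x y; legs kM M.
Qed.

(* The common value of S_env \o T and of the argument of the antipode of fun_group. *)
Definition antipode_value (x : H) : H :=
  \tsum_(R1 ⊗ R2 <- R) \tsum_(g1 ⊗ g2 <- f^-1) R2 * g2 * v * S (S x) * S (R1 * g1).

Lemma antipode_form_env h :
  env_antipode Q R h = k h (X[i1, i2, i4] * X[i3, i1 ⋆ i2, i4] * R[i1 ⋆ i2, i3] * x[i1 ⋆ i2, i3, i4]).
Proof.
have lk := antipode_form_linear; have kM := antipode_formE.
pose p := i1 ⋆ i2.
have p3 : commuting p i3 by typeclasses eauto.
have p4 : commuting p i4 by typeclasses eauto.
rewrite /env_antipode -!(mulrA X[i1, i2, i4]) -[X in k h (_ * X)]mulrA [X in k h X]mulrA.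
rewrite (expand3 (lk h)).
apply: eq_tsum => X12 X3; apply: eq_tsum => X1 X2.
rewrite [X in k h X]mulrA (expand2 (lk h)).
apply: eq_tsum => R1 R2.
rewrite tsum_pR; last first.
  by rewrite /ad; split=> ?; lin.
rewrite -[X in k h X]mulr1 (expand3 (lk h)).
apply: eq_tsum => x12 x3; apply: eq_tsum => x1 x2.
rewrite tsum_qR; last first.
  by rewrite /ad; split=> ?; lin.
rewrite -!mulrA -[X in k h X]mul1r (expand3r (lk h)).
apply: eq_tsum => Y12 Y3; apply: eq_tsum => Y1 Y2.
have p3r a b y : p a * (i3 b * y) = i3 b * (p a * y) by rewrite mulrA p3 -mulrA.
have p4r a b y : p a * (i4 b * y) = i4 b * (p a * y) by rewrite mulrA p4 -mulrA.
have [_ p1 pM] : alghom p by typeclasses eauto.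
set w := (X in k h X); have {w}-> : w = (i1 Y1 * i2 Y2 * i4 Y3 *
    (i3 X1 * i4 X3 * i3 R2 * i3 x2 * i4 x3)) * ev2 (Delta (X2 * R1 * x1)) i1 i2.
  rewrite -[ev2 _ _ _]/(p (X2 * R1 * x1)) !pM /w -/p -!mulrA mul1r !(p3r, p4r) !mulr1.
  by [].
rewrite antipode_form_pure -/(ad Q _ _).
by legs kM M; rewrite counit1 !scale1r antipode_Sinv !antipodeM !mulrA.
Qed.

(** The hexagon splits R on 1 ⋆ 2. After the deletions on 2 ⋆ 4 and 3 ⋆ 4 there remain R on legs 1,
    3, the copy of f^{-1}, and the word of v, which [drinfeld_elt_inv_conj] moves past g^2. *)
Lemma env_antipode_lambda x : env_antipode Q R (T x) = antipode_value x.
Proof.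
have lk := antipode_form_linear (S x); have kM := antipode_formE (S x).
set kk := k (S x) in lk kM.
have c24 : lsub kk (i2 ⋆ i4) trivial.
  apply: lsub_six => // p l1 l2 l3 l4 l5 l6.
  rewrite kM -(cap_alpha Q (fun z => ε l5 *: (ε l6 *:
    (l3 * beta * S (l1 * S x * S l2 * z * l4))))); last by linc.
  by apply: eq_tsum => a b; legs kM M.
have c34 : rsub kk (i3 ⋆ i4) trivial.
  apply: rsub_six => // p l1 l2 l3 l4 l5 l6.
  rewrite kM -(cup_beta Q (fun z => ε l5 *: (ε l6 *:
    (l3 * z * S (l1 * S x * S l2 * alpha * l4))))); last by linc.
  by apply: eq_tsum => a b; legs kM M.
have TE : T x = \tsum_(g1 ⊗ g2 <- f^-1) g1 * S x * S g2.
  by apply: eq_tsum => g1 g2; rewrite antipodeM mulrA.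
rewrite TE antipode_form_env -antipode_form_pure -/kk.
transitivity (kk (R[i1, i3] * X[i3, i2, i4] * R[i2, i3] * x[i2, i3, i4] *
    (X[i1, i2, i3 ⋆ i4] * G[i1, i2]))).
  transitivity (kk (R[i1, i3] * x[i1, i3, i2 ⋆ i4] * (X[i3, i2, i4] * R[i2, i3] *
    x[i2, i3, i4] * (X[i1, i2, i3 ⋆ i4] * G[i1, i2])))); last first.
    by rewrite (lsub3_3 lk c24) assocV_triv3 mulr1; congr (kk _); rewrite !mulrA.
  transitivity (kk (1 * X[i3, i1, i2 ⋆ i4] * (R[i1, i3] * x[i1, i3, i2 ⋆ i4] * (X[i3, i2, i4] *
    R[i2, i3] * x[i2, i3, i4] * (X[i1, i2, i3 ⋆ i4] * G[i1, i2]))))); last first.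
    by rewrite (lsub3_3 lk c24) assoc_triv3 !mul1r.
  congr (kk _); word.
  wr (hexagon1 (R := R) i1 i2 i3); wr (pentagon Q i3 i1 i2 i4).
  wr <- (slide3 R[i1, i3] Phi (i1 ⋆ i3) i2 i4).
  have e : X[i1 ⋆ i3, i2, i4] * x[i1, i3, i2] =
      x[i1, i3, i2 ⋆ i4] * X[i3, i2, i4] * X[i1, i3 ⋆ i2, i4].
    lcancel (assocVK Q i1 i3 (i2 ⋆ i4)); word; wr (assocK Q i1 i3 (i2 ⋆ i4)).
    by wr <- (pentagon Q i1 i3 i2 i4); wr (assocK Q i1 i3 i2).
  wr e; wr <- (slide3 R[i2, i3] Phi i1 (i2 ⋆ i3) i4).
  have e' : X[i1, i2 ⋆ i3, i4] * X[i1, i2, i3] * x[i1 ⋆ i2, i3, i4] =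
      x[i2, i3, i4] * X[i1, i2, i3 ⋆ i4].
    lcancel (assocVK Q i2 i3 i4); word; wr (assocK Q i2 i3 i4).
    by wr (pentagon Q i1 i2 i3 i4); wr (assocK Q (i1 ⋆ i2) i3 i4).
  by wr e'.
rewrite mulrA (rsub3_3 lk c34) assoc_triv3 mulr1.
rewrite -!mulrA -[X in kk X]mul1r (expand2r lk); apply: eq_tsum => R1 R2.
rewrite mul1r; move Ea: (i1 R1 * i3 R2) => a; rewrite !mulrA -[X in kk X]mulr1 (expand2 lk).
apply: eq_tsum => g1 g2.
rewrite -(mulrA R2) (drinfeld_elt_inv_conj (hR := hR)) /drinfeld_elt_inv.
pose F z := R2 * (z * S (S g2)) * S (S x) * S (R1 * g1).
rewrite -[RHS]/(F (tsum Phi _)) (linear_tsum (g := F)); last by rewrite /F; lin.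
rewrite -!mulrA (expand3r lk) /=; apply: eq_tsum => X12 X3.
rewrite (linear_tsum (g := F)); last by rewrite /F; lin.
apply: eq_tsum => X1 X2; rewrite (linear_tsum (g := F)); last by rewrite /F; lin.
rewrite (expand2r lk); apply: eq_tsum => r1 r2.
rewrite (linear_tsum (g := F)); last by rewrite /F; lin.
rewrite (expand3r lk); apply: eq_tsum => x12 x3.
rewrite (linear_tsum (g := F)); last by rewrite /F; lin.
apply: eq_tsum => x1 x2; rewrite -Ea; legs kM M; rewrite counit1 !scale1r /F.
by rewrite !antipodeM !mulrA.
Qed.

Local Notation dualH := 'Hom(H, K^o).

Definition fun_antipode_word x (l1 l2 l3 l4 l5 l6 : H) : H :=
  ε l5 *: (ε l6 *:
    \tsum_(g1 ⊗ g2 <- f^-1) g1 * S (S (l3 * beta * S l2) * alpha * l4) * S (S x) * S (g2 * S l1)).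
Definition fun_antipode_form x := six_lift (s := sixfold_tensor H) (fun_antipode_word x).
Local Notation M' := fun_antipode_word.
Local Notation k' := fun_antipode_form.

Lemma fun_antipode_formE x l1 l2 l3 l4 l5 l6 :
  k' x (six (sixfold_tensor H) l1 l2 l3 l4 l5 l6) = M' x l1 l2 l3 l4 l5 l6.
Proof. by apply: six_liftE; do ![split] => *; rewrite /M'; linc. Qed.

Lemma fun_antipode_form_linear x : linear (k' x).
Proof. exact: six_lift_linear. Qed.

Lemma fun_antipode_lambda (chi : dualH) x : fun_antipode Q R (lambda Q chi) x =
  chi (k' x (X[i2 ⋆ i1, i3, i4] * r[i2 ⋆ i1, i3] * X[i3, i2, i1])).
Proof.
set cT := lambda Q chi.
pose kk (z : six_alg (sixfold_tensor H)) : K^o := chi (k' x z).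
have lk : linear kk by apply: lin_lfun; exact: fun_antipode_form_linear.
have kM l1 l2 l3 l4 l5 l6 : kk (six (sixfold_tensor H) l1 l2 l3 l4 l5 l6) =
    chi (M' x l1 l2 l3 l4 l5 l6) by rewrite /kk fun_antipode_formE.
rewrite -[RHS]/(kk _) /fun_antipode tsum_lfunE.
transitivity (\tsum_(q1 ⊗ q2 <- qR Q) \tsum_(q11 ⊗ q12 <- Delta q1)
  \tsum_(Ri1 ⊗ Ri2 <- R^-1) \tsum_(Ri11 ⊗ Ri12 <- Delta Ri1) \tsum_(p1 ⊗ p2 <- pL Q)
    (cT (S (q2 * Ri2 * S (q11 * Ri11 * p1) * x * (q12 * Ri12 * p2))) : K^o)).
  apply: eq_tsumK => q1 q2; rewrite tsum_lfunE.
  apply: eq_tsumK => q11 q12; rewrite tsum_lfunE.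
  apply: eq_tsumK => Ri1 Ri2; rewrite tsum_lfunE.
  apply: eq_tsumK => Ri11 Ri12; rewrite tsum_lfunE.
  by apply: eq_tsumK => p1 p2; rewrite hitsE comp_lfunE.
rewrite tsum_qR; last by split=> ?; lin.
rewrite -[X in kk X]mulrA -[X in kk X]mul1r (expand3r lk).
apply: eq_tsumK => X12 X3; apply: eq_tsumK => X1 X2.
rewrite {1}/star -(mulrA (ev2 (Delta X1) _ _)) (expand_first lk).
apply: eq_tsumK => X11 X12'.
rewrite (expand2r lk); apply: eq_tsumK => Ri1 Ri2.
rewrite {1}/star (expand_first lk); apply: eq_tsumK => Ri11 Ri12.
rewrite tsum_pL; last by split=> ?; lin.
rewrite -[X in kk X]mulr1 (expand3 lk).
apply: eq_tsumK => Y12 Y3; apply: eq_tsumK => Y1 Y2.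
rewrite /cT (lambdaE (hR := hR)); legs kM M'; rewrite counit1 !scale1r /lambda_map; congr (chi _).
apply: eq_tsum => g1 g2.
by rewrite !(antipodeM, antipode_Sinv) !mulrA.
Qed.

Lemma twistV_braiding (B : falgType K) (a b : H -> B) {ha : alghom a} {hb : alghom b}
    {ab : commuting a b} :
  G[b, a] * ev2 R (antip Q a) (antip Q b) = R[a, b] * G[a, b].
Proof.
lcancel (twistVK Q b a); rcancel (twistK Q a b); word.
by wr (twistK Q b a); wr (twistVK Q a b); wr (twist_braiding Q (R := R) a b).
Qed.

(** [twistV_braiding] trades R f^{-1} for the flip of f^{-1} times (S ⊗ S)(R). *)
Lemma antipode_value_braid x : antipode_value x =
  \tsum_(R1 ⊗ R2 <- R) \tsum_(g1 ⊗ g2 <- f^-1) g1 * S R2 * v * S (S x) * S (g2 * S R1).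
Proof.
pose M (l1 l2 l3 l4 l5 l6 : H) : H :=
  ε l3 *: (ε l4 *: (ε l5 *: (ε l6 *: (l2 * v * S (S x) * S l1)))).
have lM : multilinear6 M by do ![split] => *; rewrite /M; linc.
have [k lk kM] := six_rec (sixfold_tensor H) lM.
transitivity (k (R[i1, i2] * G[i1, i2])).
  rewrite -[X in k X]mulr1 -[X in k X]mulrA -[X in k X]mul1r (expand2r lk).
  apply: eq_tsum => R1 R2; rewrite (expand2r lk); apply: eq_tsum => g1 g2.
  by legs kM M; rewrite counit1 !scale1r ?antipodeM ?mulrA.
rewrite -twistV_braiding -[X in k X]mulr1 (expand2 lk); apply: eq_tsum => R1 R2.
rewrite -[X in k X]mulrA -[X in k X]mul1r (expand2r lk); apply: eq_tsum => g1 g2.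
by rewrite /antip; legs kM M; rewrite counit1 !scale1r ?antipodeM ?mulrA.
Qed.

(** The hexagon splits R^{-1} on 2 ⋆ 1. The copy on legs 1, 3 is exchanged for R on legs 1, 4, and
    the copy on legs 2, 3 belongs to the word of v in [drinfeld_elt_inv_braidV]. *)
Lemma fun_antipode_form_value x :
  k' x (X[i2 ⋆ i1, i3, i4] * r[i2 ⋆ i1, i3] * X[i3, i2, i1]) = antipode_value x.
Proof.
have lk := fun_antipode_form_linear x; have kM := fun_antipode_formE x.
set kk := k' x in lk kM *.
have c34 : lsub kk (i3 ⋆ i4) trivial.
  apply: lsub_six => // p l1 l2 l3 l4 l5 l6.
  rewrite kM -(cap_alpha Q (fun z => ε l5 *: (ε l6 *:
    \tsum_(g1 ⊗ g2 <- f^-1) g1 * S (S (l3 * beta * S l2) * z * l4) * S (S x) * S (g2 * S l1)))).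
    by apply: eq_tsum => a b; legs kM M'.
  by linc.
have c32 : rsub kk (i3 ⋆ i2) trivial.
  apply: rsub_six => // p l1 l2 l3 l4 l5 l6.
  rewrite kM -(cup_beta Q (fun z => ε l5 *: (ε l6 *:
    \tsum_(g1 ⊗ g2 <- f^-1) g1 * S (S (l3 * z * S l2) * alpha * l4) * S (S x) * S (g2 * S l1)))).
    by apply: eq_tsum => a b; legs kM M'.
  by linc.
transitivity (kk (X[i2, i3, i4] * r[i2, i3] * R[i1, i4])); last first.
  rewrite antipode_value_braid -[X in kk X]mulr1 (expand2 lk).
  apply: eq_tsum => R1 R2; rewrite -drinfeld_elt_inv_braidV.
  pose F z := \tsum_(g1 ⊗ g2 <- f^-1) g1 * S R2 * S z * S (S x) * S (g2 * S R1).
  rewrite -[RHS]/(F (tsum Phi _)) (linear_tsum (g := F)); last by rewrite /F; lin.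
  rewrite -[X in kk (X * _)]mulrA -[X in kk X]mulrA -[X in kk X]mul1r (expand3r lk).
  apply: eq_tsum => X12 X3; rewrite (linear_tsum (g := F)); last by rewrite /F; lin.
  apply: eq_tsum => X1 X2; rewrite (linear_tsum (g := F)); last by rewrite /F; lin.
  rewrite -[X in kk (_ * X)]mulrA (expand2r lk); apply: eq_tsum => r1 r2.
  legs kM M'; rewrite counit1 !scale1r; apply: eq_tsum => g1 g2.
  by rewrite ?antipodeM ?mulrA.
transitivity (kk (1 * X[i2, i3 ⋆ i4, i1] * (X[i2, i3, i4] * r[i2, i3] *
    x[i3 ⋆ i2, i4, i1] * R[i1, i4] * X[i3 ⋆ i2, i1, i4] * 1))); last first.
  rewrite (lsub3_2 lk c34) assoc_triv2 !mul1r (rsub3_1 lk c32) assoc_triv1 !mulr1.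
  by rewrite (rsub3_1 lk c32) assocV_triv1 mulr1.
pose Z := X[i1, i3, i4] * r[i1, i3] * X[i2, i3 ⋆ i1, i4] * X[i2, i3, i1] * r[i2, i3].
transitivity (kk (1 * x[i2, i1, i3 ⋆ i4] * Z)).
  congr (kk _); rewrite /Z; word.
  wr (slide3 r[i1, i3] Phi i2 (i3 ⋆ i1) i4 (ib := braidV_star i1 i3)).
  lcancel (assocVK Q i2 i1 (i3 ⋆ i4)); wr (assocK Q i2 i1 (i3 ⋆ i4)).
  wr <- (pentagon Q i2 i1 i3 i4).
  have e : r[i2 ⋆ i1, i3] * X[i3, i2, i1] = x[i2, i1, i3] * r[i1, i3] * X[i2, i3, i1] * r[i2, i3].
    lcancel (braidVK (hR := hR) (i2 ⋆ i1) i3); word; wr (braidK (hR := hR) (i2 ⋆ i1) i3).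
    wr (hexagon1 (R := R) i2 i1 i3); wr (assocK Q i2 i1 i3).
    wr (braidK (hR := hR) i1 i3); wr (assocVK Q i2 i3 i1).
    by wr (braidK (hR := hR) i2 i3).
  by wr e; wr (assocK Q i2 i1 i3).
(* R on 1, 3 ⋆ 4 is trivial under the cap. Expanded by the hexagon it contains R on 1, 3, which
   cancels R^{-1} there and leaves R on 1, 4. *)
rewrite (lsub3_3 lk c34) assocV_triv3 !mul1r; transitivity (kk (1 * R[i1, i3 ⋆ i4] * Z)).
  by rewrite (lsub2_2 lk c34) (@braid_triv2 _ _ _ _ hR) !mul1r.
congr (kk _); rewrite /Z; word.
wr (hexagon2 (R := R) i1 i3 i4); wr (assocVK Q i1 i3 i4); wr (braidK (hR := hR) i1 i3).
wr (pentagon Q i2 i3 i1 i4); wr (slide3 R[i1, i4] Phi i2 i3 (i1 ⋆ i4)).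
have e : x[i3, i4, i1] * X[i2, i3, i4 ⋆ i1] =
    X[i2, i3 ⋆ i4, i1] * X[i2, i3, i4] * x[i2 ⋆ i3, i4, i1].
  lcancel (assocVK Q i3 i4 i1); word; wr (assocK Q i3 i4 i1).
  by wr (pentagon Q i2 i3 i4 i1); wr (assocK Q (i2 ⋆ i3) i4 i1).
wr e; wr <- (slide3 r[i2, i3] Phi (i3 ⋆ i2) i1 i4 (ia := braidV_star i2 i3)).
wr (slide2 R[i1, i4] R^-1 i2 i3).
by wr <- (slide3 r[i2, i3] Phi^-1 (i3 ⋆ i2) i4 i1 (ia := braidV_star i2 i3)).
Qed.
End Antipode.

(** * The counit, and assembly of the isomorphism *)

Section Counit.
Variables (K : fieldType) (H : falgType K) (Q : quasiHopf H) (R : (H ⊗ H)%type).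
Local Notation ε := (counit Q).
Local Notation T := (lambda_map Q).

(** Applying ε to [twistV_alpha] gives ε(g^1) ε(g^2) = 1. *)
Lemma counit_lambda_map x : ε (T x) = ε x.
Proof.
have le : linear (fun z => ε z : K^o) by exact: (@counit_linear _ _ Q).
have e : \tsum_(g1 ⊗ g2 <- (drinfeld_twist Q)^-1) (ε g1 * ε g2 : K^o) = 1.
  pose proof (congr1 ε (twistV_alpha Q)) as e.
  rewrite counit_antipode [RHS]eps_beta in e; rewrite -[RHS]e (linear_tsum _ _ le).
  apply: eq_tsumK => g1 g2.
  by rewrite !counitM counit_antipode [counit Q (alpha Q)]eps_alpha mulr1.
rewrite /lambda_map (linear_tsum _ _ le) -[RHS]mul1r -[X in X * _]e.
rewrite (linear_tsum (g := fun y : K^o => y * ε x)); last by lin.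
by apply: eq_tsumK => g1 g2; rewrite counitM counit_antipode counitM mulrA.
Qed.
End Counit.

Theorem proposition5p2 (K : fieldType) (H : falgType K) (Q : quasiHopf H)
    (R : (H ⊗ H)%type) (hR : quasiTriangular Q R) :
  hopfIso (env_group_dual Q R) (fun_group Q R) (@lambda K H Q) /\
  (forall (chi : 'Hom(H, K^o)) (h : H),
     lambda Q chi h =
     \tsum_(g1 ⊗ g2 <- (drinfeld_twist Q)^-1) chi (g1 * antipode Q (g2 * h))).
Proof.
have lE := @lambdaE K H Q R hR; have lT := @lambda_map_linear K H Q.
split; last first.
  by move=> chi h; rewrite lE /lambda_map (linear_tsum (g := fun y => chi y)) //; lin.
split.
- exact: (@lambda_linear _ _ _ _ hR).
- exact: (@lambda_bij _ _ _ _ hR).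
- move=> h chi; apply/lfunP => x; rewrite lE /= /fun_act tsum_lfunE.
  rewrite linfun_fun; last by apply: lin_lfun; exact: ad_linear.
  rewrite -[h_act _ _ _]/(ad Q (antipode Q h) (lambda_map Q x)) -lambda_map_ad.
  rewrite (linear_tsum (g := fun y => chi y)); last by lin.
  by apply: eq_tsumK => h1 h2; rewrite hitsE lE.
- exact: (@lambda_dual_mul _ _ _ _ hR).
- apply/lfunP => x; rewrite lE /= !linfun_fun; try exact: linearP.
  exact: (counit_lambda_map Q x).
- move=> chi; apply: dual_pair_ext => x y.
  rewrite -!/(dual_pair _ x y) (@dual_pair_tmap _ _ _ _ hR) /= dual_pair_comul.
  rewrite dual_pair_fun_comul lE -lambda_map_comul; congr (chi _).
  rewrite (linear_tsum _ _ lT); apply: eq_tsum => x12 x3.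
  rewrite (linear_tsum _ _ lT); apply: eq_tsum => x1 x2.
  rewrite (linear_tsum _ _ lT); apply: eq_tsum => x31 x32.
  rewrite (linear_tsum _ _ lT); apply: eq_tsum => X12 X3.
  by rewrite (linear_tsum _ _ lT).
- by move=> chi; rewrite /= lE (@lambda_map_alpha _ _ _ _ hR).
- move=> chi; apply/lfunP => x; rewrite lE /= linfun_fun; last first.
    by apply: lin_lfun; rewrite /= /env_antipode /ad; lin.
  rewrite -[h_antipode _ _]/(env_antipode Q R (lambda_map Q x)).
  by rewrite (@env_antipode_lambda _ _ _ _ hR)
    (@fun_antipode_lambda _ _ _ _ hR)
    (@fun_antipode_form_value _ _ _ _ hR).
Qed.
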